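(* Let $H\in(0,1)$, $\alpha>0$, let $S_H$ be a sub-fractional Brownian motion with index $H$, and let $S_H^{\mathrm{LT}}(t)=e^{-\alpha H t}S_H(e^{\alpha t})$ for $t\in\mathbb{R}$. Let $f\in L^1(\mathbb{P})$. Then $$\frac1T\int_0^T f(S_H^{\mathrm{LT}}(s))\,ds\ \xrightarrow[T\to\infty]{a.s.}\ \mathbb{E}\bigl[f(S_H^{\mathrm{LT}}(0))\bigr].$$ Moreover, $$S_H(t)=t^{\alpha H}\,S_H^{\mathrm{LT}}\!\left(\frac{\log t}{\alpha}\right),\qquad t>0.$$ In particular, for integers $k\ge1$, $$\frac1T\int_0^T (S_H^{\mathrm{LT}}(s))^k\,ds\ \xrightarrow[T\to\infty]{a.s.}\ \mathbb{E}\bigl[(S_H^{\mathrm{LT}}(0))^k\bigr],$$ and $$\mathbb{E}[S_H(t)^k]=t^{k\alpha H}\,\mathbb{E}\bigl[(S_H^{\mathrm{LT}}(0))^k\bigr],\qquad t>0.$$ Choosing $f(x)=e^{iux}$ yields almost sure convergence of the time-averaged characteristic function $\frac1T\int_0^T e^{iuS_H^{\mathrm{LT}}(s)}\,ds$ to $\mathbb{E}[e^{iuS_H^{\mathrm{LT}}(0)}]$ as $T\to\infty$, and shows that the one-time law of $S_H(t)$ can be reconstructed from a single long trajectory of $S_H^{\mathrm{LT}}$.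
   Context: A sub-fractional Brownian motion $S_H=\{S_H(t)\}_{t\ge 0}$ with index $H\in(0,1)$ is a centred Gaussian process with covariance $$\mathbb{E}[S_H(s)S_H(t)]=s^{2H}+t^{2H}-\tfrac12\bigl((s+t)^{2H}+|t-s|^{2H}\bigr),\qquad s,t\ge0.$$ Here $f$ is a function on the state space and $f\in L^1(\mathbb{P})$ is read as integrability of $f(S_H^{\mathrm{LT}}(0))$ under the underlying probability measure $\mathbb{P}$.
   Formalization: The exponents of t are corrected from αH and kαH to H and kH (the printed ones fail for α ≠ 1, since S^LT(log t/α) = t^{-H} S_H(t)); S_H is assumed jointly measurable in time and outcome so that the time integrals make sense. *)

(* Defs.v *)
From HB Require Import structures.
From mathcomp Require Import all_boot all_order all_algebra.
From mathcomp Require Import all_classical all_reals all_analysis.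
From mathcomp Require Import complex.
Set Implicit Arguments.
Unset Strict Implicit.
Unset Printing Implicit Defensive.
Import Order.TTheory GRing.Theory Num.Theory.
Import numFieldNormedType.Exports.
Local Open Scope classical_set_scope.
Local Open Scope ring_scope.

(* Processes indexed by [0, +oo[ are functions R -> T -> R on which nothing is
   assumed at negative times. *)

(* The library's normal_prob m 0 is the uniform law on [0, 1], so the
   degenerate Gaussian law is treated apart. *)
Definition gaussian_law (R : realType) (m s : R) (A : set R) : \bar R :=
  if s == 0 then \d_m A else normal_prob m s A.

Definition gaussian_rv (d : measure_display) (T : measurableType d)
    (R : realType) (P : probability T R) (X : T -> R) : Prop :=
  measurable_fun setT X /\
  exists m s : R, 0 <= s /\
    forall A : set R, measurable A -> P (X @^-1` A) = gaussian_law m s A.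

Definition gaussian_process (d : measure_display) (T : measurableType d)
    (R : realType) (P : probability T R) (X : R -> T -> R) : Prop :=
  forall (n : nat) (t c : 'I_n -> R), (forall i, 0 <= t i) ->
    gaussian_rv P (fun w => \sum_(i < n) c i * X (t i) w).

Definition subfBm (d : measure_display) (T : measurableType d)
    (R : realType) (P : probability T R) (H : R) (X : R -> T -> R) : Prop :=
  [/\ gaussian_process P X,
      forall t, 0 <= t -> ('E_P[X t] = 0)%E
    & forall s t, 0 <= s -> 0 <= t ->
        'E_P[X s \* X t]%E =
          (s `^ (2 * H) + t `^ (2 * H)
           - 2^-1 * ((s + t) `^ (2 * H) + `|t - s| `^ (2 * H)))%:E].

(* Joint measurability in (time, omega), needed for time integrals of the
   sample paths to make sense; it holds when the paths are continuous. *)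
Definition jointly_measurable (d : measure_display) (T : measurableType d)
    (R : realType) (X : R -> T -> R) : Prop :=
  measurable_fun ([set t : R | 0 <= t] `*` [set: T])
    (fun p : R * T => X p.1 p.2).

Definition lamperti (T : Type) (R : realType) (H alpha : R) (X : R -> T -> R)
    (t : R) (w : T) : R :=
  expR (- (alpha * H * t)) * X (expR (alpha * t)) w.

(* With values in \bar R: for measurable x, convergence to a finite limit as
   T --> +oo entails that x is integrable on every [0, T]. *)
Definition time_avg (R : realType) (x : R -> R) (T : R) : \bar R :=
  ((T^-1)%:E * \int[lebesgue_measure]_(s in `[0%R, T]) (x s)%:E)%E.

Definition cintegrable (d : measure_display) (T : measurableType d)
    (R : realType) (mu : {measure set T -> \bar R}) (D : set T)
    (f : T -> R[i]) : Prop :=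
  mu.-integrable D (fun x => (complex.Re (f x))%:E) /\
  mu.-integrable D (fun x => (complex.Im (f x))%:E).

Definition cintegral (d : measure_display) (T : measurableType d)
    (R : realType) (mu : {measure set T -> \bar R}) (D : set T)
    (f : T -> R[i]) : R[i] :=
  Complex (Rintegral mu D (fun x => complex.Re (f x)))
          (Rintegral mu D (fun x => complex.Im (f x))).

Definition cmeasurable (R : realType) (f : R -> R[i]) : Prop :=
  measurable_fun setT (fun x => complex.Re (f x)) /\
  measurable_fun setT (fun x => complex.Im (f x)).

Definition ctime_avg (R : realType) (x : R -> R[i]) (T : R) : R[i] :=
  (T^-1)%:C%C * cintegral lebesgue_measure `[0, T] x.

(* cexpi x = e^(i x) *)
Definition cexpi (R : realType) (x : R) : R[i] := (cos x +i* sin x)%C.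

(* Main.v *)
Require Import Defs.
From HB Require Import structures.
From mathcomp Require Import all_boot all_order all_algebra.
From mathcomp Require Import all_classical all_reals all_analysis.
From mathcomp Require Import complex.
From mathcomp Require Import measurable_realfun.
From mathcomp Require Import ring lra.
Import Order.TTheory GRing.Theory Num.Theory.
Import numFieldNormedType.Exports.
Set Implicit Arguments.
Unset Strict Implicit.
Unset Printing Implicit Defensive.
Local Open Scope classical_set_scope.
Local Open Scope ring_scope.

(* The Lamperti transform X of a sub-fractional Brownian motion is a centred
   stationary Gaussian process whose covariance r(s - t) is continuous at 0 and
   decays exponentially. Every equality in law is read off the integrals of
   cos (th + l), with l a linear combination of coordinates: the span of these
   functions is an algebra, and an algebra of bounded functions approximates in
   L^1 the indicators of the sets {f > 0}, since the sign is a pointwise limit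
   of polynomials bounded on [-1, 1].

   For f(x) = cos (th + u x) the covariance of f(X_s) and f(X_t) is
   O(1 / |s - t|), so the time average over [0, T] has variance O(T^(-1/2)); it
   converges almost surely along T = (n + 1)^4, hence along all T because f is
   bounded. A general f in L^1 of the law of X_0 is approximated in L^1 by a
   trigonometric polynomial q, and the maximal ergodic inequality for the
   stationary sequence of the integrals of |f - q|(X) over [k, k + 1] controls
   the averages of the error. This avoids invariant sigma-algebras altogether.

   The time averages of cos (th + u X) are Lipschitz in u, with the average of
   |X| as constant, so one null set serves all u; the characteristic function
   then determines the law. *)

(** The mixing estimate involves two times only, but the maximal inequality needs the joint law of
    all the unit integrals, and such an integral is not a function of finitely many coordinates.
    Mean continuity, a consequence of the continuity of r at 0, replaces it by a Riemann sum, so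
    that invariance of the finite-dimensional cosines under a shift by one is enough. Running maxima
    are then reached because the L^1 closure of an algebra is a lattice.

    The rate T^(-1/2) comes from cutting the double time integral at |s - t| = sqrt T: both sides of
    the cut cost a multiple of T^(3/2). Along T = (n + 1)^4 the variance is of order 1 / (n + 1)^2,
    which is summable, while the ratio of consecutive fourth powers tends to 1.

    In the approximation step the error has L^1 norm at most e_k^2 and is compared with the level
    e_k, so the exceptional set B_k has probability at most e_k. It is enough that almost every w
    lies outside B_k for infinitely many k.

    The increments of S_H are not stationary; stationarity of X comes from self-similarity alone. *)

Local Notation L1 mu D f := (integrable mu D (EFin \o f)).

(** * L^1 closures of function algebras *)

Lemma cvg_eq1 (T : Type) (U : nbhsType) (F : set_system T) (f g : T -> U) (l : set_system U) :
  f =1 g -> f @ F --> l -> g @ F --> l.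
Proof. by move=> /funext ->. Qed.

Definition bounded_measurable d (M : measurableType d) (R : realType)
    (f : M -> R) :=
  measurable_fun setT f /\ exists K : R, forall x, `|f x| <= K.

Definition L1_closure d (M : measurableType d) (R : realType)
    (mu : {measure set M -> \bar R}) (A : set (M -> R)) (f : M -> R) :=
  L1 mu setT f /\
  forall e, 0 < e -> exists2 g, A g & \int[mu]_x `|f x - g x| <= e.

(** Scalar multiples are covered by the constants and the products. *)
Definition function_algebra d (M : measurableType d) (R : realType)
    (A : set (M -> R)) :=
  [/\ A `<=` @bounded_measurable d M R,
      forall c, A (cst c),
      forall f g, A f -> A g -> A (f \+ g) &
      forall f g, A f -> A g -> A (f \* g)].

(* Iterating [y |-> (3 y - y^3) / 2] gives polynomials bounded by 1 on [-1, 1]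
   that converge there to the sign. *)
Fixpoint sgn_poly (R : realType) (n : nat) (y : R) : R :=
  if n is m.+1 then (3 * sgn_poly m y - sgn_poly m y ^+ 3) / 2 else y.

Section sgn_poly.
Context (R : realType).

Lemma sgn_polyN n (y : R) : sgn_poly n (- y) = - sgn_poly n y.
Proof. by elim: n => //= n ->; rewrite mulrN !exprS expr0; field. Qed.

Lemma sgn_poly0 n : sgn_poly n (0 : R) = 0.
Proof. by elim: n => //= n ->; rewrite mulr0 expr0n /= subr0 mul0r. Qed.

(** For p(z) = (3 z - z^3) / 2 one has 1 - p(z) = (1 - z) (1 - (z + z^2) / 2). The iterates stay
    above y, so each step shrinks the distance to 1 by a factor at most 1 - y / 2. *)
Lemma sgn_poly_bnd n (y : R) : 0 <= y <= 1 ->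
  y <= sgn_poly n y <= 1 /\ 1 - sgn_poly n y <= (1 - y / 2) ^+ n.
Proof.
move=> /andP[y0 y1]; elim: n => [|n [/andP[h1 h2] h3]] /=.
  by rewrite lexx y1 expr0; split => //; lra.
set z := sgn_poly n y in h1 h2 h3 *.
have z0 : 0 <= z by lra.
have e : 1 - (3 * z - z ^+ 3) / 2 = (1 - z) * (1 - (z + z ^+ 2) / 2).
  by field.
have zz : 0 <= (1 - z) * (z + z ^+ 2) by rewrite mulr_ge0 ?subr_ge0// addr_ge0// sqr_ge0.
have z2 : z ^+ 2 <= 1 by rewrite expr_le1.
split.
  apply/andP; split; first by move: e zz; lra.
  by rewrite -subr_ge0 e mulr_ge0 ?subr_ge0//; lra.
have z20 : 0 <= z ^+ 2 by exact: sqr_ge0.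
by rewrite e [leRHS]exprSr; apply: ler_pM => //; lra.
Qed.

Lemma sgn_poly_cvg (y : R) : -1 <= y <= 1 -> sgn_poly n y @[n --> \oo] --> Num.sg y.
Proof.
have pos (x : R) : 0 < x <= 1 -> sgn_poly n x @[n --> \oo] --> (1 : R).
  move=> /andP[x0 x1].
  have xx : 0 <= x <= 1 by rewrite (ltW x0).
  apply/cvgrPdist_le => e e0.
  have /cvgrPdist_le/(_ _ e0) : (1 - x / 2) ^+ n @[n --> \oo] --> (0 : R).
    by apply: cvg_expr; rewrite ger0_norm; lra.
  apply: filterS => n; rewrite sub0r normrN => h.
  have [/andP[_ h2] h3] := sgn_poly_bnd n xx.
  rewrite ger0_norm ?subr_ge0//.
  by apply: le_trans h3 _; apply: le_trans h; exact: ler_norm.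
case: (ltgtP y 0) => [y0|y0|->] /andP[h1 h2].
- rewrite ltr0_sg//; have yy : 0 < - y <= 1 by apply/andP; split; lra.
  by apply: (cvg_eq1 _ (cvgN (pos _ yy))) => n; rewrite !fctE sgn_polyN opprK.
- by rewrite gtr0_sg//; apply: pos; rewrite y0.
- by rewrite sgr0; under eq_fun do rewrite sgn_poly0; exact: cvg_cst.
Qed.

Lemma sgn_poly_le1 n (y : R) : -1 <= y <= 1 -> `|sgn_poly n y| <= 1.
Proof.
move=> /andP[h1 h2]; have [y0|y0] := leP 0 y.
  have [/andP[a b] _] := sgn_poly_bnd n (y := y) ltac:(by rewrite y0 h2).
  by rewrite ger0_norm// (le_trans y0).
have yy : 0 <= - y <= 1 by apply/andP; split; lra.
have [/andP[a b] _] := sgn_poly_bnd n yy.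
move: a b; rewrite sgn_polyN => a b; rewrite ler_norml; apply/andP; split; lra.
Qed.

End sgn_poly.

Section L1_toolkit.
Context d (M : measurableType d) (R : realType) (mu : {measure set M -> \bar R}).
Variables (D : set M) (mD : measurable D).
Implicit Types f g h : M -> R.

Lemma L1_eq f g : (forall x, D x -> f x = g x) -> L1 mu D f -> L1 mu D g.
Proof.
move=> fg; apply: (eq_integrable mD) => x xD /=; rewrite fg//; exact: set_mem.
Qed.

Lemma L1D f g : L1 mu D f -> L1 mu D g -> L1 mu D (fun x => f x + g x).
Proof. exact: integrableD. Qed.

Lemma L1B f g : L1 mu D f -> L1 mu D g -> L1 mu D (fun x => f x - g x).
Proof. exact: integrableB. Qed.

Lemma L1Z k f : L1 mu D f -> L1 mu D (fun x => k * f x).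
Proof. exact: integrableZl. Qed.

Lemma L1_norm f : L1 mu D f -> L1 mu D (fun x => `|f x|).
Proof. exact: integrable_norm. Qed.

Lemma L1_measurable f : L1 mu D f -> measurable_fun D f.
Proof. by move=> /integrableP[/measurable_EFinP]. Qed.

Lemma L1_le f g : measurable_fun D f -> L1 mu D g ->
  (forall x, D x -> `|f x| <= g x) -> L1 mu D f.
Proof.
move=> mf ig fg; apply: (le_integrable mD _ _ ig); first exact/measurable_EFinP.
by move=> x Dx /=; rewrite lee_fin (le_trans (fg x Dx))// ler_norm.
Qed.

Lemma L1_bounded f (K : R) : (mu D < +oo)%E -> measurable_fun D f ->
  (forall x, D x -> `|f x| <= K) -> L1 mu D f.
Proof.
move=> fin mf fK; apply: (L1_le (g := cst K)) => //.
apply: measurable_bounded_integrable => //.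
exact: bounded_cst.
Qed.

Lemma le_Rint_norm f g : L1 mu D f -> L1 mu D g ->
  (forall x, D x -> `|f x| <= g x) ->
  `|\int[mu]_(x in D) f x| <= \int[mu]_(x in D) g x.
Proof.
move=> iff ig fg; apply: le_trans (le_normr_Rintegral mD iff) _.
by apply: le_Rintegral => //; exact: L1_norm.
Qed.

Lemma L1_triangle f g h : L1 mu D f -> L1 mu D g -> L1 mu D h ->
  \int[mu]_(x in D) `|f x - h x| <=
  \int[mu]_(x in D) `|f x - g x| + \int[mu]_(x in D) `|g x - h x|.
Proof.
move=> iff ig ih; rewrite -RintegralD//; last 2 first.
  by apply: L1_norm; exact: L1B.
  by apply: L1_norm; exact: L1B.
apply: le_Rintegral => //.
- by apply: L1_norm; exact: L1B.
- by apply: L1D; apply: L1_norm; exact: L1B.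
by move=> x _; exact: ler_distD.
Qed.

Lemma Rint_sum (I : Type) (s : seq I) (F : I -> M -> R) :
  (forall i, L1 mu D (F i)) ->
  L1 mu D (fun x => \sum_(i <- s) F i x) /\
  \int[mu]_(x in D) (\sum_(i <- s) F i x) = \sum_(i <- s) \int[mu]_(x in D) F i x.
Proof.
move=> iF; elim: s => [|i s [ih1 ih2]].
  split; first by under eq_fun do rewrite big_nil; exact: integrable0.
  under eq_Rintegral do rewrite big_nil.
  by rewrite big_nil Rintegral_cst// mul0r.
split.
  apply: (L1_eq _ (L1D (iF i) ih1)) => x _.
  by rewrite big_cons.
under eq_Rintegral do rewrite big_cons.
by rewrite RintegralD// ih2 big_cons.
Qed.

Lemma Rint_bounded_cvg (f_ : nat -> M -> R) (f g : M -> R) :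
  (forall n, measurable_fun D (f_ n)) -> measurable_fun D f ->
  (forall x, D x -> f_ n x @[n --> \oo] --> f x) -> L1 mu D g ->
  (forall n x, D x -> `|f_ n x| <= g x) ->
  [/\ L1 mu D f, \int[mu]_(x in D) `|f x - f_ n x| @[n --> \oo] --> 0 &
    \int[mu]_(x in D) f_ n x @[n --> \oo] --> \int[mu]_(x in D) f x].
Proof.
move=> mf_ mf cf ig fg.
have [|||||i1 i2 i3] := @dominated_convergence _ _ _ mu D mD
   (fun n => EFin \o f_ n) (EFin \o f) (EFin \o g).
- by move=> n; exact/measurable_EFinP.
- exact/measurable_EFinP.
- by apply: aeW => x Dx; apply: cvg_EFin; [exact: nearW|exact: cf].
- exact: ig.
- by apply: aeW => x n Dx /=; rewrite lee_fin fg.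
split => //.
- have : fine (\int[mu]_(x in D) `|(EFin \o f_ n) x - (EFin \o f) x|)%E @[n --> \oo] --> (0 : R).
    exact: fine_cvg i2.
  by apply: cvg_eq1 => n; congr fine; apply: eq_integral => x _ /=; rewrite distrC.
- by apply: fine_cvg; rewrite /Rintegral fineK//; exact: integrable_fin_num.
Qed.

End L1_toolkit.

(** * The L^1 closure of an algebra of bounded functions is a vector lattice *)

Section closure.
Context d (M : measurableType d) (R : realType) (mu : {measure set M -> \bar R}).
Hypothesis fin : (mu setT < +oo)%E.
Variable A : set (M -> R).
Hypothesis algA : function_algebra A.
Implicit Types f g h : M -> R.

Local Notation cl := (L1_closure mu A).

Lemma bounded_measurable_L1 f : bounded_measurable f -> L1 mu setT f.
Proof. by move=> [mf [K fK]]; exact: (@L1_bounded _ _ _ _ _ _ _ K). Qed.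

Lemma algebra_L1 f : A f -> L1 mu setT f.
Proof. by case: algA => + _ _ _ => /(_ f) bf Af; apply: bounded_measurable_L1; exact: bf. Qed.

Lemma sub_closure : A `<=` cl.
Proof.
move=> f Af; split; first exact: algebra_L1.
move=> e e0; exists f => //; under eq_Rintegral do rewrite subrr normr0.
by rewrite Rintegral_cst// mul0r ltW.
Qed.

Lemma closure_L1 f : cl f -> L1 mu setT f. Proof. by case. Qed.

Lemma closure_lim f : L1 mu setT f ->
  (forall e, 0 < e -> exists2 g, cl g & \int[mu]_x `|f x - g x| <= e) -> cl f.
Proof.
move=> iff H; split => // e e0.
have e2 : 0 < e / 2 by rewrite divr_gt0.
have [g [ig /(_ _ e2)[h Ah gh]] fg] := H _ e2.
exists h => //; rewrite [e]splitr.
apply: (le_trans (L1_triangle measurableT iff ig (algebra_L1 Ah))).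
exact: lerD.
Qed.

(** Dominated convergence; the constant bound is integrable because [mu] is finite. *)
Lemma closure_cvg (f_ : nat -> M -> R) f (K : R) : (forall n, cl (f_ n)) ->
  measurable_fun setT f ->
  (forall x, f_ n x @[n --> \oo] --> f x) -> (forall n x, `|f_ n x| <= K) -> cl f.
Proof.
move=> clf mf cf fK.
have iK : L1 mu setT (cst K) by exact: (@L1_bounded _ _ _ _ _ _ _ `|K|).
have mf_ n : measurable_fun setT (f_ n) by exact: (L1_measurable (closure_L1 (clf n))).
have [iff /cvgrPdist_le c0 _] := Rint_bounded_cvg measurableT mf_ mf
  (fun x _ => cf x) iK (fun n x _ => fK n x).
apply: closure_lim => // e /c0 [n _ /(_ n (leqnn _))/=] h.
exists (f_ n) => //; move: h; rewrite sub0r normrN; apply: le_trans.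
exact: ler_norm.
Qed.

Lemma closureD f g : cl f -> cl g -> cl (f \+ g).
Proof.
move=> [iff hf] [ig hg]; split; first exact: L1D.
move=> e e0; have e2 : 0 < e / 2 by rewrite divr_gt0.
have [f' Af hf'] := hf _ e2; have [g' Ag hg'] := hg _ e2.
case: (algA) => _ _ AD _; exists (f' \+ g'); first exact: AD.
have i1 : L1 mu setT (fun x => `|f x - f' x|).
  by apply: L1_norm => //; apply: L1B => //; exact: algebra_L1.
have i2 : L1 mu setT (fun x => `|g x - g' x|).
  by apply: L1_norm => //; apply: L1B => //; exact: algebra_L1.
rewrite [e]splitr; apply: le_trans (lerD hf' hg'); rewrite -RintegralD//.
apply: le_Rintegral => //.
- apply: L1_norm => //; apply: L1B => //; first exact: L1D.
  by apply: algebra_L1; exact: AD.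
- exact: L1D.
by move=> x _ /=; rewrite opprD addrACA ler_normD.
Qed.

Lemma closureZ k f : cl f -> cl (fun x => k * f x).
Proof.
move=> [iff hf]; split; first exact: L1Z.
move=> e e0; have e2 : 0 < e / (`|k| + 1) by rewrite divr_gt0// ltr_wpDl.
have [f' Af hf'] := hf _ e2.
case: (algA) => _ Ac _ AM; exists (cst k \* f'); first exact: AM.
under eq_Rintegral do rewrite /= -mulrBr normrM.
rewrite RintegralZl//; last first.
  by apply: L1_norm => //; apply: L1B => //; exact: algebra_L1.
apply: le_trans (ler_wpM2l _ hf') _ => //.
rewrite mulrA ler_pdivrMr ?ltr_wpDl// mulrC ler_pM2l// lerDl//.
Qed.

Lemma closureB f g : cl f -> cl g -> cl (fun x => f x - g x).
Proof.
move=> cf cg; have := closureD cf (closureZ (-1) cg).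
by congr cl; apply/funext => x /=; rewrite mulN1r.
Qed.

Lemma algebra_sgn_poly n f : A f -> A (fun x => sgn_poly n (f x)).
Proof.
move=> Af; case: (algA) => _ Ac AD AM; elim: n => //= n ih.
have := AM _ _ (Ac (2^-1)) (AD _ _ (AM _ _ (Ac 3) ih) (AM _ _ (Ac (-1)) (AM _ _ ih (AM _ _ ih ih)))).
congr A; apply/funext => x /=; rewrite !exprS expr0; by field.
Qed.

Lemma algebra_scaled f : A f ->
  exists2 k, 0 < k & A (fun x => k * f x) /\ forall x, -1 <= k * f x <= 1.
Proof.
case: (algA) => bA Ac AD AM Af; have [_ [K fK]] := bA _ Af.
have K0 : 0 < `|K| + 1 by rewrite ltr_wpDl.
exists (`|K| + 1)^-1; first by rewrite invr_gt0.
split; first exact: (AM _ _ (Ac _) Af).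
move=> x; rewrite -ler_norml normrM gtr0_norm ?invr_gt0// mulrC ler_pdivrMr// mul1r.
by apply: le_trans (fK x) _; rewrite (le_trans (ler_norm K))// lerDl.
Qed.

(** For [g] in the algebra, |g| = g sg(g) is the bounded pointwise limit of g times the sign
    polynomials of [k * g], where [k] rescales [g] into [-1, 1]. Stability under positive parts
    follows, and with it the running maxima of the maximal inequality. *)
Lemma closure_norm f : cl f -> cl (fun x => `|f x|).
Proof.
move=> [iff hf]; apply: closure_lim; first exact: L1_norm.
move=> e e0; have [g Ag fg] := hf _ e0; exists (fun x => `|g x|); last first.
  apply: le_trans fg; apply: le_Rintegral => //.
  - apply: L1_norm => //; apply: L1B => //; apply: L1_norm => //; exact: algebra_L1.
  - by apply: L1_norm => //; apply: L1B => //; exact: algebra_L1.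
  - by move=> x _; exact: ler_dist_dist.
have [k k0 [Ak bk]] := algebra_scaled Ag.
case: (algA) => bA Ac AD AM; have [mg [K gK]] := bA _ Ag.
apply: (@closure_cvg (fun n => g \* (fun x => sgn_poly n (k * g x))) _ K).
- by move=> n; apply: sub_closure; apply: AM => //; exact: algebra_sgn_poly.
- exact: measurableT_comp.
- move=> x /=; rewrite -[`|g x|]mulr1.
  have -> : `|g x| * 1 = g x * Num.sg (k * g x).
    by rewrite sgrM (gtr0_sg k0) mul1r mulr1 normrEsg mulrC.
  by apply: cvgMr; exact: sgn_poly_cvg.
- move=> n x /=; rewrite normrM -[K]mulr1 ler_pM//.
  exact: sgn_poly_le1.
Qed.

Lemma closure_max0 f : cl f -> cl (fun x => Num.max 0 (f x)).
Proof.
move=> cf; have := closureZ (2^-1) (closureD cf (closure_norm cf)).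
congr cl; apply/funext => x /=; case: (leP 0 (f x)) => h.
  by rewrite ger0_norm//; field.
by rewrite ltr0_norm// subrr mulr0.
Qed.

(** If s is the sign of f, then (s + s^2) / 2 is the indicator of f > 0, also where s = 0; replacing
    s by the sign polynomials gives elements of the algebra. *)
Lemma closure_indic_gt0 f : A f -> cl (\1_[set x | 0 < f x]).
Proof.
move=> Af; have [k k0 [Ak bk]] := algebra_scaled Af.
case: (algA) => bA Ac AD AM; have [mf _] := bA _ Af.
set s := fun n x => sgn_poly n (k * f x).
have As n : A (s n) by exact: algebra_sgn_poly.
apply: (@closure_cvg (fun n => cst (2^-1) \* (s n \+ (s n \* s n))) _ 1).
- by move=> n; apply: sub_closure; apply: (AM) => //; apply: AD => //; exact: AM.
- apply: measurable_indic; rewrite -[X in measurable X]setTI.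
  have -> : [set x | 0 < f x] = f @^-1` `]0, +oo[%classic.
    by apply/seteqP; split=> x /=; rewrite in_itv/= andbT.
  exact: mf.
- move=> x /=.
  have -> : \1_[set x0 | 0 < f x0] x = 2^-1 * (Num.sg (k * f x) + Num.sg (k * f x) * Num.sg (k * f x)) :> R.
    rewrite sgrM (gtr0_sg k0) mul1r indicE.
    have -> : (x \in [set y | 0 < f y]) = (0 < f x) by apply/idP/idP; rewrite inE.
    case: (ltgtP 0 (f x)) => h.
    - by rewrite gtr0_sg//=; field.
    - by rewrite ltr0_sg//=; ring.
    - by rewrite -h sgr0/=; ring.
  apply: cvgMr; apply: cvgD; first exact: sgn_poly_cvg.
  by apply: cvgM; exact: sgn_poly_cvg.
- move=> n x /=; have := sgn_poly_le1 n (bk x); rewrite -/(s n x).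
  set z := s n x => h.
  rewrite normrM ger0_norm// mulrC ler_pdivrMr// mul1r.
  apply: le_trans (ler_normD _ _) _; rewrite normrM.
  by rewrite -[2]/(1 + 1) lerD// -[1]mulr1 ler_pM.
Qed.

End closure.

(** The phase [th] plays the part of complex exponentials: it gives sines as well as cosines while
    all functions stay real, and with [l] = 0 it gives the constants. *)
Inductive trig_span (M : Type) (R : realType) (L : set (M -> R)) :
    (M -> R) -> Prop :=
| trig_cos th l : L l -> trig_span L (fun x => cos (th + l x))
| trig_add f g : trig_span L f -> trig_span L g -> trig_span L (f \+ g)
| trig_scale k f : trig_span L f -> trig_span L (fun x => k * f x).

Section trig_span.
Context d (M : measurableType d) (R : realType) (L : set (M -> R)).
Hypotheses (L0 : L (cst 0)) (LD : forall f g, L f -> L g -> L (f \+ g))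
  (LB : forall f g, L f -> L g -> L (f \- g))
  (Lmeas : forall f, L f -> measurable_fun setT f).

(** The product-to-sum formula, which calls for both sums and differences of elements of [L]. *)
Lemma trig_mul f g : trig_span L f -> trig_span L g -> trig_span L (f \* g).
Proof.
move=> + Lg; elim=> [th l Ll|f1 f2 _ h1 _ h2|k f1 _ h1].
- elim: Lg => [th' l' Ll'|g1 g2 _ h1 _ h2|k g1 _ h1].
  + have := trig_scale (2^-1) (trig_add (trig_cos (th + th') (LD Ll Ll')) (trig_cos (th - th') (LB Ll Ll'))).
    congr trig_span; apply/funext => x /=.
    rewrite (_ : th + th' + (l x + l' x) = (th + l x) + (th' + l' x)); last by ring.
    rewrite (_ : th - th' + (l x - l' x) = (th + l x) - (th' + l' x)); last by ring.
    by rewrite cosB cosD; field.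
  + by have := trig_add h1 h2; congr trig_span; apply/funext => x /=; ring.
  + by have := trig_scale k h1; congr trig_span; apply/funext => x /=; ring.
- by have := trig_add h1 h2; congr trig_span; apply/funext => x /=; ring.
- by have := trig_scale k h1; congr trig_span; apply/funext => x /=; ring.
Qed.

Lemma trig_algebra : @function_algebra d M R (trig_span L).
Proof.
split => [f|c|f g|f g]; last 2 first.
- exact: trig_add.
- exact: trig_mul.
- elim=> [th l Ll|f1 f2 _ [m1 [K1 h1]] _ [m2 [K2 h2]]|k f1 _ [m1 [K1 h1]]].
  + split; last by exists 1 => x; rewrite ler_norml cos_geN1 cos_le1.
    apply: measurableT_comp; first by apply: continuous_measurable_fun; exact: continuous_cos.
    by apply: measurable_funD => //; exact: Lmeas.
  + split; first exact: measurable_funD.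
    exists (K1 + K2) => x; apply: le_trans (ler_normD _ _) _.
    exact: lerD.
  + split; first exact: measurable_funM.
    by exists (`|k| * K1) => x; rewrite normrM ler_wpM2l.
- have := trig_scale c (trig_cos 0 L0).
  by congr trig_span; apply/funext => x /=; rewrite addr0 cos0 mulr1.
Qed.

End trig_span.

Definition linear_fun (R : realType) : set (R -> R) :=
  [set l | exists u, l = (fun x => u * x)].

Lemma trig_linear_algebra (R : realType) :
  @function_algebra _ (measurableTypeR R) R (trig_span (@linear_fun R)).
Proof.
apply: trig_algebra.
- by exists 0; apply/funext => x /=; rewrite mul0r.
- by move=> _ _ [u ->] [v ->]; exists (u + v); apply/funext => x /=; rewrite mulrDl.
- by move=> _ _ [u ->] [v ->]; exists (u - v); apply/funext => x /=; rewrite mulrBl.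
- by move=> _ [u ->]; exact: measurable_funM.
Qed.

(** * Density of trigonometric polynomials in L^1 of a finite measure on the line *)

Section trig_dense.
Import HBSimple.
Context (R : realType) (mu : {measure set (measurableTypeR R) -> \bar R}).
Hypothesis fin : (mu setT < +oo)%E.
Local Notation cl := (L1_closure mu (trig_span (@linear_fun R))).
Let alg := @trig_linear_algebra R.

(** The sine of (x - a) / (n + 1) has the sign of x - a as soon as n + 1 exceeds |x - a|, because
    its argument is then smaller than 1 < pi. The indicators of the sets where these sines are
    positive therefore converge pointwise to that of the half-line. *)
Lemma closure_half_line (a : R) : cl (\1_`]a, +oo[).
Proof.
pose f n (x : R) := sin (n.+1%:R^-1 * (x - a)).
have Af n : trig_span (@linear_fun R) (f n).
  have Ll : linear_fun (fun x => n.+1%:R^-1 * x : R) by eexists.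
  (* The cosine of y + pi / 2 is the opposite of the sine of y, whence the factor -1. *)
  have := trig_scale (-1) (trig_cos (pi / 2 - n.+1%:R^-1 * a) Ll).
  congr trig_span; apply/funext => x; rewrite /f.
  rewrite (_ : _ + _ = n.+1%:R^-1 * (x - a) + pi / 2); last by ring.
  by rewrite cosDpihalf; ring.
have key (x : R) : \1_[set x | 0 < f n x] x @[n --> \oo] --> (\1_`]a, +oo[ x : R).
  apply: cvg_near_cst.
  have [k kx] : exists k : nat, `|x - a| < k%:R.
    by exists (Num.truncn `|x - a|).+1; exact: truncnS_gt.
  exists k => // n /= kn; rewrite !indicE; congr (_%:R); congr nat_of_bool.
  have lt1 : n.+1%:R^-1 * `|x - a| < 1.
    rewrite mulrC ltr_pdivrMr// mul1r; apply: lt_le_trans kx _.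
    by rewrite ler_nat; exact: leqW.
  have pi1 : 1 < pi :> R by rewrite (lt_le_trans _ (pi_ge2 R))// ltr1n.
  have n0 : 0 < n.+1%:R^-1 :> R by rewrite invr_gt0.
  apply/idP/idP; rewrite !inE /= in_itv /= andbT /f.
  + move=> h; rewrite -subr_gt0 ltNge; apply/negP => xa.
    move: lt1; rewrite ler0_norm// mulrN => lt1.
    have : 0 <= sin (- (n.+1%:R^-1 * (x - a))).
      apply: sin_ge0_pi; apply/andP; split; last exact: ltW (lt_trans lt1 pi1).
      by rewrite -mulrN mulr_ge0 ?(ltW n0)// oppr_ge0.
    by rewrite sinN oppr_ge0 leNgt h.
  + rewrite -subr_gt0 => h; apply: sin_gt0_pi; rewrite mulr_gt0//=.
    by move: lt1; rewrite gtr0_norm// => lt1; exact: lt_trans lt1 pi1.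
apply: (@closure_cvg _ _ _ mu fin _ alg (fun n => \1_[set x | 0 < f n x]) _ 1).
- by move=> n; exact: closure_indic_gt0.
- exact: measurable_indic.
- exact: key.
- by move=> n x; rewrite indicE ger0_norm// lern1 leq_b1.
Qed.

(** Dynkin's theorem: the open right half-lines form a pi-system generating the Borel sets, and the
    sets whose indicator is in the closure form a lambda-system, an increasing union being a bounded
    pointwise limit. *)
Lemma closure_indic (B : set (measurableTypeR R)) : measurable B -> cl (\1_B).
Proof.
have nice n x (B_ : nat -> set R) : `|\1_(B_ n) x| <= 1 :> R.
  by rewrite indicE ger0_norm// lern1 leq_b1.
pose H : set (set (measurableTypeR R)) := [set B | measurable B /\ cl (\1_B)].
have sub : <<s setT, @RGenOInfty.G R >> `<=` H.
  apply: lambda_system_subset => //.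
  - move=> _ _ [a ->] [b ->]; exists (Num.max a b).
    by apply/seteqP; split => x /=; rewrite !in_itv/= !andbT gt_max => /andP.
  - split => //.
    + split; first exact: measurableT.
      apply: sub_closure => //; case: alg => _ /(_ 1) + _ _.
      by rewrite (_ : \1_setT = cst 1)//; apply/funext => x; rewrite indicE mem_set.
    + move=> C D DC [mC cC] [mD cD]; split; first exact: measurableD.
      have := closureB fin alg cC cD; congr cl; apply/funext => x /=.
      rewrite !indicE in_setD; case: (boolP (x \in D)) => xD /=; last by rewrite andbT subr0.
      by rewrite andbF (mem_set (DC _ (set_mem xD))) subrr.
    + move=> F Fnd HF; split; first by apply: bigcup_measurable => k _; case: (HF k).
      apply: (@closure_cvg _ _ _ mu fin _ alg (fun n => \1_(F n)) _ 1) => //.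
      * by move=> n; case: (HF n).
      * by apply: measurable_indic; apply: bigcup_measurable => k _; case: (HF k).
      * move=> x; apply: cvg_near_cst; have [[k _ Fkx]|nF] := pselect ((\bigcup_k F k) x).
          exists k => // n /= kn.
          have Fnx : F n x by have /subsetPset := Fnd _ _ kn; apply.
          by rewrite !indicE !mem_set//; exists n.
        exists 0%N => // n _; have nFn : ~ F n x by move=> Fx; apply: nF; exists n.
        by rewrite !indicE !memNset.
  - move=> _ [a ->]; split; last exact: closure_half_line.
    exact: measurable_itv.
move=> mB; suff : H B by case.
apply: sub; have : ((R.-ocitv).-measurable).-sigma.-measurable B by [].
by rewrite RGenOInfty.measurableE.
Qed.

(** Simple functions are dense in L^1, and each is a finite combination of indicators covered by
    [closure_indic]. *)
Lemma trig_dense (f : R -> R) : L1 mu setT f -> cl f.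
Proof.
move=> iff; have [g [ig _ fg]] := approximation_sfun_integrable measurableT iff.
apply: (closure_lim fin alg iff) => e e0.
have : fine (\int[mu]_z `|(EFin \o f) z - (g n z)%:E|)%E @[n --> \oo] --> (0 : R).
  exact: fine_cvg fg.
move=> /cvgrPdist_le/(_ _ e0)[n _ /(_ _ (leqnn _))]; rewrite /= sub0r normrN => h.
exists (g n); last by apply: le_trans h; exact: ler_norm.
rewrite (_ : (g n : _ -> _) = fun x => \sum_(y <- finmap.enum_fset (fset_set (range (g n)))) (y * \1_(g n @^-1` [set y]) x)); last first.
  by apply/funext => x; rewrite fimfunE fsbig_finite//=; exact: fimfunP.
elim: (finmap.enum_fset _) => [|y s ih].
  under eq_fun do rewrite big_nil.
  by apply: sub_closure => //; case: alg => _ + _ _; apply.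
under eq_fun do rewrite big_cons.
apply: (closureD fin alg _ ih); apply: (closureZ fin alg).
apply: closure_indic; exact: measurable_funPTI.
Qed.

End trig_dense.

Section closure_functional.
Context d (M : measurableType d) (R : realType).
Variables (m1 m2 : {measure set M -> \bar R}).
Hypotheses (fin1 : (m1 setT < +oo)%E) (fin2 : (m2 setT < +oo)%E).

Lemma measure_add_fin : (measure_add m1 m2 setT < +oo)%E.
Proof. by rewrite measure_addE lte_add_pinfty. Qed.

Lemma measure_add_L1 f : L1 (measure_add m1 m2) setT f ->
  [/\ L1 m1 setT f, L1 m2 setT f &
    \int[measure_add m1 m2]_x f x = \int[m1]_x f x + \int[m2]_x f x].
Proof.
move=> /integrableP[mf]; rewrite ge0_integral_measure_add//; last first.
  exact: measurableT_comp.
move=> fin.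
have i1 : L1 m1 setT f.
  by apply/integrableP; split => //; apply: le_lt_trans fin; rewrite leeDl// integral_ge0.
have i2 : L1 m2 setT f.
  by apply/integrableP; split => //; apply: le_lt_trans fin; rewrite leeDr// integral_ge0.
split => //; rewrite /Rintegral integral_measure_add// fineD//.
- exact: integrable_fin_num.
- exact: integrable_fin_num.
Qed.

Variable A : set (M -> R).
Hypothesis algA : function_algebra A.
Hypothesis eqA : forall f, A f -> \int[m1]_x f x = \int[m2]_x f x.

(** Closeness in L^1 of the sum [m1] + [m2] bounds the error under both measures at once, so a
    single approximant [g] serves for the two integrals. *)
Lemma closure_functional_eq f : L1_closure (measure_add m1 m2) A f ->
  \int[m1]_x f x = \int[m2]_x f x.
Proof.
move=> [iff hf]; apply/eqP; rewrite -subr_eq0 -normr_le0; apply/ler_addgt0Pr => e e0.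
rewrite add0r; have [g Ag fg] := hf _ e0.
have ig : L1 (measure_add m1 m2) setT g by exact: (algebra_L1 measure_add_fin algA).
have ifg : L1 (measure_add m1 m2) setT (fun x => `|f x - g x|).
  by apply: L1_norm => //; exact: L1B.
have [if1 if2 _] := measure_add_L1 iff.
have [ig1 ig2 _] := measure_add_L1 ig.
have [i1 i2 E] := measure_add_L1 ifg.
apply: le_trans fg; rewrite E.
rewrite (_ : _ - _ = \int[m1]_x (f x - g x) - \int[m2]_x (f x - g x)); last first.
  by rewrite !RintegralB// (eqA Ag); ring.
apply: le_trans (ler_normB _ _) _.
by rewrite lerD// le_normr_Rintegral//; exact: L1B.
Qed.

End closure_functional.

(** The uniqueness theorem for characteristic functions in real form: letting [th] vary recovers the
    real and the imaginary part. *)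
Lemma cos_integral_unique (R : realType)
    (m1 m2 : {measure set (measurableTypeR R) -> \bar R}) :
  (m1 setT < +oo)%E -> (m2 setT < +oo)%E ->
  (forall th u, \int[m1]_x cos (th + u * x) = \int[m2]_x cos (th + u * x)) ->
  forall B, measurable B -> m1 B = m2 B.
Proof.
move=> f1 f2 H B mB.
have algA := trig_linear_algebra R.
have fin := measure_add_fin f1 f2.
have eqA f : trig_span (@linear_fun R) f -> \int[m1]_x f x = \int[m2]_x f x.
  have iA g (m : {measure set (measurableTypeR R) -> \bar R}) :
      (m setT < +oo)%E -> trig_span (@linear_fun R) g -> L1 m setT g.
    by move=> fm Ag; exact: (algebra_L1 fm algA).
  elim=> [th l [u ->]|f3 f4 A3 h3 A4 h4|k f3 A3 h3]; first exact: H.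
    by rewrite !RintegralD// ?h3 ?h4//; exact: iA.
  by rewrite !RintegralZl// ?h3//; exact: iA.
have := closure_functional_eq f1 f2 algA eqA (closure_indic fin mB).
rewrite /Rintegral !integral_indic// !setIT => e.
have fn (m : {measure set (measurableTypeR R) -> \bar R}) : (m setT < +oo)%E -> m B \is a fin_num.
  move=> fm; rewrite ge0_fin_numE//; apply: le_lt_trans fm.
  by apply: le_measure; rewrite ?inE.
by rewrite -[LHS]fineK ?fn// -[RHS]fineK ?fn// e.
Qed.

(** * Maximal inequality *)

Section maximal_inequality.
Context d (Omega : measurableType d) (R : realType) (P : probability Omega R).
Implicit Type W : nat -> Omega -> R.

(** This is the maximum over 0 <= j <= n of W_k + ... + W_(k+j-1), the empty sum included. Peeling
    off the first term, rather than the last, relates the maximum started at 0 to the one started at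
    1. The type [M] is arbitrary because the same recursion is later run on [Omega * bool]. *)
Fixpoint partial_max (M : Type) (W : nat -> M -> R) n k : M -> R :=
  if n is m.+1 then fun w => Num.max 0 (W k w + partial_max W m k.+1 w)
  else cst 0.

Lemma partial_max_ge0 W n k w : 0 <= partial_max W n k w.
Proof. by case: n => //= n; rewrite le_max lexx. Qed.

Lemma partial_max_mono W n k w : partial_max W n k w <= partial_max W n.+1 k w.
Proof.
elim: n k => [|n ih] k; first exact: partial_max_ge0.
rewrite [leLHS]/= [leRHS]/= -/(partial_max W n.+1 k.+1 w).
rewrite ge_max !le_max lexx/=; apply/orP; right.
by rewrite lerD2l.
Qed.

Lemma partial_sum_le_max W n k j w : (j <= n)%N ->
  \sum_(i < j) W (k + i)%N w <= partial_max W n k w.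
Proof.
elim: n k j => [|n ih] k [|j]//=.
- by move=> _; rewrite big_ord0.
- by move=> _; rewrite big_ord0 le_max lexx.
- rewrite ltnS => jn; rewrite big_ord_recl/= addn0 le_max; apply/orP; right.
  rewrite lerD2l; apply: le_trans (ih k.+1 j jn).
  by apply: ler_sum => i _; rewrite /bump/= add1n addSnnS.
Qed.

Lemma bounded_partial_max W n k : (forall i, bounded_measurable (W i)) ->
  bounded_measurable (partial_max W n k).
Proof.
move=> bW; elim: n k => [|n ih] k /=.
  by split => //; exists 0 => x; rewrite normr0.
have [mW [K hK]] := bW k; have [mM [K' hK']] := ih k.+1.
split; first by apply: measurable_maxr => //; exact: measurable_funD.
exists (K + K') => x; apply: (@le_trans _ _ `|W k x + partial_max W n k.+1 x|).
  by rewrite /Num.max; case: ifP => _ //; rewrite normr0.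
by apply: le_trans (ler_normD _ _) _; exact: lerD.
Qed.

Let fin : (P setT < +oo)%E. Proof. by rewrite probability_setT ltry. Qed.

Variables (V : nat -> Omega -> R) (lam : R).
Hypotheses (bV : forall i, bounded_measurable (V i)) (V0 : forall w, 0 <= V 0%N w)
  (lam_gt0 : 0 < lam).
Let W i w := V i w - lam.
(** Stationarity enters as an equality of two integrals, without any measure-preserving map on
    [Omega]. *)
Hypothesis stationary :
  forall n, \int[P]_w partial_max W n 0 w = \int[P]_w partial_max W n 1 w.

Let bW i : bounded_measurable (W i).
Proof.
have [mV [K hK]] := bV i; split; first exact: measurable_funB.
by exists (K + `|lam|) => w; apply: le_trans (ler_normB _ _) _; rewrite lerD2r.
Qed.

Let event n := [set w | 0 < partial_max W n 0 w].

Let event_meas n : measurable (event n).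
Proof.
rewrite -[event n]setTI; have -> : event n = partial_max W n 0 @^-1` `]0, +oo[%classic.
  by apply/seteqP; split=> x /=; rewrite in_itv/= andbT.
by have [+ _] := bounded_partial_max n 0 bW; apply.
Qed.

(* Garsia's argument: the increment between the running maxima started at 0
   and at 1 integrates to 0 and is at most V 0 - lam where the first is
   positive, at most V 0 elsewhere. *)
Lemma garsia n : (lam%:E * P [set w | (exists2 j, (j <= n)%N &
    (j%:R * lam < \sum_(i < j) V i w)%R)] <= (\int[P]_w V 0%N w)%:E)%E.
Proof.
have mI m : measurable_fun setT (\1_(event m) : Omega -> R) by exact: measurable_indic.
have iV : L1 P setT (V 0%N) by exact: bounded_measurable_L1.
have iM m k : L1 P setT (partial_max W m k).
  by apply: bounded_measurable_L1 => //; exact: bounded_partial_max.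
have iI : L1 P setT (\1_(event n.+1) : Omega -> R).
  by apply: (@L1_bounded _ _ _ _ _ _ _ 1) => // x _; rewrite indicE ger0_norm// lern1 leq_b1.
have key : 0 <= \int[P]_w (V 0%N w - lam * \1_(event n.+1) w).
  have -> : 0 = \int[P]_w (partial_max W n.+1 0 w - partial_max W n.+1 1 w).
    by rewrite RintegralB// stationary subrr.
  apply: le_Rintegral => //; first exact: L1B.
    by apply: L1B => //; exact: L1Z.
  move=> w _; rewrite indicE; case: (boolP (w \in event n.+1)) => [|/negP] h.
    (* On the event the outer maximum with 0 is inactive, so the maximum started at 0 equals [W 0]
       plus a maximum of length [n] started at 1; monotonicity raises that length to [n.+1], the
       length subtracted. *)
    rewrite mulr1 lerBlDr; have := partial_max_mono W n 1 w.
    have := set_mem h; rewrite /event/= /Num.max.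
    by case: ifP => _; rewrite ?ltxx// => _; rewrite -/(W 0%N w) lerD2l.
  rewrite mulr0 subr0; apply: le_trans (V0 w).
  have -> : partial_max W n.+1 0 w = 0.
    apply/eqP; rewrite eq_le partial_max_ge0 andbT leNgt; apply/negP => h'.
    by apply: h; rewrite inE.
  by rewrite sub0r oppr_le0 partial_max_ge0.
move: key; rewrite RintegralB ?RintegralZl//; last exact: L1Z.
rewrite subr_ge0 /Rintegral integral_indic// setIT => key.
have fP A : measurable A -> P A = (fine (P A))%:E.
  by move=> mA; rewrite fineK// fin_num_measure.
apply: (@le_trans _ _ (lam%:E * P (event n.+1)))%E; last by rewrite fP// -EFinM lee_fin.
rewrite lee_pmul2l//; apply: le_measure; rewrite ?inE//.
  rewrite (_ : mkset _ = \bigcup_(j in [set j | (j <= n)%N])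
      [set w | j%:R * lam < \sum_(i < j) V i w]); last first.
    by apply/seteqP; split => [w [j jn h]|w [j jn h]]; exists j.
  apply: bigcup_measurable => j _; rewrite -[X in measurable X]setTI.
  rewrite (_ : mkset _ = (fun w => \sum_(i < j) V i w) @^-1` `]j%:R * lam, +oo[%classic); last first.
    by apply/seteqP; split => x /=; rewrite in_itv/= andbT.
  have : measurable_fun setT (fun w => \sum_(i < j) V i w).
    by apply: measurable_sum => i; case: (bV i).
  by apply.
move=> w [j jn h]; rewrite /event /=.
apply: (@lt_le_trans _ _ (\sum_(i < j) W (0 + i)%N w)).
  by rewrite /W big_split/= sumr_const card_ord mulNrn subr_gt0 -mulr_natl.
apply: (@partial_sum_le_max W n.+1 0 j w); exact: leqW.
Qed.

End maximal_inequality.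

(** * Laws and integrals over intervals *)

Section law.
Context d d' (T : measurableType d) (T' : measurableType d') (R : realType).
Variables (P : probability T R) (X : T -> T') (mX : measurable_fun setT X).

Definition law : probability T' R := distribution P (mfun_Sub (mem_set mX)).

Lemma ge0_integral_law (f : T' -> \bar R) : measurable_fun setT f ->
  (forall y, 0 <= f y)%E -> (\int[law]_y f y = \int[P]_x f (X x))%E.
Proof. by move=> mf f0; rewrite /law ge0_integral_distribution. Qed.

Lemma law_L1 (f : T' -> R) : measurable_fun setT f ->
  L1 law setT f <-> L1 P setT (f \o X).
Proof.
move=> mf; split => /integrableP[_]; rewrite ?ge0_integral_law//; do ?exact: measurableT_comp;
  do ?[by apply: measurableT_comp => //; exact/measurable_EFinP].
- move=> fin; apply/integrableP; split => //; apply/measurable_EFinP.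
  exact: measurableT_comp.
- move=> fin; apply/integrableP; split; first exact/measurable_EFinP.
  by rewrite ge0_integral_law//; apply: measurableT_comp => //; exact/measurable_EFinP.
Qed.

Lemma Rintegral_law (f : T' -> R) : measurable_fun setT f -> L1 P setT (f \o X) ->
  \int[law]_y f y = \int[P]_x f (X x).
Proof.
move=> mf iff; rewrite /Rintegral; congr fine.
by rewrite /law integral_distribution//; exact/measurable_EFinP.
Qed.

End law.

Lemma measurable_fun_bool d (T : measurableType d) d' (T' : measurableType d')
    (F : T * bool -> T') :
  (forall b, measurable_fun setT (fun w => F (w, b))) -> measurable_fun setT F.
Proof.
move=> mF _ B mB; rewrite setTI.
rewrite (_ : F @^-1` B = ((fun w => F (w, true)) @^-1` B) `*` [set true] `|`
   ((fun w => F (w, false)) @^-1` B) `*` [set false]); last first.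
  apply/seteqP; split => [[w []] /= Bw|[w b] /= [[Bw ->]|[Bw ->]]]//.
    by left.
  by right.
apply: measurableU; apply: measurableX => //; rewrite -[X in measurable X]setTI; exact: mF.
Qed.

Section interval_integrals.
Context (R : realType).
Local Notation mu := (@lebesgue_measure R).
Implicit Types (f : R -> R) (a b c e K : R).

Lemma lebesgue_itv_fin a b : (mu `[a, b] < +oo)%E.
Proof. by rewrite lebesgue_measure_itv/=; case: ifP => _; rewrite ?ltry// -EFinB ltry. Qed.

Lemma fine_lebesgue_itv a b : a <= b -> fine (mu `[a, b]) = b - a.
Proof.
rewrite lebesgue_measure_itv/= lte_fin le_eqVlt => /predU1P[->|->//].
by rewrite ltxx subrr.
Qed.

Lemma bounded_L1_itv f K a b : measurable_fun setT f ->
  (forall x, `|f x| <= K) -> L1 mu `[a, b] f.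
Proof.
move=> mf fK; apply: (L1_bounded _ (K := K)) => //; first exact: lebesgue_itv_fin.
exact: measurable_funTS.
Qed.

Lemma Rintegral_itv_cst a b (k : R) : a <= b ->
  \int[mu]_(x in `[a, b]) k = k * (b - a).
Proof. by move=> ab; rewrite Rintegral_cst// fine_lebesgue_itv. Qed.

Lemma Rintegral_itv_cat f a b c : a <= b -> b <= c -> L1 mu `[a, c] f ->
  \int[mu]_(x in `[a, c]) f x =
  \int[mu]_(x in `[a, b]) f x + \int[mu]_(x in `[b, c]) f x.
Proof.
move=> ab bc ifc; rewrite -(@Rintegral_itv_obnd_cbnd _ b (BRight c)); last first.
  apply: (integrableS _ _ _ ifc) => //.
  by apply: subset_itv; rewrite ?bnd_simp.
rewrite -(@Rintegral_itvB _ f (BLeft a) (BRight c) b ifc); last 2 first.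
- by rewrite bnd_simp.
- by rewrite bnd_simp.
by rewrite addrC subrK.
Qed.

Lemma Rintegral_itv_sum f a e n : 0 <= e -> L1 mu `[a, a + n%:R * e] f ->
  \int[mu]_(x in `[a, a + n%:R * e]) f x =
  \sum_(j < n) \int[mu]_(x in `[a + j%:R * e, a + j.+1%:R * e]) f x.
Proof.
move=> e0; elim: n => [|n ih] ifn.
  by rewrite mul0r addr0 set_itv1 Rintegral_set1 big_ord0.
have h : n%:R * e <= n.+1%:R * e by rewrite ler_wpM2r// ler_nat.
rewrite big_ord_recr/= -ih.
  apply: Rintegral_itv_cat => //; last by rewrite lerD2l.
  by rewrite lerDl mulr_ge0.
apply: (integrableS _ _ _ ifn) => //.
by apply: subset_itvl; rewrite bnd_simp lerD2l.
Qed.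

Lemma le_Rint_itv f K a b : a <= b -> L1 mu `[a, b] f ->
  (forall x, a <= x <= b -> `|f x| <= K) ->
  `|\int[mu]_(x in `[a, b]) f x| <= K * (b - a).
Proof.
move=> ab iff fK; rewrite -Rintegral_itv_cst//.
have iK : L1 mu `[a, b] (cst K).
  by apply: (L1_bounded _ (K := `|K|)) => //; exact: lebesgue_itv_fin.
exact: (le_Rint_norm _ iff iK).
Qed.

End interval_integrals.

Lemma prob_bounded_L1 d (T : measurableType d) (R : realType)
    (P : probability T R) (f : T -> R) (K : R) :
  measurable_fun setT f -> (forall w, `|f w| <= K) -> L1 P setT f.
Proof.
move=> mf fK; apply: (L1_bounded measurableT (K := K)) => //.
by rewrite -ge0_fin_numE//; exact: fin_num_measure.
Qed.

Lemma prob_Rint_cst d (T : measurableType d) (R : realType) (Q : probability T R) (k : R) :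
  \int[Q]_x k = k.
Proof.
rewrite Rintegral_cst// -[RHS]mulr1; congr (_ * _).
by transitivity (fine (1 : \bar R)) => //; congr fine; exact: probability_setT.
Qed.

Lemma measurable_cosD (R : realType) (th u : R) :
  measurable_fun setT (fun x : R => cos (th + u * x)).
Proof.
apply: measurableT_comp; first by apply: continuous_measurable_fun; exact: continuous_cos.
by apply: measurable_funD => //; exact: measurable_funM.
Qed.

Lemma cosD_L1 d (T : measurableType d) (R : realType) (Q : probability T R)
    (Z : T -> measurableTypeR R) th u : measurable_fun setT Z ->
  L1 Q setT (fun w => cos (th + u * Z w)).
Proof.
move=> mZ; apply: (prob_bounded_L1 Q (K := 1)); last first.
  by move=> w /=; rewrite ler_norml cos_geN1 cos_le1.
exact: (measurableT_comp (measurable_cosD th u) mZ).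
Qed.

Lemma cos_law d (Omega : measurableType d) d' (Omega' : measurableType d') (R : realType)
    (P : probability Omega R) (P' : probability Omega' R)
    (X : Omega -> measurableTypeR R) (Y : Omega' -> measurableTypeR R)
    (mX : measurable_fun setT X) (mY : measurable_fun setT Y) :
  (forall th u, \int[P]_w cos (th + u * X w) = \int[P']_w cos (th + u * Y w)) ->
  forall B, measurable B -> law P mX B = law P' mY B.
Proof.
move=> XY B; apply: cos_integral_unique => [||th u].
- by rewrite -ge0_fin_numE//; exact: fin_num_measure.
- by rewrite -ge0_fin_numE//; exact: fin_num_measure.
have mc := measurable_cosD th u.
by rewrite !Rintegral_law//; exact: cosD_L1.
Qed.

Section bounded_fubini.
Context d (Omega : measurableType d) (R : realType) (P : probability Omega R).
Local Notation mu := (@lebesgue_measure R).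
Variables (F : measurableTypeR R * Omega -> R) (K : R).
Hypotheses (mF : measurable_fun setT F) (FK : forall p, `|F p| <= K).

Lemma bounded_fubini (a b : R) :
  [/\ measurable_fun setT (fun w => \int[mu]_(s in `[a, b]) F (s, w)),
    L1 mu `[a, b] (fun s => \int[P]_w F (s, w)) &
    \int[P]_w \int[mu]_(s in `[a, b]) F (s, w) =
    \int[mu]_(s in `[a, b]) \int[P]_w F (s, w)].
Proof.
(* Cutting [F] by an indicator in time moves the problem to the full product space, where the cut
   function is bounded by [K] and carried by a strip of finite measure. *)
pose I : R -> R := \1_`[a, b].
pose G (p : measurableTypeR R * Omega) : R := F p * I p.1.
have I01 s : `|I s| <= 1 by rewrite /I indicE ger0_norm// lern1 leq_b1.
have mI : measurable_fun setT I by exact: measurable_indic.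
have mG : measurable_fun setT G.
  apply: measurable_funM => //.
  exact: (measurableT_comp mI measurable_fst).
have K0 : 0 <= K by apply: le_trans (FK (a, point)); exact: normr_ge0.
have iG : (mu \x P)%E.-integrable setT (EFin \o G).
  apply/integrable12ltyP; first exact/measurable_EFinP.
  apply: (@le_lt_trans _ _ (\int[mu]_(s in `[a, b]) K%:E)%E); last first.
    by rewrite integral_cst// lte_mul_pinfty// lebesgue_itv_fin.
  rewrite [leRHS]integral_mkcond; apply: ge0_le_integral => //.
  - by move=> s _; exact: integral_ge0.
  - apply: (@measurable_fun_fubini_tonelli_F _ _ (measurableTypeR R) Omega _ P (fun p => `|(G p)%:E|%E)) => //.
    by apply: measurableT_comp => //; exact/measurable_EFinP.
  - exact/(measurable_restrictT _ _).1.
  move=> s _; rewrite patchE; case: ifP => h.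
    rewrite -[leRHS]mule1 -(probability_setT P) -integral_cst//.
    apply: ge0_le_integral => //.
    + apply: measurableT_comp => //; apply/measurable_EFinP.
      exact: (measurable_fun_pair2 s mG).
    + by move=> w _; rewrite lee_fin /G normrM -[K]mulr1 ler_pM.
  rewrite (_ : (fun _ => _) = cst 0%E) ?integral0//.
  by apply/funext => w; rewrite /= /G /= /I indicE h mulr0 normr0.
have GE w : \int[mu]_(s in `[a, b]) F (s, w) = fine (\int[mu]_s (G (s, w))%:E).
  rewrite Rintegral_mkcond /Rintegral; congr fine; apply: eq_integral => s _.
  by rewrite /G /I patchE indicE /=; case: ifP => _; rewrite ?mulr1 ?mulr0.
have HE s : fine (\int[P]_w (G (s, w))%:E) = I s * \int[P]_w F (s, w).
  rewrite -RintegralZl//; last first.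
    by apply: (prob_bounded_L1 P (K := K)) => //; exact: (measurable_fun_pair2 s mF).
  by rewrite /Rintegral; congr fine; apply: eq_integral => w _; rewrite /G /= mulrC.
have iGF : L1 mu setT (fun s => I s * \int[P]_w F (s, w)).
  move: (integrable_fubini_F iG); apply: eq_integrable => // s _.
  rewrite /fubini_F /= -HE fineK//; apply: integrable_fin_num => //.
  apply: (prob_bounded_L1 P (K := K)); first exact: (measurable_fun_pair2 s mG).
  by move=> w; rewrite /G normrM -[K]mulr1 ler_pM.
split.
- under eq_fun do rewrite GE.
  apply: measurableT_comp => //; exact: (measurable_fubini_G iG).
- have : L1 mu `[a, b] (fun s => I s * \int[P]_w F (s, w)).
    by apply: (integrableS _ _ _ iGF).
  by apply: L1_eq => // s sab; rewrite /I indicE mem_set// mul1r.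
- under eq_Rintegral do rewrite GE.
  rewrite [RHS]Rintegral_mkcond.
  transitivity (\int[mu]_s fine (\int[P]_w (G (s, w))%:E)); last first.
    apply: eq_Rintegral => s _; rewrite HE patchE /I indicE.
    by case: ifP => _; rewrite ?mul1r ?mul0r.
  rewrite /Rintegral; congr fine.
  transitivity (\int[P]_w \int[mu]_s (G (s, w))%:E)%E.
    apply: eq_integral => w _; rewrite fineK//; apply: integrable_fin_num => //.
    apply: (@L1_le _ (measurableTypeR R) _ mu setT measurableT (fun s => G (s, w)) (fun s => K * I s)) => //.
    + exact: (measurable_fun_pair1 w mG).
    + by apply: L1Z => //; exact: integrable_indic_itv.
    + by move=> s _; rewrite /G normrM ler_pM// /I indicE ger0_norm.
  rewrite -(Fubini iG); apply: eq_integral => s _; rewrite fineK//.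
  apply: integrable_fin_num => //.
  apply: (prob_bounded_L1 P (K := K)); first exact: (measurable_fun_pair2 s mG).
  by move=> w; rewrite /G normrM -[K]mulr1 ler_pM.
Qed.
End bounded_fubini.

(** Telescoping: 1 / (n + 2)^2 is at most 1 / (n + 1) - 1 / (n + 2). *)
Lemma sum_inv_square (R : realType) n :
  \sum_(k < n.+1) (k.+1%:R ^+ 2)^-1 <= 2 - n.+1%:R^-1 :> R.
Proof.
elim: n => [|n ih]; first by rewrite big_ord1 expr1n invr1; lra.
rewrite big_ord_recr/=; apply: le_trans (lerD ih (lexx _)) _.
rewrite -addrA lerD2l -lerBrDl opprK addrC.
have h1 : 0 < n.+1%:R :> R by [].
have h2 : 0 < n.+2%:R :> R by [].
rewrite -[leRHS]addrC; apply: (@le_trans _ _ (n.+1%:R * n.+2%:R)^-1).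
  rewrite lef_pV2 ?posrE ?exprn_gt0 ?mulr_gt0// expr2 ler_pM2r// ler_nat//.
rewrite le_eqVlt; apply/orP; left; apply/eqP.
have e : n.+2%:R = n.+1%:R + 1 :> R by rewrite natr1.
rewrite e in h2 *; field; rewrite !gt_eqF//.
Qed.

(** The expectations are summable, so the random series has finite expectation by monotone
    convergence. It is then finite almost everywhere, and its terms tend to 0. *)
Lemma ae_cvg0 d (T : measurableType d) (R : realType) (P : probability T R)
    (Z : nat -> T -> R) K :
  (forall n w, 0 <= Z n w) -> (forall n, L1 P setT (Z n)) ->
  (forall n, \int[P]_w Z n w <= K * (n.+1%:R ^+ 2)^-1) ->
  {ae P, forall w, Z n w @[n --> \oo] --> 0}.
Proof.
move=> Z0 iZ ZK.
have mZ n : measurable_fun setT (EFin \o Z n) by apply/measurable_EFinP; exact: L1_measurable.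
have K0 : 0 <= K.
  have := ZK 0%N; rewrite expr1n invr1 mulr1; apply: le_trans.
  exact: Rintegral_ge0.
pose S w := (\big[+%E/0]_(0 <= n <oo) (Z n w)%:E)%E.
have iS : (\int[P]_w S w <= (2 * K)%:E)%E.
  rewrite /S (integral_nneseries P measurableT mZ); last by move=> n w _; rewrite lee_fin.
  apply: lime_le; first by apply: is_cvg_nneseries => n _ _; apply: integral_ge0 => w _; rewrite lee_fin.
  apply: nearW => n.
  rewrite (eq_bigr (fun k => (\int[P]_w Z k w)%:E)); last first.
    by move=> k _; rewrite /Rintegral fineK//; exact: (integrable_fin_num measurableT (iZ k)).
  rewrite sumEFin lee_fin big_mkord.
  case: n => [|n]; first by rewrite big_ord0 mulr_ge0.
  apply: (@le_trans _ _ (\sum_(k < n.+1) K * (k.+1%:R ^+ 2)^-1)); first exact: ler_sum.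
  rewrite -mulr_sumr mulrC ler_wpM2r//; apply: le_trans (sum_inv_square _ _) _.
  by rewrite gerDl oppr_le0 invr_ge0.
have mS : measurable_fun setT S.
  apply: ge0_emeasurable_sum => [n w _ _|n _]; [by rewrite lee_fin|exact: mZ].
have : P.-integrable setT S.
  apply/integrableP; split => //; apply: le_lt_trans (ltry (2 * K)).
  apply: le_trans iS; rewrite le_eqVlt; apply/orP; left; apply/eqP.
  apply: eq_integral => w _; rewrite gee0_abs//; apply: nneseries_ge0 => n _ _.
  by rewrite lee_fin.
move=> /(integrable_ae measurableT); apply: filterS => w /(_ I) fS.
have cs : cvgn (series (fun n => Z n w)).
  apply: nondecreasing_is_cvgn; first by apply/nondecreasing_seqP => n; rewrite seriesEnat/= big_nat_recr//= lerDl.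
  exists (fine (S w)) => _ [n _ <-]; rewrite -lee_fin fineK// seriesEnat/= -sumEFin.
  by apply: nneseries_lim_ge => k _ _; rewrite lee_fin.
exact: cvg_series_cvg_0 cs.
Qed.

(** * Ergodic theorem for mixing stationary processes *)

Section stationary_process.
Context d (Omega : measurableType d) (R : realType) (P : probability Omega R).
Local Notation mu := (@lebesgue_measure R).
Variable X : R -> Omega -> R.
Hypothesis mX : @measurable_fun _ _ (measurableTypeR R * Omega)%type
  (measurableTypeR R) setT (fun p => X p.1 p.2).

(** The boolean is the shift, by 0 or by 1, so that shifting time by one unit amounts to changing
    the fibre over [bool]. *)
Definition lin_comb (b : bool) (s : seq (R * R)) (w : Omega) : R :=
  \sum_(p <- s) p.1 * X (p.2 + b%:R) w.

(** By the Cramer-Wold principle this is invariance of the finite-dimensional laws under the shift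
    by 1. The next two hypotheses are equality of all one-dimensional laws and mean continuity with
    a modulus uniform in time. *)
Hypothesis X_shift : forall th s,
  \int[P]_w cos (th + lin_comb false s w) = \int[P]_w cos (th + lin_comb true s w).
Hypothesis X_law : forall th u s,
  \int[P]_w cos (th + u * X s w) = \int[P]_w cos (th + u * X 0 w).
Hypothesis X_cont : forall th u e, 0 < e -> exists2 de, 0 < de &
  forall s t, `|s - t| <= de ->
    \int[P]_w `|cos (th + u * X s w) - cos (th + u * X t w)| <= e.

Lemma measurable_X s : @measurable_fun _ _ Omega (measurableTypeR R) setT (X s).
Proof. exact: (measurable_fun_pair2 s mX). Qed.

Lemma measurable_comp_X (g : R -> R) : measurable_fun setT g ->
  @measurable_fun _ _ (measurableTypeR R * Omega)%type
  (measurableTypeR R) setT (fun p => g (X p.1 p.2)).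
Proof. by move=> mg; exact: (measurableT_comp mg mX). Qed.

Lemma same_law s (B : set (measurableTypeR R)) : measurable B ->
  law P (measurable_X s) B = law P (measurable_X 0) B.
Proof. by apply: cos_law => th u; exact: X_law. Qed.

Lemma same_integral s (g : R -> \bar R) : measurable_fun setT g -> (forall x, 0 <= g x)%E ->
  (\int[P]_w g (X s w) = \int[P]_w g (X 0%R w))%E.
Proof.
move=> mg g0; rewrite -(ge0_integral_law P (measurable_X s))// -(ge0_integral_law P (measurable_X 0))//.
by apply: eq_measure_integral => B mB _; exact: same_law.
Qed.

Lemma same_Rintegral s (g : R -> R) : measurable_fun setT g -> (forall x, 0 <= g x) ->
  \int[P]_w g (X s w) = \int[P]_w g (X 0 w).
Proof.
move=> mg g0; rewrite /Rintegral (same_integral s (g := EFin \o g))//.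
exact/measurable_EFinP.
Qed.

Lemma bounded_comp_X_L1 (g : R -> R) s : bounded_measurable g -> L1 P setT (fun w => g (X s w)).
Proof.
move=> [mg [K gK]]; apply: (prob_bounded_L1 P (K := K)) => //.
by apply: (measurableT_comp mg); exact: measurable_X.
Qed.

Lemma bounded_path_L1 (g : R -> R) a b w : bounded_measurable g ->
  L1 mu `[a, b] (fun s => g (X s w)).
Proof.
move=> [mg [K gK]]; apply: (bounded_L1_itv _ _ (K := K)) => //.
exact: (measurable_fun_pair1 w (measurable_comp_X mg)).
Qed.

(** The stationary sequence fed to Garsia's argument; its partial sums are the time integrals over
    [0, j] with integer j. *)
Definition unit_int (g : R -> R) (k : nat) (w : Omega) : R :=
  \int[mu]_(s in `[k%:R, k%:R + 1]) g (X s w).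

Lemma bounded_unit_int g k : bounded_measurable g -> bounded_measurable (unit_int g k).
Proof.
move=> bg; have [mg [K gK]] := bg; split.
  by have [+ _ _] := bounded_fubini P (measurable_comp_X mg) (fun p => gK (X p.1 p.2)) k%:R (k%:R + 1).
exists K => w; have e : K = K * (k%:R + 1 - k%:R) by rewrite addrAC subrr add0r mulr1.
rewrite e; apply: le_Rint_itv => //; first by rewrite lerDl.
exact: bounded_path_L1.
Qed.

(* Both endpoints of the comparison live on Omega * bool: the fibre over b
   carries the process shifted by b. *)
Let half (b : bool) := law P (@pair2_measurable _ _ Omega bool b).
Let nu := measure_add (half false) (half true).

Let shift_fun : set (Omega * bool -> R) :=
  [set l | exists s, l = (fun p => lin_comb p.2 s p.1)].

Let fin_half b : (half b setT < +oo)%E.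
Proof. by rewrite -ge0_fin_numE//; exact: fin_num_measure. Qed.

Let fin_nu : (nu setT < +oo)%E. Proof. exact: (measure_add_fin (fin_half false) (fin_half true)). Qed.

Lemma measurable_lin_comb b s : measurable_fun setT (lin_comb b s).
Proof.
apply: measurable_sum => p.
by apply: measurable_funM => //; exact: measurable_X.
Qed.

Let shift_algebra : function_algebra (trig_span shift_fun).
Proof.
apply: trig_algebra.
- by exists [::]; apply/funext => -[w b]; rewrite /lin_comb big_nil.
- move=> _ _ [s ->] [t ->]; exists (s ++ t); apply/funext => -[w b] /=.
  by rewrite /lin_comb big_cat.
- move=> _ _ [s ->] [t ->]; exists (s ++ [seq (- p.1, p.2) | p <- t]); apply/funext => -[w b] /=.
  rewrite /lin_comb big_cat big_map -sumrN; congr (_ + _).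
  by apply: eq_bigr => p _; rewrite mulNr.
- by move=> _ [s ->]; apply: measurable_fun_bool => b; exact: measurable_lin_comb.
Qed.

Let half_int b F : bounded_measurable F -> \int[half b]_p F p = \int[P]_w F (w, b).
Proof.
move=> [mF [K FK]]; apply: Rintegral_law => //.
apply: (prob_bounded_L1 P (K := K)) => [|w]; last exact: FK.
by apply: measurableT_comp => //; exact: pair2_measurable.
Qed.

Let nu_int F : bounded_measurable F ->
  \int[nu]_p F p = \int[P]_w F (w, false) + \int[P]_w F (w, true).
Proof.
move=> bF; rewrite -!half_int//.
by have [] := measure_add_L1 (bounded_measurable_L1 fin_nu bF).
Qed.

Let shift_inv F : trig_span shift_fun F -> \int[half false]_p F p = \int[half true]_p F p.
Proof.
have bA G : trig_span shift_fun G -> bounded_measurable G.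
  by case: shift_algebra => + _ _ _; apply.
have iA G b : trig_span shift_fun G -> L1 (half b) setT G.
  by move=> AG; exact: (algebra_L1 (fin_half b) shift_algebra).
elim=> [th l [s ->]|F1 F2 A1 h1 A2 h2|k F1 A1 h1].
- have b1 : bounded_measurable (fun p : Omega * bool => cos (th + lin_comb p.2 s p.1)).
    by apply: bA; apply: trig_cos; exists s.
  by rewrite !half_int//=; exact: X_shift.
- by rewrite !RintegralD// ?h1 ?h2//; exact: iA.
- by rewrite !RintegralZl// ?h1//; exact: iA.
Qed.

Let cl := L1_closure nu (trig_span shift_fun).

Let trig_bounded q : trig_span (@linear_fun R) q -> bounded_measurable q.
Proof. by case: (trig_linear_algebra R) => + _ _ _; apply. Qed.

Let trig_shift q s : trig_span (@linear_fun R) q ->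
  trig_span shift_fun (fun p => q (X (s + p.2%:R) p.1)).
Proof.
elim=> [th l [u ->]|q1 q2 _ h1 _ h2|k q1 _ h1]; [|exact: trig_add|exact: trig_scale].
apply: trig_cos; exists [:: (u, s)]; apply/funext => -[w b] /=.
by rewrite /lin_comb big_seq1.
Qed.

Lemma trig_path_cont q e : trig_span (@linear_fun R) q -> 0 < e ->
  exists2 de, 0 < de & forall s t, `|s - t| <= de ->
    \int[P]_w `|q (X s w) - q (X t w)| <= e.
Proof.
move=> Aq; elim: Aq e => [th l [u ->]|q1 q2 A1 h1 A2 h2|k q1 A1 h1] e e0.
- exact: X_cont.
- have e2 : 0 < e / 2 by rewrite divr_gt0.
  have [d1 d10 h1'] := h1 _ e2; have [d2 d20 h2'] := h2 _ e2.
  exists (Num.min d1 d2); first by rewrite lt_min d10.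
  move=> s t; rewrite le_min => /andP[st1 st2].
  have i1 : L1 P setT (fun w => `|q1 (X s w) - q1 (X t w)|).
    by apply: L1_norm => //; apply: L1B => //; apply: bounded_comp_X_L1; exact: trig_bounded.
  have i2 : L1 P setT (fun w => `|q2 (X s w) - q2 (X t w)|).
    by apply: L1_norm => //; apply: L1B => //; apply: bounded_comp_X_L1; exact: trig_bounded.
  rewrite [e]splitr; apply: le_trans (lerD (h1' _ _ st1) (h2' _ _ st2)).
  rewrite -RintegralD//; apply: le_Rintegral => //; [|exact: L1D|].
    apply: L1_norm => //; apply: L1B => //; apply: (bounded_comp_X_L1 (g := q1 \+ q2));
    by apply: trig_bounded; exact: trig_add.
  by move=> w _ /=; rewrite opprD addrACA ler_normD.
- have e2 : 0 < e / (`|k| + 1) by rewrite divr_gt0// ltr_wpDl.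
  have [d1 d10 h1'] := h1 _ e2; exists d1 => // s t st.
  under eq_Rintegral do rewrite -mulrBr normrM.
  rewrite RintegralZl//; last first.
    by apply: L1_norm => //; apply: L1B => //; apply: bounded_comp_X_L1; exact: trig_bounded.
  apply: le_trans (ler_wpM2l _ (h1' _ _ st)) _ => //.
  by rewrite mulrA ler_pdivrMr ?ltr_wpDl// mulrC ler_pM2l// lerDl.
Qed.

Lemma osc_fubini q t a b : a <= b -> bounded_measurable q ->
  [/\ L1 P setT (fun w => \int[mu]_(s in `[a, b]) `|q (X s w) - q (X t w)|),
    L1 mu `[a, b] (fun s => \int[P]_w `|q (X s w) - q (X t w)|) &
  \int[P]_w \int[mu]_(s in `[a, b]) `|q (X s w) - q (X t w)| =
  \int[mu]_(s in `[a, b]) \int[P]_w `|q (X s w) - q (X t w)|].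
Proof.
move=> ab [mq [K qK]].
pose F (p : measurableTypeR R * Omega) := `|q (X p.1 p.2) - q (X t p.2)|.
have mF : measurable_fun setT F.
  apply: measurableT_comp => //; apply: measurable_funB; first exact: measurable_comp_X.
  apply: (measurableT_comp mq); apply: (measurableT_comp (measurable_X t)).
  exact: measurable_snd.
have FK p : `|F p| <= K + K.
  by rewrite /F normr_id; apply: le_trans (ler_normB _ _) _; exact: lerD.
have [m1 i1 e1] := bounded_fubini P mF FK a b; split => //.
apply: (prob_bounded_L1 P (K := (K + K) * (b - a))) => // w.
apply: le_Rint_itv => // [|s _]; last exact: (FK (s, w)).
apply: (@bounded_L1_itv R (fun s => F (s, w)) (K + K)) => //.
exact: (measurable_fun_pair1 w mF).
Qed.

(** The modulus of mean continuity is uniform in time, so one mesh 1 / (m + 1) serves every [k]. By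
    Fubini each of the m + 1 cells contributes at most e / (m + 1). A Riemann sum, unlike the
    integral, is a function of finitely many coordinates. *)
Lemma unit_int_riemann q e : trig_span (@linear_fun R) q -> 0 < e ->
  exists m, forall k, \int[P]_w `|unit_int q k w -
    \sum_(j < m.+1) m.+1%:R^-1 * q (X (k%:R + j%:R * m.+1%:R^-1) w)| <= e.
Proof.
move=> Aq e0; have [de de0 hde] := trig_path_cont Aq e0.
have bq := trig_bounded Aq.
have [m mde] : exists m, m.+1%:R^-1 <= de.
  exists (Num.truncn de^-1); rewrite -[leRHS]invrK lef_pV2 ?posrE ?invr_gt0//.
  by rewrite ltW// truncnS_gt.
exists m => k; set dl := m.+1%:R^-1.
have dl0 : 0 <= dl by rewrite /dl invr_ge0.
have m1 : m.+1%:R * dl = 1 by rewrite /dl mulfV.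
pose t j := k%:R + j%:R * dl.
have tS j : t j.+1 - t j = dl by rewrite /t -natr1; ring.
have tle j : t j <= t j.+1 by rewrite -subr_ge0 tS.
pose G j w := \int[mu]_(s in `[t j, t j.+1]) `|q (X s w) - q (X (t j) w)|.
have iG j : L1 P setT (G j) by have [] := osc_fubini (t j) (tle j) bq.
have [iSG eSG] := Rint_sum measurableT (index_enum 'I_m.+1) (fun j : 'I_m.+1 => iG j).
have iq s : L1 P setT (fun w => q (X s w)) by exact: bounded_comp_X_L1.
have iS : L1 P setT (fun w => \sum_(j < m.+1) dl * q (X (t j) w)).
  have [] // := Rint_sum (mu := P) measurableT (index_enum 'I_m.+1)
     (F := fun (j : 'I_m.+1) w => dl * q (X (t j) w)) _.
  by move=> j; exact: L1Z.
apply: (@le_trans _ _ (\int[P]_w \sum_(j < m.+1) G j w)).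
  apply: le_Rintegral => //.
    apply: L1_norm => //; apply: L1B => //.
    by apply: bounded_measurable_L1; [exact: fin_num_fun_lty|exact: bounded_unit_int].
  move=> w _; have ek : k%:R + 1 = k%:R + m.+1%:R * dl by rewrite m1.
  rewrite /unit_int ek Rintegral_itv_sum//; last exact: bounded_path_L1.
  rewrite -sumrB; apply: le_trans (ler_norm_sum _ _ _) _; apply: ler_sum => j _.
  have -> : dl * q (X (t j) w) = \int[mu]_(s in `[t j, t j.+1]) q (X (t j) w).
    by rewrite Rintegral_itv_cst// tS mulrC.
  have iqs := bounded_path_L1 (t j) (t j.+1) w bq.
  have ic : L1 mu `[t j, t j.+1] (fun=> q (X (t j) w)).
    by apply: (bounded_L1_itv _ _ (K := `|q (X (t j) w)|)).
  rewrite -RintegralB//; apply: le_normr_Rintegral => //; exact: L1B.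
rewrite eSG; apply: (@le_trans _ _ (\sum_(j < m.+1) e * dl)); last first.
  by rewrite sumr_const card_ord -mulr_natl mulrCA m1 mulr1.
apply: ler_sum => j _; have [_ i1 ->] := osc_fubini (t j) (tle j) bq.
rewrite -(tS j) -[leLHS]ger0_norm; last by apply: Rintegral_ge0 => s _; exact: Rintegral_ge0.
apply: le_Rint_itv => // s /andP[h1 h2].
rewrite ger0_norm; last exact: Rintegral_ge0.
apply: hde; apply: le_trans mde; rewrite ger0_norm ?subr_ge0//.
by rewrite -/dl -(tS j) lerD2r.
Qed.

Let bounded_fibres (F : Omega * bool -> R) :
  (forall b, bounded_measurable (fun w => F (w, b))) -> bounded_measurable F.
Proof.
move=> bF; split; first by apply: measurable_fun_bool => b; case: (bF b).
have [_ [K1 h1]] := bF true; have [_ [K2 h2]] := bF false.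
exists (`|K1| + `|K2|) => -[w []].
  by apply: le_trans (h1 w) _; apply: le_trans (ler_norm _) _; rewrite lerDl.
by apply: le_trans (h2 w) _; apply: le_trans (ler_norm _) _; rewrite lerDr.
Qed.

Let nu_dist F G e : bounded_measurable F -> bounded_measurable G ->
  (forall b, \int[P]_w `|F (w, b) - G (w, b)| <= e / 2) ->
  \int[nu]_p `|F p - G p| <= e.
Proof.
move=> [mF [K1 FK]] [mG [K2 GK]] h; rewrite (nu_int (F := fun p => `|F p - G p|)).
  by rewrite [e]splitr; apply: lerD.
split; first by apply: measurableT_comp => //; exact: measurable_funB.
exists (K1 + K2) => p; rewrite normr_id; apply: le_trans (ler_normB _ _) _.
exact: lerD.
Qed.

Let bounded_shifted g k : bounded_measurable g ->
  bounded_measurable (fun p : Omega * bool => unit_int g (k + p.2)%N p.1).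
Proof. by move=> bg; apply: bounded_fibres => b /=; exact: bounded_unit_int. Qed.

Let closure_unit_int_trig q k : trig_span (@linear_fun R) q ->
  cl (fun p : Omega * bool => unit_int q (k + p.2)%N p.1).
Proof.
move=> Aq; have bq := trig_bounded Aq.
apply: (closure_lim fin_nu shift_algebra).
  by apply: bounded_measurable_L1 => //; exact: bounded_shifted.
move=> e e0; have e2 : 0 < e / 2 by rewrite divr_gt0.
have [m hm] := unit_int_riemann Aq e2.
pose g (p : Omega * bool) := \sum_(j < m.+1) m.+1%:R^-1 *
  q (X (k%:R + j%:R * m.+1%:R^-1 + p.2%:R) p.1).
have Ag : trig_span shift_fun g.
  rewrite /g; elim: (index_enum _) => [|j s ih].
    under eq_fun do rewrite big_nil.
    by case: shift_algebra => _ + _ _; apply.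
  under eq_fun do rewrite big_cons; apply: trig_add => //.
  by apply: trig_scale; exact: trig_shift.
exists g; first exact: sub_closure.
have bg : bounded_measurable g by case: shift_algebra => + _ _ _; apply.
apply: nu_dist => // [|b]; first exact: bounded_shifted.
have := hm (k + b)%N; rewrite /g /=.
by under [X in _ -> X <= _]eq_Rintegral do (under eq_bigr do rewrite addrAC -natrD).
Qed.

(** Fubini and the equality of the laws of X_s reduce the distance between unit integrals to a
    distance under the law of X_0 alone, uniformly in [k]; hence density in one dimension is
    enough. *)
Lemma unit_int_dist g q k : bounded_measurable g -> bounded_measurable q ->
  \int[P]_w `|unit_int g k w - unit_int q k w| <= \int[P]_w `|g (X 0 w) - q (X 0 w)|.
Proof.
move=> bg bq; pose h x := `|g x - q x|.
have mh : measurable_fun setT h.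
  case: bg => mg _; case: bq => mq _.
  by apply: measurableT_comp => //; exact: measurable_funB.
have bh : bounded_measurable h.
  case: bg => _ [K1 h1]; case: bq => _ [K2 h2]; split => //.
  by exists (K1 + K2) => x; rewrite normr_id; apply: le_trans (ler_normB _ _) _; exact: lerD.
apply: (@le_trans _ _ (\int[P]_w unit_int h k w)).
  have iu f : bounded_measurable f -> L1 P setT (unit_int f k).
    move=> bf; apply: bounded_measurable_L1; last exact: bounded_unit_int.
    exact: fin_num_fun_lty.
  apply: le_Rintegral => //; [|exact: iu|].
    by apply: L1_norm => //; apply: L1B => //; exact: iu.
  move=> w _; have i1 := bounded_path_L1 k%:R (k%:R + 1) w bg.
  have i2 := bounded_path_L1 k%:R (k%:R + 1) w bq.
  rewrite /unit_int -RintegralB//; apply: le_normr_Rintegral => //; exact: L1B.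
have [_ [K hK]] := bh.
have [_ _] := bounded_fubini P (measurable_comp_X mh) (fun p => hK (X p.1 p.2)) k%:R (k%:R + 1).
rewrite /unit_int => -> /=.
rewrite [leLHS](@eq_Rintegral _ _ _ _ _ (cst (\int[P]_w h (X 0 w)))); last first.
  by move=> s _; exact: (same_Rintegral s mh (fun x => normr_ge0 _)).
by rewrite Rintegral_itv_cst ?lerDl// addrAC subrr add0r mulr1.
Qed.

Let fin_law : (law P (measurable_X 0) setT < +oo)%E.
Proof. by rewrite -ge0_fin_numE//; exact: fin_num_measure. Qed.

Lemma trig_approx (f : R -> R) e : measurable_fun setT f -> L1 P setT (fun w => f (X 0 w)) ->
  0 < e -> exists2 q, trig_span (@linear_fun R) q & \int[P]_w `|f (X 0 w) - q (X 0 w)| <= e.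
Proof.
move=> mf iff e0.
have ifl : L1 (law P (measurable_X 0)) setT f by apply/law_L1.
have [_ /(_ _ e0)[q Aq fq]] := trig_dense fin_law ifl.
have [mq _] := trig_bounded Aq.
exists q => //; move: fq; rewrite (Rintegral_law (measurable_X 0) (f := fun x => `|f x - q x|))//.
  by apply: measurableT_comp => //; exact: measurable_funB.
apply: L1_norm => //; apply: L1B => //.
by apply: bounded_comp_X_L1; exact: trig_bounded.
Qed.

Let closure_unit_int g k : bounded_measurable g ->
  cl (fun p : Omega * bool => unit_int g (k + p.2)%N p.1).
Proof.
move=> bg; apply: (closure_lim fin_nu shift_algebra).
  by apply: bounded_measurable_L1 => //; exact: bounded_shifted.
move=> e e0; have e2 : 0 < e / 2 by rewrite divr_gt0.
have [q Aq gq] := trig_approx (proj1 bg) (bounded_comp_X_L1 0 bg) e2.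
have bq := trig_bounded Aq.
exists (fun p : Omega * bool => unit_int q (k + p.2)%N p.1); first exact: closure_unit_int_trig.
apply: nu_dist => [||b]; [exact: bounded_shifted|exact: bounded_shifted|].
by apply: le_trans gq => /=; exact: (unit_int_dist (k + b) bg bq).
Qed.

(** The two running maxima are the fibres over false and true of one function on [Omega * bool].
    That function is built by lattice operations from unit integrals in the closure of the
    shift-invariant algebra, so its integrals over the two halves agree. *)
Let stationary_partial_max g lam n : bounded_measurable g ->
  \int[P]_w partial_max (fun i w => unit_int g i w - lam) n 0 w =
  \int[P]_w partial_max (fun i w => unit_int g i w - lam) n 1 w.
Proof.
move=> bg; pose W i w := unit_int g i w - lam.
pose W' i (p : Omega * bool) := unit_int g (i + p.2)%N p.1 - lam.
have eW k w b : partial_max W' n k (w, b) = partial_max W n (k + b) w.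
  by elim: n k => //= n ih k; rewrite ih.
have clW : cl (partial_max W' n 0).
  elim: n 0%N {eW} => [|n ih] k /=.
    by apply: sub_closure => //; case: shift_algebra => _ + _ _; apply.
  apply: (closure_max0 fin_nu shift_algebra).
  apply: (closureD fin_nu shift_algebra); last exact: ih.
  apply: (closureB fin_nu shift_algebra); first exact: closure_unit_int.
  by apply: sub_closure => //; case: shift_algebra => _ + _ _; apply.
have bW : bounded_measurable (partial_max W' n 0).
  apply: bounded_partial_max => i; have [m1 [K hK]] := bounded_shifted i bg.
  split; first exact: measurable_funB.
  by exists (K + `|lam|) => p; apply: le_trans (ler_normB _ _) _; rewrite lerD2r.
have := closure_functional_eq (fin_half false) (fin_half true) shift_algebra shift_inv clW.
rewrite !half_int//.
by under eq_Rintegral do rewrite eW; under [RHS]eq_Rintegral do rewrite eW.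
Qed.

Lemma maximal_bounded g lam n : bounded_measurable g -> (forall x, 0 <= g x) -> 0 < lam ->
  (lam%:E * P [set w | exists2 j, (j <= n)%N &
    (j%:R * lam < \int[mu]_(s in `[0, j%:R]) g (X s w))%R] <= (\int[P]_w g (X 0%R w))%:E)%E.
Proof.
move=> bg g0 lam0; have [mg [K gK]] := bg.
have V0 w : 0 <= unit_int g 0 w by apply: Rintegral_ge0.
have := garsia (fun i => bounded_unit_int i bg) V0 lam0
  (fun n => stationary_partial_max lam n bg) n.
have -> : \int[P]_w unit_int g 0 w = \int[P]_w g (X 0 w).
  have [_ _] := bounded_fubini P (measurable_comp_X mg) (fun p => gK (X p.1 p.2)) 0%:R (0%:R + 1).
  rewrite /unit_int => -> /=.
  rewrite [LHS](@eq_Rintegral _ _ _ _ _ (cst (\int[P]_w g (X 0 w)))); last first.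
    by move=> s _; exact: same_Rintegral.
  by rewrite Rintegral_itv_cst ?lerDl// addrAC subrr add0r mulr1.
congr (_ * P _ <= _)%E; apply/seteqP; split => w [j jn h]; exists j => //.
  move: h; congr (_ < _).
  rewrite -[X in `[0, X]]add0r -[X in 0 + X]mulr1 Rintegral_itv_sum//; last exact: bounded_path_L1.
  by apply: eq_bigr => i _; rewrite /unit_int !mulr1 !add0r natr1.
move: h; congr (_ < _).
rewrite -[X in `[0, X]]add0r -[X in 0 + X]mulr1 Rintegral_itv_sum//; last exact: bounded_path_L1.
by apply: eq_bigr => i _; rewrite /unit_int !mulr1 !add0r natr1.
Qed.

(** Truncation reduces to bounded [g]. The time integrals outside [B] are kept in the extended reals
    because integrability along the path is not assumed at this point. *)
Lemma maximal_inequality (g : R -> R) lam : measurable_fun setT g -> (forall x, 0 <= g x) ->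
  L1 P setT (fun w => g (X 0 w)) -> 0 < lam ->
  exists B, [/\ measurable B, (lam%:E * P B <= (\int[P]_w g (X 0%R w))%:E)%E &
    forall w, ~ B w -> forall j : nat,
      (\int[mu]_(s in `[0%R, j%:R]) (g (X s w))%:E <= (j%:R * lam)%:E)%E].
Proof.
move=> mg g0 ig lam0; pose g_ (n : nat) x := Num.min (g x) n%:R.
have g_0 n x : 0 <= g_ n x by rewrite /g_ le_min g0/=.
have mg_ n : measurable_fun setT (g_ n) by exact: measurable_minr.
have g_n n x : `|g_ n x| <= n%:R by rewrite ger0_norm// /g_ ge_min lexx orbT.
have bg_ n : bounded_measurable (g_ n) by split => //; exists n%:R.
have g_mono n m x : (n <= m)%N -> g_ n x <= g_ m x.
  by move=> nm; rewrite /g_ le_min !ge_min lexx/= ler_nat nm orbT.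
pose A n j := [set w | j%:R * lam < \int[mu]_(s in `[0, j%:R]) g_ n (X s w)].
(* The index [n] is both the truncation level and the time horizon, so that the sets increase and
   continuity from below applies to a single sequence. *)
pose B n := [set w | exists2 j, (j <= n)%N & A n j w].
have mA n j : measurable (A n j).
  have [m1 _ _] := bounded_fubini P (measurable_comp_X (mg_ n)) (fun p => g_n n (X p.1 p.2)) 0 j%:R.
  rewrite -[A n j]setTI (_ : A n j = (fun w => \int[mu]_(s in `[0, j%:R]) g_ n (X s w)) @^-1` `]j%:R * lam, +oo[%classic).
    exact: m1.
  by apply/seteqP; split => x /=; rewrite /A/= in_itv/= andbT.
have mB n : measurable (B n).
  rewrite (_ : B n = \bigcup_(j in [set j | (j <= n)%N]) A n j); first exact: bigcup_measurable.
  by apply/seteqP; split => [w [j jn h]|w [j jn h]]; exists j.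
have ndB : {homo B : n m / (n <= m)%N >-> (n <= m)%O}.
  move=> n m nm; apply/subsetPset => w [j jn Aw]; exists j; first exact: leq_trans nm.
  apply: lt_le_trans Aw _; apply: le_Rintegral => //.
  - exact: bounded_path_L1.
  - exact: bounded_path_L1.
  - by move=> s _; exact: g_mono.
have mU : measurable (\bigcup_n B n) by exact: bigcup_measurable.
have cB : P (B n) @[n --> \oo] --> P (\bigcup_n B n) by exact: nondecreasing_cvg_mu.
exists (\bigcup_n B n); split => //.
  rewrite -lee_pdivlMl// -(cvg_lim (@ereal_hausdorff R) cB).
  apply: lime_le; first by apply/cvg_ex; exists (P (\bigcup_n B n)); exact: cB.
  apply: nearW => n /=; rewrite lee_pdivlMl//.
  apply: le_trans (maximal_bounded n (bg_ n) (g_0 n) lam0) _.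
  rewrite lee_fin; apply: le_Rintegral => //; first exact: bounded_comp_X_L1.
  by move=> w _; rewrite /g_ ge_min lexx.
move=> w nBw j.
have mgX : @measurable_fun _ _ (measurableTypeR R) (measurableTypeR R) setT (fun s => g (X s w)).
  exact: (measurable_fun_pair1 w (measurable_comp_X mg)).
have mgXn n : @measurable_fun _ _ (measurableTypeR R) (measurableTypeR R) setT (fun s => g_ n (X s w)).
  exact: (measurable_fun_pair1 w (measurable_comp_X (mg_ n))).
have := @cvg_monotone_convergence _ (measurableTypeR R) R mu `[0, j%:R]
  (measurable_itv _) (fun n s => (g_ n (X s w))%:E).
have lg s : limn (fun n => (g_ n (X s w))%:E) = (g (X s w))%:E.
  apply: cvg_lim => //; apply: cvg_near_cst.
  exists (Num.truncn (g (X s w))).+1 => // n /= h; congr EFin; apply/min_idPl.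
  by apply: ltW; apply: lt_le_trans (truncnS_gt _) _; rewrite ler_nat.
move=> /(_ _ _ _); under [X in _ -> _ --> X]eq_integral do rewrite lg.
move=> cv.
have {}cv : (\int[mu]_(s in `[0%R, j%:R]) (g_ n (X s w))%:E)%E @[n --> \oo] -->
    (\int[mu]_(s in `[0%R, j%:R]) (g (X s w))%:E)%E.
  apply: cv => [n|n s _|s _ n m nm].
  - by apply/measurable_EFinP; apply: measurable_funTS; exact: mgXn.
  - by rewrite lee_fin.
  - by rewrite lee_fin; exact: g_mono.
rewrite -(cvg_lim (@ereal_hausdorff R) cv); apply: lime_le.
  by apply/cvg_ex; eexists; exact: cv.
(* From n = j on, the horizon [j] is covered by [B n], so being outside [B n] bounds the integral of
   the truncated function. *)
exists j => // n /= jn.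
have := bounded_path_L1 0 j%:R w (bg_ n) => /integrable_fin_num fn.
rewrite -[leLHS]fineK; last exact: fn.
rewrite lee_fin leNgt; apply/negP => h; apply: nBw; exists n => //.
by exists j.
Qed.

Definition average (f : R -> R) (w : Omega) (T : R) : R :=
  T^-1 * \int[mu]_(s in `[0, T]) f (X s w).

(** * Averages of a bounded function whose covariances decay like 1 / |s - t| *)

Section mixing.
Variables (c : R -> R) (C : R).
Hypotheses (mc : measurable_fun setT c) (c2 : forall x, `|c x| <= 2) (C_ge0 : 0 <= C).
Hypothesis c_mix : forall s t, `|\int[P]_w (c (X s w) * c (X t w))| * `|s - t| <= C.

Let bc : bounded_measurable c. Proof. by split => //; exists 2. Qed.

Let S N w := \int[mu]_(s in `[0, N]) c (X s w).

Let mS N : measurable_fun setT (S N).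
Proof. by have [] := bounded_fubini P (measurable_comp_X mc) (fun p => c2 (X p.1 p.2)) 0 N. Qed.

Let S_bound N w : 0 <= N -> `|S N w| <= 2 * N.
Proof.
move=> N0; rewrite -[X in 2 * X]subr0; apply: le_Rint_itv => //.
exact: bounded_path_L1.
Qed.

Let c_cov s t : `|\int[P]_w (c (X s w) * c (X t w))| <= 4.
Proof.
have m s' : measurable_fun setT (fun w => c (X s' w)).
  by apply: (measurableT_comp mc); exact: measurable_X.
have b w : `|c (X s w) * c (X t w)| <= 4.
  by rewrite normrM (_ : 4 = 2 * 2); [exact: ler_pM|ring].
have i1 : L1 P setT (fun w => c (X s w) * c (X t w)).
  by apply: (prob_bounded_L1 P (K := 4)) => //; exact: measurable_funM.
have i4 : L1 P setT (cst (4 : R)) by apply: (prob_bounded_L1 P (K := 4)) => // w; rewrite ger0_norm.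
have := le_Rint_norm measurableT i1 i4 (fun w _ => b w).
by rewrite prob_Rint_cst.
Qed.

(** On |s - t| <= a, a set of length at most 2 a, the covariance is bounded by 4, which gives 8 a;
    elsewhere it is at most C / a, over a length at most N. *)
Let cov_int N t a : 0 <= N -> 0 < a ->
  `|\int[mu]_(s in `[0, N]) \int[P]_w (c (X s w) * c (X t w))| <= 8 * a + N * (C / a).
Proof.
move=> N0 a0.
pose F (p : measurableTypeR R * Omega) := c (X p.1 p.2) * c (X t p.2).
have mF : measurable_fun setT F.
  apply: measurable_funM; first exact: measurable_comp_X.
  apply: (measurableT_comp mc); apply: (measurableT_comp (measurable_X t)).
  exact: measurable_snd.
have FK p : `|F p| <= 4.
  by rewrite /F normrM (_ : 4 = 2 * 2); [exact: ler_pM|ring].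
have [_ i1 _] := bounded_fubini P mF FK 0 N.
pose I : R -> R := \1_`[t - a, t + a].
have mI : measurable_fun setT I by exact: measurable_indic.
have I01 s : `|I s| <= 1 by rewrite /I indicE ger0_norm// lern1 leq_b1.
have i2 : L1 mu `[0, N] I by exact: (bounded_L1_itv _ _ mI I01).
have i3 : L1 mu `[0, N] (cst (C / a)) by apply: (bounded_L1_itv _ _ (K := `|C / a|)).
apply: (@le_trans _ _ (\int[mu]_(s in `[0, N]) (4 * I s + C / a))).
  apply: (le_Rint_norm _ i1) => //; first by apply: L1D => //; exact: L1Z.
  move=> s _; rewrite /I indicE; case: (boolP (s \in _)) => [_|/negP h].
    by rewrite mulr1; apply: le_trans (c_cov s t) _; rewrite lerDl divr_ge0// ltW.
  rewrite mulr0 add0r ler_pdivlMr//; apply: le_trans (c_mix s t).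
  rewrite ler_wpM2l// leNgt; apply/negP => st; apply: h; rewrite inE/= in_itv/=.
  by move: st; rewrite ltr_norml => /andP[h1 h2]; apply/andP; split; lra.
rewrite RintegralD//; last exact: L1Z.
rewrite RintegralZl// Rintegral_itv_cst// subr0 (mulrC (C / a)) lerD2r.
rewrite (_ : 8 * a = 4 * (2 * a)); last by ring.
rewrite ler_pM2l//.
apply: (@le_trans _ _ (\int[mu]_s I s)).
  rewrite Rintegral_mkcond; apply: le_Rintegral => //.
  - apply: (@L1_le _ (measurableTypeR R) R mu setT measurableT _ I).
    + by apply/(measurable_restrictT _ _).1 => //; exact: measurable_funTS.
    + exact: integrable_indic_itv.
    + move=> s _; rewrite patchE; case: ifP => _; last by rewrite normr0.
      by rewrite ger0_norm.
  - exact: integrable_indic_itv.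
  - by move=> s _; rewrite patchE; case: ifP.
rewrite /I /Rintegral integral_indic// setIT fine_lebesgue_itv; last lra.
by rewrite (_ : _ - _ = 2 * a)//; ring.
Qed.

(** The square of the time integral is a double time integral. Fubini, applied once for each
    variable, brings it to integrals of covariances, which [cov_int] bounds uniformly in the outer
    variable. *)
Lemma second_moment N a : 0 <= N -> 0 < a ->
  \int[P]_w (S N w) ^+ 2 <= N * (8 * a + N * (C / a)).
Proof.
move=> N0 a0.
pose F (p : measurableTypeR R * Omega) := c (X p.1 p.2) * S N p.2.
have mF : measurable_fun setT F.
  apply: measurable_funM; first exact: measurable_comp_X.
  by apply: (measurableT_comp (mS N)); exact: measurable_snd.
have FK p : `|F p| <= 2 * (2 * N).
  by rewrite /F normrM ler_pM//; exact: S_bound.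
have [_ i1 e1] := bounded_fubini P mF FK 0 N.
have -> : \int[P]_w (S N w) ^+ 2 = \int[mu]_(s in `[0, N]) \int[P]_w F (s, w).
  rewrite -e1; apply: eq_Rintegral => w _; rewrite expr2 /F /=.
  by rewrite RintegralZr//; exact: bounded_path_L1.
apply: le_trans (ler_norm _) _; rewrite mulrC -[X in _ * X]subr0.
apply: le_Rint_itv => // s _.
pose G (p : measurableTypeR R * Omega) := c (X p.1 p.2) * c (X s p.2).
have mG : measurable_fun setT G.
  apply: measurable_funM; first exact: measurable_comp_X.
  apply: (measurableT_comp mc); apply: (measurableT_comp (measurable_X s)).
  exact: measurable_snd.
have GK p : `|G p| <= 4.
  by rewrite /G normrM (_ : 4 = 2 * 2); [exact: ler_pM|ring].
have [_ _ e2] := bounded_fubini P mG GK 0 N.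
have -> : \int[P]_w F (s, w) = \int[mu]_(t in `[0, N]) \int[P]_w G (t, w).
  rewrite -e2; apply: eq_Rintegral => w _; rewrite /F /G /= mulrC.
  by rewrite RintegralZr//; exact: bounded_path_L1.
exact: cov_int.
Qed.

Let pow4 (n : nat) : R := n.+1%:R ^+ 4.

Let pow4_gt0 n : 0 < pow4 n. Proof. by rewrite exprn_gt0. Qed.

Let subsequence_ae : {ae P, forall w, (S (pow4 n) w / pow4 n) ^+ 2 @[n --> \oo] --> 0}.
Proof.
have mZ n : measurable_fun setT (fun w => (S (pow4 n) w / pow4 n) ^+ 2).
  by apply: measurable_funX; apply: measurable_funM.
have iS2 n : L1 P setT (fun w => S (pow4 n) w ^+ 2).
  apply: (prob_bounded_L1 P (K := (2 * pow4 n) ^+ 2)); first exact: measurable_funX.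
  have p0 : 0 <= 2 * pow4 n by rewrite mulr_ge0// ltW.
  by move=> w; rewrite normrX ler_pXn2r ?nnegrE//; apply: S_bound; exact: ltW.
have eZ n w : (S (pow4 n) w / pow4 n) ^+ 2 = (pow4 n ^+ 2)^-1 * S (pow4 n) w ^+ 2.
  by rewrite exprMn exprVn mulrC.
apply: (@ae_cvg0 _ _ _ P _ (8 + C)) => [n w|n|n].
- exact: sqr_ge0.
- by under eq_fun do rewrite eZ; exact: L1Z.
- under eq_Rintegral do rewrite eZ; rewrite RintegralZl//.
  have q0 : 0 < n.+1%:R :> R by [].
  (* With N = (n + 1)^4 the cut a = (n + 1)^2 balances the two terms, and dividing by N^2 leaves
     exactly (8 + C) / (n + 1)^2. *)
  apply: le_trans (ler_wpM2l _ (second_moment (a := n.+1%:R ^+ 2) _ _)) _.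
  + by rewrite invr_ge0 sqr_ge0.
  + exact: ltW.
  + by rewrite exprn_gt0.
  + rewrite le_eqVlt; apply/orP; left; apply/eqP; rewrite /pow4.
    by move: (n.+1%:R) q0 => q q0; field; rewrite gt_eqF.
Qed.

(** Between consecutive fourth powers the time integral moves by at most twice the gap, since |c| <=
    2, and the gap is negligible compared with T. *)
Lemma average_mixing_ae : {ae P, forall w, average c w T @[T --> +oo] --> 0}.
Proof.
apply: filterS subsequence_ae => w /cvgrPdist_le cw.
apply/cvgrPdist_le => e e0; have e2 : 0 < e / 2 by rewrite divr_gt0.
have e22 : 0 < (e / 2) ^+ 2 by rewrite exprn_gt0.
have [n0 _ hn0] := cw _ e22.
(* For q >= 1 the gap (q + 1)^4 - q^4 is at most 15 q^3, so it costs at most 30 q^3, which is below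
   (e / 2) q^4 once q >= 60 / e. *)
pose n1 := (maxn n0 (Num.truncn (60 / e))).+1.
near=> T.
have Tn : (n1%:R ^+ 4 : R) <= T by near: T; exact: nbhs_pinfty_ge.
have T0 : 0 <= T by apply: le_trans Tn; exact: exprn_ge0.
pose r := Num.sqrt (Num.sqrt T).
have r0 : 0 <= r by exact: sqrtr_ge0.
have rT : r ^+ 4 = T.
  by rewrite (exprM r 2 2) !sqr_sqrtr// sqrtr_ge0.
have nr : n1%:R <= r.
  by rewrite -(ler_pXn2r (n := 4)) ?nnegrE// rT.
have /andP[] := truncn_itv r0; set n := Num.truncn r => nl nU.
have n1n : (n1 <= n)%N by rewrite truncn_ge_nat.
have n_gt0 : (0 < n)%N by exact: leq_trans n1n.
(* The predecessor is taken because [pow4 m] is the fourth power of [m.+1]; thus [pow4 m] is n^4,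
   with n the integer part of the fourth root of T. *)
pose m := n.-1; have mn : n = m.+1 by rewrite /m prednK.
have [m1 m2] : (n0 <= m)%N /\ (Num.truncn (60 / e) <= m)%N.
  by move: n1n; rewrite mn /n1 ltnS geq_max => /andP.
have q1 : 1 <= m.+1%:R :> R by rewrite ler1n.
have qe : 60 / e <= m.+1%:R.
  by rewrite ltW//; apply: lt_le_trans (truncnS_gt _) _; rewrite ler_nat.
have TL : pow4 m <= T by rewrite -rT /pow4 -mn ler_pXn2r ?nnegrE.
have TU : T <= (m.+1%:R + 1) ^+ 4.
  by rewrite -rT natr1 -mn ler_pXn2r ?nnegrE// ltW.
have Am : `|S (pow4 m) w| <= e / 2 * pow4 m.
  have := hn0 m m1; rewrite /= sub0r normrN normrX ler_pXn2r ?nnegrE//; last exact: ltW.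
  by rewrite normrM normfV (gtr0_norm (pow4_gt0 m)) ler_pdivrMr.
have ST : `|S T w| <= `|S (pow4 m) w| + 2 * (T - pow4 m).
  rewrite {1}/S (@Rintegral_itv_cat _ _ _ (pow4 m))//; last 2 first.
  - exact: ltW.
  - exact: bounded_path_L1.
  apply: le_trans (ler_normD _ _) _; rewrite lerD2l.
  by apply: le_Rint_itv => //; exact: bounded_path_L1.
have T1 : 0 < T by exact: lt_le_trans (pow4_gt0 m) TL.
rewrite sub0r normrN /average normrM normfV (gtr0_norm T1) mulrC ler_pdivrMr//.
apply: (le_trans ST); apply: (@le_trans _ _ (e * pow4 m)); last by rewrite ler_pM2l.
have -> : e * pow4 m = e / 2 * pow4 m + e / 2 * pow4 m by field.
apply: lerD => //.
move: TU qe q1; rewrite /pow4; move: (m.+1%:R) => q TU qe q1.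
have eq : 60 <= e * q by rewrite mulrC -ler_pdivrMr.
have : (q + 1) ^+ 4 - q ^+ 4 <= 15 * q ^+ 3.
  rewrite -subr_ge0 (_ : _ - _ = (q - 1) * (11 * q ^+ 2 + 5 * q + 1)); last by ring.
  by rewrite mulr_ge0 ?subr_ge0// !addr_ge0// mulr_ge0// ?sqr_ge0// (le_trans _ q1).
have : 60 * q ^+ 3 <= e * q ^+ 4.
  rewrite (_ : e * q ^+ 4 = e * q * q ^+ 3); last by ring.
  by rewrite ler_wpM2r// exprn_ge0// (le_trans _ q1).
rewrite (_ : e * q ^+ 4 = 2 * (e / 2 * q ^+ 4)); last by field.
move: TU; move: (q ^+ 4) (q ^+ 3) ((q + 1) ^+ 4) (e / 2 * _) => q4 q3 q14 e4; lra.
Unshelve. all: by end_near. Qed.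

End mixing.

Hypothesis X_mix : forall th u, exists2 C, 0 <= C & forall s t,
  `|\int[P]_w ((cos (th + u * X s w) - \int[P]_w' cos (th + u * X 0 w')) *
               (cos (th + u * X t w) - \int[P]_w' cos (th + u * X 0 w')))| * `|s - t| <= C.

Lemma trig_ergodic q : trig_span (@linear_fun R) q ->
  {ae P, forall w, average q w T @[T --> +oo] --> \int[P]_w q (X 0 w)}.
Proof.
elim=> [th l [u ->]|q1 q2 A1 h1 A2 h2|k q1 A1 h1].
- set m := \int[P]_w _.
  have mcos := measurable_cosD th u.
  have cos1 (x : R) : `|cos x| <= 1 by rewrite ler_norml cos_geN1 cos_le1.
  have icos s : L1 P setT (fun w => cos (th + u * X s w)).
    exact: cosD_L1 (measurable_X s).
  have m1 : `|m| <= 1.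
    rewrite -(prob_Rint_cst P 1); apply: (le_Rint_norm measurableT (icos 0)) => //.
    by apply: (prob_bounded_L1 P (K := 1)) => // _; rewrite normr1.
  have [C C0 hC] := X_mix th u.
  pose c x := cos (th + u * x) - m.
  have mc : measurable_fun setT c by exact: measurable_funB.
  have c2 x : `|c x| <= 2.
    by rewrite -[2]/(1 + 1); apply: le_trans (ler_normB _ _) _; exact: lerD.
  have := average_mixing_ae mc c2 C0 hC; apply: filterS => w cw.
  have bc : bounded_measurable c by split => //; exists 2.
  have cm : (average c w T + m) @[T --> +oo] --> m.
    by rewrite -[X in _ --> X]add0r; apply: cvgD => //; exact: cvg_cst.
  apply: (cvg_trans _ cm); apply: near_eq_cvg; near=> T.
  have T0 : 0 < T by [].
  rewrite /average -[m in LHS](mulKf (lt0r_neq0 T0)) -mulrDr; congr (_ * _).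
  have -> : T * m = \int[mu]_(s in `[0, T]) m by rewrite Rintegral_itv_cst ?ltW// subr0 mulrC.
  rewrite -RintegralD//; last 2 first.
  + exact: bounded_path_L1.
  + by apply: (bounded_L1_itv _ _ (K := `|m|)).
  by apply: eq_Rintegral => s _; rewrite /c subrK.
- have b1 := trig_bounded A1; have b2 := trig_bounded A2.
  apply: filterS2 h1 h2 => w h1 h2; rewrite RintegralD//; [|exact: bounded_comp_X_L1..].
  apply: cvg_eq1 (cvgD h1 h2) => T.
  rewrite !fctE /average -mulrDr RintegralD//; exact: bounded_path_L1.
- have b1 := trig_bounded A1.
  apply: filterS h1 => w h1; rewrite RintegralZl//; last exact: bounded_comp_X_L1.
  apply: (cvg_eq1 _ (cvgM (cvg_cst k) h1)) => T.
  by rewrite /average /= RintegralZl//; [rewrite mulrCA|exact: bounded_path_L1].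
Unshelve. all: by end_near. Qed.

(** Tonelli: since X_s has the law of X_0, the integral of |f(X_s)| over [0, n] has expectation n
    E|f(X_0)|, which is finite. The null sets of the integer horizons are then combined, and they
    cover every T. *)
Lemma path_integrable (f : R -> R) : measurable_fun setT f -> L1 P setT (fun w => f (X 0 w)) ->
  {ae P, forall w, forall T, L1 mu `[0, T] (fun s => f (X s w))}.
Proof.
move=> mf iff.
have mfX := measurable_comp_X mf.
have iN (n : nat) : {ae P, forall w, L1 mu `[0, n%:R] (fun s => f (X s w))}.
  pose G (p : measurableTypeR R * Omega) : \bar R := (`|f (X p.1 p.2)| * \1_`[0, n%:R] p.1)%:E.
  have mG : measurable_fun setT G.
    apply/measurable_EFinP; apply: measurable_funM; first exact: measurableT_comp.
    by apply: (measurableT_comp _ measurable_fst); exact: measurable_indic.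
  have G0 p : (0 <= G p)%E by rewrite lee_fin mulr_ge0.
  have GE w : (\int[mu]_s G (s, w) = \int[mu]_(s in `[0%R, n%:R]) `|(f (X s w))%:E|)%E.
    rewrite [RHS]integral_mkcond; apply: eq_integral => s _.
    by rewrite /G /= patchE indicE; case: ifP => _; rewrite ?mulr1 ?mulr0.
  have HE s : (\int[P]_w G (s, w) = (\1_`[0%R, n%:R] s)%:E * \int[P]_w `|(f (X 0%R w))%:E|)%E.
    rewrite /G /=; under eq_integral do rewrite mulrC EFinM.
    rewrite ge0_integralZl//; last first.
      by apply/measurable_EFinP; apply: measurableT_comp => //; exact: (measurable_fun_pair2 s mfX).
    congr (_ * _)%E; apply: (same_integral s (g := fun x => `|f x|%:E)).
    + by apply/measurable_EFinP; exact: measurableT_comp.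
    + by move=> x; rewrite lee_fin.
  have fin : (\int[P]_w \int[mu]_s G (s, w) < +oo)%E.
    rewrite -(@fubini_tonelli _ _ _ _ _ mu P G mG G0).
    under eq_integral do rewrite HE.
    have /integrableP[_ fi] := iff.
    have [K Ke] : exists K : R, (\int[P]_w `|(f (X 0%R w))%:E|)%E = K%:E.
      exists (fine (\int[P]_w `|(f (X 0%R w))%:E|)%E); rewrite fineK// ge0_fin_numE//.
      exact: integral_ge0.
    rewrite Ke.
    under eq_integral do rewrite muleC.
    rewrite integralZl//; last exact: integrable_indic_itv.
    rewrite ltey_eq fin_numM//.
    by apply: integrable_fin_num => //; exact: integrable_indic_itv.
  have : P.-integrable setT (fun w => \int[mu]_s G (s, w))%E.
    apply/integrableP; split; first exact: (@measurable_fun_fubini_tonelli_G _ _ _ _ _ mu G mG G0).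
    by under eq_integral do rewrite gee0_abs ?integral_ge0//.
  move=> /(integrable_ae measurableT); apply: filterS => w /(_ I) fw.
  apply/integrableP; split.
    by apply/measurable_EFinP; apply: measurable_funTS; exact: (measurable_fun_pair1 w mfX).
  by rewrite -GE -ge0_fin_numE// integral_ge0.
have := ae_foralln iN; apply: filterS => w h T.
apply: (integrableS _ _ _ (h (Num.truncn T).+1)) => //.
by apply: subset_itvl; rewrite bnd_simp ltW// truncnS_gt.
Qed.

(** The bounds 1 / (k + 1) are not summable, but the intersection of the [B k] with k >= m has
    measure below all of them, hence 0. So almost every point is outside [B k] for arbitrarily large
    [k]. *)
Lemma negligible_tail (B : nat -> set Omega) : (forall k, measurable (B k)) ->
  (forall k, (P (B k) <= (k.+1%:R^-1)%:E)%E) ->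
  {ae P, forall w, forall m, exists2 k, (m <= k)%N & ~ B k w}.
Proof.
move=> mB PB; apply: ae_foralln => m.
exists (\bigcap_(k in [set k | (m <= k)%N]) B k); split.
- by apply: bigcap_measurable => //; exists m => /=.
- apply/eqP; rewrite eq_le measure_ge0 andbT; apply/lee_addgt0Pr => e e0; rewrite add0e.
  pose k := maxn m (Num.truncn e^-1).
  apply: (@le_trans _ _ (P (B k))).
    apply: le_measure; rewrite ?inE//.
    + by apply: bigcap_measurable => //; exists m => /=.
    + by apply: bigcap_inf => /=; exact: leq_maxl.
  apply: le_trans (PB k) _; rewrite lee_fin -[leRHS]invrK lef_pV2 ?posrE ?invr_gt0//.
  by rewrite ltW//; apply: lt_le_trans (truncnS_gt _) _; rewrite ler_nat ltnS leq_maxr.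
- move=> w /= nw k mk; apply: contrapT => nB; apply: nw.
  by exists k.
Qed.

Theorem ergodic_theorem (f : R -> R) : measurable_fun setT f ->
  L1 P setT (fun w => f (X 0 w)) ->
  {ae P, forall w, (forall T, L1 mu `[0, T] (fun s => f (X s w))) /\
    average f w T @[T --> +oo] --> \int[P]_w' f (X 0 w')}.
Proof.
(* Approximating [f] within [e k ^+ 2] and applying the maximal inequality at level [e k] makes the
   exceptional set of measure at most [e k]. *)
move=> mf iff; pose e (k : nat) : R := k.+1%:R^-1.
have e0 k : 0 < e k by rewrite invr_gt0.
have e20 k : 0 < e k ^+ 2 by rewrite exprn_gt0.
have /choice[q hq] : forall k, exists q, trig_span (@linear_fun R) q /\
    \int[P]_w `|f (X 0 w) - q (X 0 w)| <= e k ^+ 2.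
  by move=> k; have [q Aq fq] := trig_approx mf iff (e20 k); exists q.
have Aq k : trig_span (@linear_fun R) (q k) by case: (hq k).
have fq k : \int[P]_w `|f (X 0 w) - q k (X 0 w)| <= e k ^+ 2 by case: (hq k).
have bq k := trig_bounded (Aq k).
have iq k : L1 P setT (fun w => q k (X 0 w)) by exact: bounded_comp_X_L1.
pose g k x := `|f x - q k x|.
have mg k : measurable_fun setT (g k).
  by apply: measurableT_comp => //; apply: measurable_funB => //; case: (bq k).
have ig k : L1 P setT (fun w => g k (X 0 w)) by apply: L1_norm => //; exact: L1B.
have /choice[B hB] : forall k, exists B, [/\ measurable B,
    ((e k)%:E * P B <= (\int[P]_w g k (X 0%R w))%:E)%E &
    forall w, ~ B w -> forall j : nat,
      (\int[mu]_(s in `[0%R, j%:R]) (g k (X s w))%:E <= (j%:R * e k)%:E)%E].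
  by move=> k; apply: maximal_inequality => // x; rewrite /g.
have mB k : measurable (B k) by case: (hB k).
have PB k : (P (B k) <= (e k)%:E)%E.
  case: (hB k) => _ h _; rewrite -(@lee_pmul2l _ (e k)%:E) ?lte_fin//.
  by apply: (le_trans h); rewrite -EFinM lee_fin -expr2; exact: fq.
have qcv := ae_foralln (fun k => trig_ergodic (Aq k)).
apply: filterS3 (path_integrable mf iff) qcv (negligible_tail mB PB).
move=> w wi wq wB; split => //.
apply/cvgrPdist_le => d0 d00.
(* This makes e_k <= d0 / 8 for k >= m. The error budget is e_k for the expectations, d0 / 8 for the
   average of q_k and 2 e_k for the average of f - q_k: at most d0 / 2 in all. *)
pose m := Num.truncn (8 / d0).
have [k mk nBk] := wB m.
have ek : e k <= d0 / 8.
  rewrite -[leRHS]invrK lef_pV2 ?posrE// ?invr_gt0 ?divr_gt0// invf_div.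
  by rewrite ltW//; apply: lt_le_trans (truncnS_gt _) _; rewrite ler_nat.
have ek1 : e k <= 1 by rewrite invf_le1// ler1n.
have d8 : 0 < d0 / 8 by rewrite divr_gt0.
have /cvgrPdist_le/(_ _ d8) qk := wq k.
have [_ _ /(_ _ nBk) hg] := hB k.
near=> T.
have T1 : 1 <= T by near: T; exact: nbhs_pinfty_ge.
have T0 : 0 < T by exact: lt_le_trans T1.
have qT : `|\int[P]_w' q k (X 0 w') - average (q k) w T| <= d0 / 8 by near: T.
have igw U : L1 mu `[0, U] (fun s => `|f (X s w) - q k (X s w)|).
  by apply: L1_norm => //; apply: L1B => //; exact: bounded_path_L1.
have gT : `|average f w T - average (q k) w T| <= 2 * e k.
  rewrite /average -mulrBr -RintegralB//; last exact: bounded_path_L1.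
  rewrite normrM gtr0_norm ?invr_gt0// mulrC ler_pdivrMr//.
  apply: le_trans (le_normr_Rintegral _ _) _ => //.
    by apply: L1B => //; exact: bounded_path_L1.
  (* The maximal inequality speaks of integer horizons; rounding T >= 1 up at most doubles it,
     whence the factor 2. *)
  pose j := (Num.truncn T).+1.
  have Tj : T <= j%:R by rewrite ltW// truncnS_gt.
  have jT : j%:R <= 2 * T.
    have : (Num.truncn T)%:R <= T by rewrite truncn_le ltW.
    by rewrite /j -natr1; move: (_%:R) => z; lra.
  apply: (@le_trans _ _ (\int[mu]_(s in `[0, j%:R]) `|f (X s w) - q k (X s w)|)).
    rewrite (Rintegral_itv_cat (ltW T0) Tj (igw _)) lerDl.
    exact: Rintegral_ge0.
  rewrite -lee_fin /Rintegral fineK; last exact: (integrable_fin_num _ (igw _)).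
  apply: le_trans (hg j) _; rewrite lee_fin mulrAC.
  by rewrite mulrC (mulrC _ (e k)) ler_pM2l.
have fE : `|\int[P]_w' f (X 0 w') - \int[P]_w' q k (X 0 w')| <= e k.
  rewrite -RintegralB//; apply: le_trans (le_normr_Rintegral _ _) _ => //.
    exact: L1B.
  by apply: le_trans (fq k) _; rewrite expr2 ger_pMr.
have -> : \int[P]_w' f (X 0 w') - average f w T =
  (\int[P]_w' f (X 0 w') - \int[P]_w' q k (X 0 w')) +
  (\int[P]_w' q k (X 0 w') - average (q k) w T) -
  (average f w T - average (q k) w T) by ring.
apply: le_trans (ler_normB _ _) _.
apply: le_trans (lerD (ler_normD _ _) (lexx _)) _.
apply: le_trans (lerD (lerD fE qT) gT) _.
by move: ek; lra.
Unshelve. all: by end_near. Qed.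

End stationary_process.

(** * Gaussian variables *)

Section gaussian_integrals.
Context (R : realType).
Local Notation mu := (@lebesgue_measure R).
Implicit Types (m s x th u : R).

(** The integral over [m - n - 1, m + n + 1] is a difference of two values of F, each at most K / (n
    + 1). All Gaussian integrations by parts below have this form. *)
Lemma integral_derivative0 (F f : R -> R) (m K : R) :
  (forall x, is_derive x 1 F (f x)) -> continuous f -> L1 mu setT f ->
  (forall x, `|F x| * `|x - m| <= K) -> \int[mu]_x f x = 0.
Proof.
move=> dF cf iff FK.
pose a (n : nat) := m - n.+1%:R; pose b (n : nat) := m + n.+1%:R.
have ab n : a n < b n by rewrite /a /b ltrD2l gtrN.
have cF : continuous F.
  by move=> x; apply: differentiable_continuous; apply/derivable1_diffP; case: (dF x).
have FTC n : \int[mu]_x (f \_ `[a n, b n]) x = F (b n) - F (a n).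
  rewrite -Rintegral_mkcond /Rintegral (@continuous_FTC2 _ f F)//.
  - exact: continuous_subspaceT.
  - split; first by move=> x _; case: (dF x).
    + by apply: cvg_at_right_filter; exact: cF.
    + by apply: cvg_at_left_filter; exact: cF.
  - by move=> x _; rewrite derive1E; case: (dF x).
have K0 : 0 <= K by apply: le_trans (FK m); rewrite mulr_ge0.
have mf : measurable_fun setT f by exact: continuous_measurable_fun.
have [|||_ _ cv] := @Rint_bounded_cvg _ _ R mu setT measurableT (fun n => f \_ `[a n, b n]) f
   (fun x => `|f x|) _ mf _ (L1_norm iff).
- by move=> n; apply/(measurable_restrictT _ _).1 => //; exact: measurable_funTS.
- move=> x _; apply: cvg_near_cst.
  exists (Num.truncn `|x - m|) => // n /= kn.
  have xn : `|x - m| <= n.+1%:R.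
    by rewrite ltW//; apply: lt_le_trans (truncnS_gt _) _; rewrite ler_nat.
  rewrite patchE mem_set//= in_itv/= /a /b; move: xn; rewrite ler_norml => /andP[h1 h2].
  by apply/andP; split; [rewrite lerBlDr -lerBlDl|]; move: h1 h2; move: (n.+1%:R) => z; lra.
- move=> n x _; rewrite patchE; case: ifP => // _; by rewrite normr0.
apply/esym; apply: (cvg_unique _ _ cv) => //.
apply/cvgrPdist_le => e e0; near=> n.
rewrite FTC sub0r normrN; apply: le_trans (ler_normB _ _) _.
have n0 : 0 < n.+1%:R :> R by [].
have h x : `|x - m| = n.+1%:R -> `|F x| <= K / n.+1%:R.
  by move=> xm; rewrite ler_pdivlMr// -xm.
have h1 := h (b n); have h2 := h (a n).
apply: le_trans (lerD (h1 _) (h2 _)) _.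
- by rewrite /b addrAC subrr add0r ger0_norm.
- by rewrite /a addrAC subrr add0r normrN ger0_norm.
rewrite -mulrDl ler_pdivrMr// mulrC -ler_pdivrMr// ltW//.
apply: (@lt_trans _ _ n%:R); last by rewrite ltr_nat.
near: n; exact: nbhs_infty_gtr.
Unshelve. all: by end_near. Qed.

Section fixed_deviation.
Variables (m s : R).
Hypothesis s0 : s != 0.
Local Notation p := (normal_pdf m s).

Let s2_gt0 : 0 < s ^+ 2. Proof. by rewrite exprn_even_gt0. Qed.

Lemma normal_pdf_exp x : p x = normal_peak s * expR (- (x - m) ^+ 2 / (s ^+ 2 * 2)).
Proof. by rewrite normal_pdfE// /normal_fun mulr_natr. Qed.

Lemma normal_pdf_derive x : is_derive x 1 p (- ((x - m) / s ^+ 2) * p x).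
Proof.
rewrite (_ : p = (fun x => normal_peak s * expR (- (x - m) ^+ 2 / (s ^+ 2 * 2)))); last first.
  by apply/funext => y; rewrite normal_pdf_exp.
apply: is_derive_eq; rewrite /GRing.scale/=; by field.
Qed.

(** With z = (x - m)^2 / (4 s^2) the Gaussian factor is exp(-z) exp(-z): one copy absorbs the power,
    since z^(k+1) <= (k+1)! exp(z), and the other is the Gaussian factor of deviation sqrt 2 s. *)
Lemma normal_pdf_moment_bound k : exists K, forall x,
  `|x - m| ^+ k * p x <= K * normal_pdf m (Num.sqrt 2 * s) x.
Proof.
have s0' : Num.sqrt 2 * s != 0 by rewrite mulf_neq0// gt_eqF// sqrtr_gt0.
pose B : R := 1 + (4 * s ^+ 2) ^+ k.+1 * (k.+1)`!%:R.
exists (B * (normal_peak s / normal_peak (Num.sqrt 2 * s))) => x.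
rewrite normal_pdf_exp normal_pdfE// /normal_fun.
set y := x - m; set z := y ^+ 2 / (4 * s ^+ 2).
have z0 : 0 <= z by rewrite divr_ge0 ?sqr_ge0// mulr_ge0// ltW.
have -> : - y ^+ 2 / (s ^+ 2 * 2) = - z + - z by rewrite /z; field.
have -> : - y ^+ 2 / ((Num.sqrt 2 * s) ^+ 2 *+ 2) = - z.
  by rewrite exprMn sqr_sqrtr// /z -mulr_natr; field.
rewrite [leRHS](_ : _ = normal_peak s * (B * expR (- z))); last first.
  by field; rewrite gt_eqF// normal_peak_gt0.
rewrite expRD mulrCA ler_wpM2l ?normal_peak_ge0// mulrA ler_pM2r ?expR_gt0//.
rewrite expRN ler_pdivrMr ?expR_gt0//.
have yk : `|y| ^+ k <= 1 + (y ^+ 2) ^+ k.+1.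
  have [y1|y1] := leP `|y| 1.
    apply: (@le_trans _ _ 1); first by rewrite exprn_ile1.
    by rewrite lerDl exprn_ge0// sqr_ge0.
  apply: (@le_trans _ _ ((y ^+ 2) ^+ k.+1)); last by rewrite lerDr.
  rewrite -exprM -(ger0_norm (exprn_even_ge0 y _)) ?oddM// normrX.
  apply: ler_weXn2l; first exact: ltW.
  by rewrite mul2n -addnn (leq_trans (leqnSn k))// leq_addr.
apply: (le_trans yk).
have -> : y ^+ 2 = 4 * s ^+ 2 * z by rewrite /z; field.
have ez := expR_ge1Dxn k z0.
have e1 : 1 <= expR z by rewrite -expR0 ler_expR.
rewrite /B [leRHS]mulrDl [X in _ <= X + _]mul1r; apply: lerD => //.
rewrite exprMn -mulrA; apply: ler_wpM2l.
  by rewrite exprn_ge0// mulr_ge0// ltW.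
rewrite -ler_pdivrMl ?ltr0n ?fact_gt0// mulrC; apply: le_trans ez.
by rewrite lerDr.
Qed.

Lemma normal_pdf_moment k : L1 mu setT (fun x => `|x - m| ^+ k * p x).
Proof.
have [K hK] := normal_pdf_moment_bound k.
apply: (@L1_le _ (measurableTypeR R) R mu setT measurableT _
  (fun x => K * normal_pdf m (Num.sqrt 2 * s) x)) => //.
- apply: measurable_funM; last exact: measurable_normal_pdf.
  by apply: measurable_funX; apply: measurableT_comp => //; exact: measurable_funB.
- by apply: L1Z => //; exact: integrable_normal_pdf.
- by move=> x _; rewrite ger0_norm// mulr_ge0 ?exprn_ge0// normal_pdf_ge0.
Qed.

Lemma normal_pdf_bounded_moment k : exists K, forall x, `|x - m| ^+ k * p x <= K.
Proof.
have s0' : Num.sqrt 2 * s != 0 by rewrite mulf_neq0// gt_eqF// sqrtr_gt0.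
have [K hK] := normal_pdf_moment_bound k.
exists (`|K| * normal_peak (Num.sqrt 2 * s)) => x; apply: (le_trans (hK x)).
apply: (@le_trans _ _ (`|K| * normal_pdf m (Num.sqrt 2 * s) x)).
  by rewrite ler_wpM2r ?ler_norm// normal_pdf_ge0.
by rewrite ler_wpM2l// normal_pdf_ub.
Qed.

(** The derivative of the density is - (x - m) / s^2 times the density, and its integral
    vanishes. *)
Lemma normal_mean : \int[mu]_x ((x - m) * p x) = 0.
Proof.
have [K hK] := normal_pdf_bounded_moment 1.
have i1 : L1 mu setT (fun x => (x - m) * p x).
  apply: (@L1_le _ (measurableTypeR R) R mu setT measurableT _ _ _ (normal_pdf_moment 1)).
  - by apply: measurable_funM; [exact: measurable_funB|exact: measurable_normal_pdf].
  - by move=> x _; rewrite normrM expr1 (ger0_norm (normal_pdf_ge0 _ _ _)).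
have e : \int[mu]_x (- (s ^+ 2)^-1 * ((x - m) * p x)) = 0.
  apply: (@integral_derivative0 p _ m K).
  - by move=> x; apply: (is_derive_eq (normal_pdf_derive x)); field.
  - move=> x; apply: cvgM; first exact: cvg_cst.
    apply: cvgM; last exact: continuous_normal_pdf.
    by apply: cvgB; [exact: cvg_id|exact: cvg_cst].
  - exact: L1Z.
  - by move=> x; rewrite mulrC (ger0_norm (normal_pdf_ge0 _ _ _)) -[`|x - m|]expr1.
move: e; rewrite RintegralZl// => /eqP.
by rewrite mulf_eq0 oppr_eq0 invr_eq0 gt_eqF//= => /eqP.
Qed.

(** Here the function differentiated is (x - m) p(x), with derivative p(x) - (x - m)^2 p(x) /
    s^2. *)
Lemma normal_variance : \int[mu]_x ((x - m) ^+ 2 * p x) = s ^+ 2.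
Proof.
have [K hK] := normal_pdf_bounded_moment 2.
have i2 : L1 mu setT (fun x => (x - m) ^+ 2 * p x).
  apply: L1_eq (normal_pdf_moment 2) => // x _.
  by rewrite -normrX ger0_norm// sqr_ge0.
have ip : L1 mu setT p by exact: integrable_normal_pdf.
have e : \int[mu]_x (p x - (s ^+ 2)^-1 * ((x - m) ^+ 2 * p x)) = 0.
  apply: (@integral_derivative0 (fun x => (x - m) * p x) _ m K).
  - move=> x; have := normal_pdf_derive x => dp.
    by apply: is_derive_eq; rewrite /GRing.scale/=; field.
  - have cp : continuous p by exact: continuous_normal_pdf.
    move=> x; apply: cvgB; first exact: cp.
    apply: cvgM; first exact: cvg_cst.
    apply: cvgM; last exact: cp.
    by apply: cvgM; (apply: cvgB; [exact: cvg_id|exact: cvg_cst]).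
  - by apply: L1B => //; exact: L1Z.
  - move=> x; apply: le_trans (hK x).
    by rewrite normrM (ger0_norm (normal_pdf_ge0 _ _ _)) mulrAC expr2.
move: e; rewrite RintegralB//; last exact: L1Z.
rewrite RintegralZl// (_ : \int[mu]_x p x = 1); last by rewrite /Rintegral integral_normal_pdf.
by move/eqP; rewrite subr_eq0 => /eqP h; rewrite -[RHS]mulr1 h mulrA mulfV ?mul1r// gt_eqF.
Qed.

(** Differentiation under the integral, dominated by |x - m| p(x), followed by an integration by
    parts of sin(th + u (x - m)) p(x): the integral c solves c' = - s^2 u c. *)
Let normal_chf_derive th u :
  is_derive u 1 (fun u => \int[mu]_x (cos (th + u * (x - m)) * p x))
    (- (s ^+ 2 * u) * \int[mu]_x (cos (th + u * (x - m)) * p x)).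
Proof.
have cp : continuous p by exact: continuous_normal_pdf.
have cl v : continuous (fun x : R => th + v * (x - m)).
  move=> x; apply: cvgD; first exact: cvg_cst.
  apply: cvgM; first exact: cvg_cst.
  by apply: cvgB; [exact: cvg_id|exact: cvg_cst].
have ccos v : continuous (fun x => cos (th + v * (x - m)) * p x).
  move=> x; apply: cvgM; last exact: cp.
  by apply: (continuous_comp (cl v x)); exact: continuous_cos.
have csin v : continuous (fun x => sin (th + v * (x - m)) * p x).
  move=> x; apply: cvgM; last exact: cp.
  by apply: (continuous_comp (cl v x)); exact: continuous_sin.
have cos1 (x : R) : `|cos x| <= 1 by rewrite ler_norml cos_geN1 cos_le1.
have sin1 (x : R) : `|sin x| <= 1 by rewrite ler_norml sin_geN1 sin_le1.
have p0 x : 0 <= p x by exact: normal_pdf_ge0.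
have ip : L1 mu setT p by exact: integrable_normal_pdf.
have ic v : L1 mu setT (fun x => cos (th + v * (x - m)) * p x).
  apply: (@L1_le _ (measurableTypeR R) R mu setT measurableT _ p) => //.
    by apply: continuous_measurable_fun; exact: ccos.
  by move=> x _; rewrite normrM (ger0_norm (p0 x)) ler_piMl.
have imom : L1 mu setT (fun x => `|x - m| * p x).
  by apply: L1_eq (normal_pdf_moment 1) => // x _; rewrite expr1.
have isin v : L1 mu setT (fun x => (x - m) * (sin (th + v * (x - m)) * p x)).
  apply: (@L1_le _ (measurableTypeR R) R mu setT measurableT _ (fun x => `|x - m| * p x)) => //.
    apply: measurable_funM; first exact: measurable_funB.
    by apply: continuous_measurable_fun; exact: csin.
  by move=> x _; rewrite !normrM (ger0_norm (p0 x)) ler_wpM2l// ler_piMl.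
pose f (v x : R) : R := cos (th + v * (x - m)) * p x.
have df (v x : R) : is_derive v (1 : R) (f^~ x : R -> R) (- ((x - m) * (sin (th + v * (x - m)) * p x))).
  by apply: is_derive_eq; rewrite /GRing.scale/=; ring.
have parts v : \int[mu]_x ((x - m) * (sin (th + v * (x - m)) * p x)) =
    s ^+ 2 * v * \int[mu]_x f v x.
  have [K hK] := normal_pdf_bounded_moment 1.
  pose g x := v * f v x - (s ^+ 2)^-1 * ((x - m) * (sin (th + v * (x - m)) * p x)).
  have iA := L1Z measurableT v (ic v); have iB := L1Z measurableT (s ^+ 2)^-1 (isin v).
  have e : \int[mu]_x g x = 0.
    apply: (@integral_derivative0 (fun x => sin (th + v * (x - m)) * p x) g m K).
    - move=> x; have dp := normal_pdf_derive x.
      by apply: is_derive_eq; rewrite /g /f /GRing.scale/=; field.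
    - rewrite /g => x; apply: cvgB; first by apply: cvgM; [exact: cvg_cst|exact: ccos].
      apply: cvgM; first exact: cvg_cst.
      apply: cvgM; last exact: csin.
      by apply: cvgB; [exact: cvg_id|exact: cvg_cst].
    - exact: (L1B measurableT iA iB).
    - move=> x; apply: le_trans (hK x); rewrite expr1 normrM (ger0_norm (p0 x)) mulrC.
      by rewrite ler_wpM2l// ler_piMl.
  move: e; rewrite /g (RintegralB measurableT iA iB).
  rewrite (RintegralZl _ measurableT (ic v)) (RintegralZl _ measurableT (isin v)).
  move/eqP; rewrite subr_eq0 => /eqP h.
  by rewrite -mulrA h mulrA mulfV ?mul1r// gt_eqF.
have Iu : `]u - 1, u + 1[%classic u.
  by rewrite /= in_itv/= ltrBlDr ltrDl ltr01.
have D x y : `]u - 1, u + 1[%classic x -> setT y -> derivable (f^~ y) x 1.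
  by move=> _ _; case: (df x y).
have bG x y : `]u - 1, u + 1[%classic x -> setT y -> `|partial1of2 f x y| <= `|y - m| * p y.
  move=> _ _; rewrite partial1of2E; case: (df x y) => _ ->.
  by rewrite normrN !normrM (ger0_norm (p0 y)) ler_wpM2l// ler_piMl.
have G0 y : 0 <= `|y - m| * p y by rewrite mulr_ge0.
apply: DeriveDef.
  exact: (@derivable_under_integral R _ (measurableTypeR R) mu f setT measurableT u _ _ Iu
    (fun x _ => ic x) D _ G0 imom bG).
rewrite -derive1E (@differentiation_under_integral R _ (measurableTypeR R) mu f setT measurableT u _ _ Iu
    (fun x _ => ic x) D _ G0 imom bG).
rewrite mulNr -parts -mulN1r -RintegralZl//; apply: eq_Rintegral => x _.
by rewrite partial1of2E; case: (df u x) => _ ->; rewrite mulN1r.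
Qed.

(** By the differential equation c(u) exp(u^2 s^2 / 2) is constant, and at u = 0 it equals cos
    th. *)
Lemma normal_chf th u :
  \int[mu]_x (cos (th + u * (x - m)) * p x) = cos th * expR (- (u ^+ 2 * s ^+ 2 / 2)).
Proof.
pose c (u : R) : R := \int[mu]_x (cos (th + u * (x - m)) * p x).
pose g := fun u : R => (c u : R) * expR (u ^+ 2 * s ^+ 2 / 2).
have dg (v : R) : is_derive v (1 : R) (g : R -> R) 0.
  have dc : is_derive v (1 : R) (c : R -> R) (- (s ^+ 2 * v) * c v) := normal_chf_derive th v.
  by apply: is_derive_eq; rewrite /GRing.scale/=; field.
have gE : g u = cos th.
  rewrite (@is_derive_0_is_cst R g u 0 dg) /g expr0n /= !mul0r expR0 mulr1 /c.
  under eq_Rintegral do rewrite mul0r addr0.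
  rewrite RintegralZl//; last exact: integrable_normal_pdf.
  by rewrite /Rintegral integral_normal_pdf mulr1.
by rewrite -gE /g -mulrA -expRD subrr expR0 mulr1.
Qed.

End fixed_deviation.
End gaussian_integrals.

(** * Integrals against the normal law as Lebesgue integrals against its density *)

Section normal_prob_integral.
Context (R : realType) (m s : R).
Local Notation mu := (@lebesgue_measure R).
Let nu : probability (measurableTypeR R) R := normal_prob m s.

(** Both functions integrate to the normal probability over every measurable set. *)
Let dens : ae_eq mu setT (Radon_Nikodym (charge_of_finite_measure nu) mu)
  (EFin \o normal_pdf m s).
Proof.
have dom : nu `<< mu by exact: normal_prob_dominates.
apply: integral_ae_eq => //.
- exact: Radon_Nikodym_integrable.
- by apply/measurable_EFinP; exact: measurable_normal_pdf.
- by move=> E _ mE; rewrite -Radon_Nikodym_integral.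
Qed.

Lemma ge0_integral_normal_prob (g : measurableTypeR R -> R) :
  measurable_fun setT g -> (forall x, 0 <= g x) ->
  (\int[nu]_x (g x)%:E = \int[mu]_x (g x * normal_pdf m s x)%:E)%E.
Proof.
move=> mg g0; have dom : nu `<< mu by exact: normal_prob_dominates.
rewrite -(@Radon_Nikodym_SigmaFinite.change_of_variables _ _ _ nu mu)//; last exact/measurable_EFinP.
apply: ae_eq_integral => //.
- apply: emeasurable_funM; first exact/measurable_EFinP.
  exact: (measurable_int mu (Radon_Nikodym_SigmaFinite.f_integrable _)).
- apply/measurable_EFinP; apply: measurable_funM => //; exact: measurable_normal_pdf.
- apply: filterS2 dens (ae_eq_Radon_Nikodym_SigmaFinite dom measurableT) => x h1 h2 xT.
  by rewrite h2// h1.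
Qed.

Lemma L1_normal_prob (g : measurableTypeR R -> R) : measurable_fun setT g ->
  L1 mu setT (fun x => g x * normal_pdf m s x) ->
  L1 nu setT g /\ \int[nu]_x g x = \int[mu]_x (g x * normal_pdf m s x).
Proof.
move=> mg ig; have dom : nu `<< mu by exact: normal_prob_dominates.
have igx : L1 nu setT g.
  apply/integrableP; split; first exact/measurable_EFinP.
  rewrite (ge0_integral_normal_prob (g := fun x => `|g x|))//; last exact: measurableT_comp.
  have /integrableP[_] := ig; congr (_ < _)%E; apply: eq_integral => x _ /=.
  by rewrite normrM (ger0_norm (normal_pdf_ge0 _ _ _)).
split => //; rewrite /Rintegral; congr fine.
rewrite -(Radon_Nikodym_change_of_variables dom measurableT igx).
apply: ae_eq_integral => //.
- apply: emeasurable_funM; first exact/measurable_EFinP.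
  exact: (measurable_int mu (Radon_Nikodym_integrable _)).
- apply/measurable_EFinP; apply: measurable_funM => //; exact: measurable_normal_pdf.
- by apply: filterS dens => x h1 xT; rewrite h1.
Qed.

End normal_prob_integral.

Section gaussian_rv.
Context d (Omega : measurableType d) (R : realType) (P : probability Omega R).
Variable X : Omega -> R.

(** The cosine is stated at frequency 1 only: in a Gaussian process other frequencies are absorbed
    in the coefficients of a linear combination. *)
Lemma gaussian_rv_facts : gaussian_rv P X -> exists m s,
  [/\ forall k, L1 P setT (fun w => X w ^+ k),
    \int[P]_w X w = m,
    \int[P]_w (X w - m) ^+ 2 = s ^+ 2 &
    forall th, \int[P]_w cos (th + (X w - m)) = cos th * expR (- (s ^+ 2 / 2))].
Proof.
move=> [mX [m [s [s0 lawX]]]]; exists m, s.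
have mX' : @measurable_fun _ _ Omega (measurableTypeR R) setT X by [].
have mcos th : measurable_fun setT (fun x : R => cos (th + (x - m))).
  apply: measurableT_comp; first by apply: continuous_measurable_fun; exact: continuous_cos.
  by apply: measurable_funD => //; exact: measurable_funB.
have lE (A : set (measurableTypeR R)) : measurable A -> law P mX' A = gaussian_law m s A.
  by move=> mA; exact: lawX.
(* Transfer from [X] to its law, in the two cases of [gaussian_law]: a Dirac mass at m when s = 0, a
   density otherwise. *)
suff key (g : R -> R) : measurable_fun setT g ->
    (s = 0 -> L1 P setT (g \o X) /\ \int[P]_w g (X w) = g m) /\
    (s != 0 -> L1 (@lebesgue_measure R) setT (fun x => g x * normal_pdf m s x) ->
      L1 P setT (g \o X) /\
      \int[P]_w g (X w) = \int[lebesgue_measure]_x (g x * normal_pdf m s x)).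
  have [s_0|sN0] := eqVneq s 0.
    split.
    - by move=> k; have [/(_ s_0)[]] := key (fun x => x ^+ k) (measurable_funX _ (@measurable_id _ _ _)).
    - by have [/(_ s_0)[]] := key id (@measurable_id _ _ _).
    - have [/(_ s_0)[_ ->]] := key (fun x => (x - m) ^+ 2) ltac:(by apply: measurable_funX; exact: measurable_funB).
      by rewrite s_0 subrr.
    - move=> th; have [/(_ s_0)[_ ->]] := key _ (mcos th).
      by rewrite subrr addr0 s_0 expr0n mul0r oppr0 expR0 mulr1.
  have mom k : L1 (@lebesgue_measure R) setT (fun x => (x - m) ^+ k * normal_pdf m s x).
    apply: (@L1_le _ (measurableTypeR R) R _ setT measurableT _ _ _ (normal_pdf_moment m sN0 k)).
      apply: measurable_funM; last exact: measurable_normal_pdf.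
      by apply: measurable_funX; exact: measurable_funB.
    by move=> x _; rewrite normrM normrX (ger0_norm (normal_pdf_ge0 _ _ _)).
  have ip : L1 (@lebesgue_measure R) setT (normal_pdf m s) by exact: integrable_normal_pdf.
  have cent k : L1 P setT (fun w => (X w - m) ^+ k) /\
      \int[P]_w (X w - m) ^+ k = \int[lebesgue_measure]_x ((x - m) ^+ k * normal_pdf m s x).
    have [_ /(_ sN0 (mom k))] := key (fun x => (x - m) ^+ k) ltac:(by apply: measurable_funX; exact: measurable_funB).
    by [].
  have i1 : L1 P setT (fun w => X w - m).
    by have [+ _] := cent 1%N; apply: L1_eq => // w _; rewrite expr1.
  split.
  - move=> k.
    (* Raw moments come from the centred ones by the binomial formula, to be used with c = m. *)
    have h (c : R) : L1 P setT (fun w => ((X w - m) + c) ^+ k).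
      have [] // := Rint_sum (mu := P) measurableT (index_enum 'I_k.+1)
        (F := fun (i : 'I_k.+1) w => (c ^+ i *+ 'C(k, i)) * (X w - m) ^+ (k - i)) _.
        by move=> i; apply: L1Z => //; case: (cent (k - i)%N).
      move=> + _; apply: L1_eq => // w _; rewrite exprDn; apply: eq_bigr => i _.
      by rewrite mulrC mulrnAr.
    by have := h m; apply: L1_eq => // w _; rewrite subrK.
  - have [_] := cent 1%N; under eq_Rintegral do rewrite expr1.
    under [X in _ = X -> _]eq_Rintegral do rewrite expr1.
    rewrite normal_mean// => h.
    have : \int[P]_w ((X w - m) + m) = 0 + m.
      by rewrite RintegralD// ?prob_Rint_cst ?h//; exact: (prob_bounded_L1 P (K := `|m|)).
    by under eq_Rintegral do rewrite subrK; rewrite add0r.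
  - by have [_ ->] := cent 2%N; rewrite normal_variance.
  - move=> th; have [_ /(_ sN0)[|_ ->]] := key _ (mcos th).
      apply: (@L1_le _ (measurableTypeR R) R _ setT measurableT _ (normal_pdf m s)) => //.
        by apply: measurable_funM; [exact: mcos|exact: measurable_normal_pdf].
      move=> x _; rewrite normrM (ger0_norm (normal_pdf_ge0 _ _ _)) ler_piMl ?normal_pdf_ge0//.
      by rewrite ler_norml cos_geN1 cos_le1.
    have := normal_chf m sN0 th 1; rewrite expr1n mul1r => <-.
    by apply: eq_Rintegral => x _; rewrite mul1r.
move=> mg; split => [s_0|sN0 ig].
- have lE0 (h : R -> \bar R) : measurable_fun setT h -> (forall x, 0 <= h x)%E ->
      (\int[P]_w h (X w) = h m)%E.
    move=> mh h0; rewrite -(ge0_integral_law P mX')//.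
    rewrite (eq_measure_integral (dirac (m : measurableTypeR R))); last first.
      by move=> A mA _; rewrite /= lE// /gaussian_law s_0 eqxx.
    by rewrite integral_dirac// diracT mul1e.
  have igx : L1 P setT (g \o X).
    apply/integrableP; split; first by apply/measurable_EFinP; exact: (measurableT_comp mg).
    rewrite (lE0 (fun x => `|(g x)%:E|%E)) ?ltry//.
    by apply/measurable_EFinP; exact: measurableT_comp.
  split => //.
  rewrite -(Rintegral_law mX' mg igx) /Rintegral.
  rewrite (eq_measure_integral (dirac (m : measurableTypeR R))); last first.
    by move=> A mA _; rewrite /= lE// /gaussian_law s_0 eqxx.
  rewrite integral_dirac//; last exact/measurable_EFinP.
  by rewrite diracT mul1e.
- have lEn (A : set (measurableTypeR R)) : measurable A -> law P mX' A = normal_prob m s A.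
    by move=> mA; rewrite lE// /gaussian_law (negbTE sN0).
  have [in1 en] := L1_normal_prob mg ig.
  have igl : L1 (law P mX') setT g.
    apply/integrableP; split; first exact/measurable_EFinP.
    have /integrableP[_] := in1; congr (_ < _)%E; apply: eq_measure_integral => A mA _.
    by rewrite /= lEn.
  have igx : L1 P setT (g \o X) by apply/(law_L1 P mX').
  split => //; rewrite -en -(Rintegral_law mX' mg igx) /Rintegral; congr fine.
  by apply: eq_measure_integral => A mA _; exact: lEn.
Qed.

End gaussian_rv.

(** * The Lamperti transform of sub-fractional Brownian motion *)

Section gaussian_process_cos.
Context d (Omega : measurableType d) (R : realType) (P : probability Omega R).
Variables (X : R -> Omega -> R) (K : R -> R -> R).
Hypotheses (gX : gaussian_process P X)
  (mean0 : forall t, 0 <= t -> ('E_P[X t] = 0)%E)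
  (covK : forall s t, 0 <= s -> 0 <= t -> 'E_P[X s \* X t]%E = (K s t)%:E).

Lemma gaussian_process_moment t k : 0 <= t -> L1 P setT (fun w => X t w ^+ k).
Proof.
move=> t0; have := @gX 1%N (fun=> t) (fun=> 1) (fun=> t0).
move=> /gaussian_rv_facts[m [s [/(_ k) + _ _ _]]]; apply: L1_eq => // w _.
by rewrite big_ord1 mul1r.
Qed.

Let mX t : 0 <= t -> L1 P setT (X t).
Proof.
by move=> t0; apply: L1_eq (gaussian_process_moment 1 t0) => // w _; rewrite expr1.
Qed.

Let mXX s t : 0 <= s -> 0 <= t -> L1 P setT (fun w => X s w * X t w).
Proof.
move=> s0 t0; have i1 := gaussian_process_moment 2 s0; have i2 := gaussian_process_moment 2 t0.
apply: (L1_le measurableT _ (L1D measurableT i1 i2)).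
  by apply: measurable_funM; apply: L1_measurable; exact: mX.
move=> w _; rewrite normrM -(real_normK (num_real (X s w))) -(real_normK (num_real (X t w))).
move: (normr_ge0 (X s w)) (normr_ge0 (X t w)); move: `|X s w| `|X t w| => a b a0 b0.
have : 0 <= (a - b) ^+ 2 by exact: sqr_ge0.
have -> : (a - b) ^+ 2 = a ^+ 2 + b ^+ 2 - 2 * (a * b) by ring.
have : 0 <= a * b by exact: mulr_ge0.
lra.
Qed.

(** The linear combination is itself a centred Gaussian variable, so its one-dimensional formula
    applies; its variance is the quadratic form of the covariance by bilinearity. *)
Lemma gaussian_process_cos th (l : seq (R * R)) : (forall p, p \in l -> 0 <= p.2) ->
  \int[P]_w cos (th + \sum_(p <- l) p.1 * X p.2 w) =
  cos th * expR (- (\sum_(p <- l) \sum_(q <- l) p.1 * q.1 * K p.2 q.2) / 2).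
Proof.
move=> l0; pose n := size l; pose t (i : 'I_n) := (nth (0, 0) l i).2.
pose c (i : 'I_n) := (nth (0, 0) l i).1.
have t0 i : 0 <= t i by apply: l0; rewrite mem_nth.
have sumE (F : R * R -> R) : \sum_(p <- l) F p = \sum_(i < n) F (c i, t i).
  rewrite (big_nth (0, 0)) big_mkord; apply: eq_bigr => i _; rewrite /c /t.
  by case: (nth _ _ _).
have [m [s [mom mean var chf]]] := gaussian_rv_facts (@gX n t c t0).
have sum0 : \int[P]_w (\sum_(i < n) c i * X (t i) w) = 0.
  have [_ ->] := Rint_sum (mu := P) measurableT (index_enum 'I_n)
    (F := fun i w => c i * X (t i) w) (fun i => L1Z measurableT (c i) (mX (t0 i))).
  apply: big1 => i _; rewrite RintegralZl//; last exact: mX.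
  have := mean0 (t0 i); rewrite unlock /Rintegral => ->.
  by rewrite mulr0.
have m0 : m = 0 by rewrite -mean sum0.
have varE : s ^+ 2 = \sum_(i < n) \sum_(j < n) c i * c j * K (t i) (t j).
  rewrite -var m0.
  have ij i j : L1 P setT (fun w => c i * c j * (X (t i) w * X (t j) w)).
    by apply: L1Z => //; exact: mXX.
  have row i := Rint_sum (mu := P) measurableT (index_enum 'I_n)
    (F := fun j w => c i * c j * (X (t i) w * X (t j) w)) (ij i).
  have [_ e] := Rint_sum (mu := P) measurableT (index_enum 'I_n)
    (fun i => proj1 (row i)).
  transitivity (\int[P]_w (\sum_(i < n) \sum_(j < n) c i * c j * (X (t i) w * X (t j) w))).
    apply: eq_Rintegral => w _; rewrite subr0 expr2 mulr_suml; apply: eq_bigr => i _.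
    by rewrite mulr_sumr; apply: eq_bigr => j _; ring.
  rewrite e; apply: eq_bigr => i _; have [_ ->] := row i; apply: eq_bigr => j _.
  rewrite RintegralZl//; last exact: mXX.
  congr (_ * _); have := covK (t0 i) (t0 j); rewrite unlock /Rintegral => h.
  by rewrite (_ : (\int[P]_w _)%E = (K (t i) (t j))%:E).
have := chf th; rewrite m0 varE -mulNr => e.
rewrite (sumE (fun p => \sum_(q <- l) p.1 * q.1 * K p.2 q.2)).
under [in RHS]eq_bigr do rewrite sumE.
rewrite -e; apply: eq_Rintegral => w _.
by rewrite sumE subr0.
Qed.

End gaussian_process_cos.

(** * Stationarity, decay and continuity of the covariance of the Lamperti transform *)

Section lamperti_covariance.
Context (R : realType) (H alpha : R).
Hypotheses (H_gt0 : 0 < H) (H_lt1 : H < 1) (alpha_gt0 : 0 < alpha).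

Definition subfBm_cov (s t : R) : R := s `^ (2 * H) + t `^ (2 * H)
  - 2^-1 * ((s + t) `^ (2 * H) + `|t - s| `^ (2 * H)).

Definition lamperti_cov (s t : R) : R := expR (- (alpha * H * s)) * expR (- (alpha * H * t)) *
  subfBm_cov (expR (alpha * s)) (expR (alpha * t)).

Lemma subfBm_covZ k s t : 0 < k -> 0 <= s -> 0 <= t ->
  subfBm_cov (k * s) (k * t) = k `^ (2 * H) * subfBm_cov s t.
Proof.
move=> k0 s0 t0; rewrite /subfBm_cov -mulrDr -mulrBr normrM (ger0_norm (ltW k0)).
by rewrite !powRM ?addr_ge0// ?(ltW k0)//; ring.
Qed.

Lemma expR_powR (a b : R) : expR a `^ b = expR (a * b).
Proof. by rewrite /powR gt_eqF ?expR_gt0// expRK mulrC. Qed.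

(** A time shift by c multiplies both arguments of the original covariance by exp(alpha c);
    self-similarity turns this into the factor exp(2 alpha H c), which the Lamperti prefactors
    cancel. *)
Lemma lamperti_cov_shift c s t : lamperti_cov (s + c) (t + c) = lamperti_cov s t.
Proof.
rewrite /lamperti_cov !(mulrDr (alpha * H)) !(mulrDr alpha) !(expRD _ (alpha * c)).
rewrite !(mulrC _ (expR (alpha * c))).
rewrite subfBm_covZ ?expR_gt0 ?expR_ge0// expR_powR.
rewrite !opprD !expRD.
rewrite (_ : expR (alpha * c * (2 * H)) = (expR (- (alpha * H * c)) * expR (- (alpha * H * c)))^-1); last first.
  by rewrite -expRD -expRN; congr expR; ring.
have h : expR (- (alpha * H * c)) != 0 by rewrite gt_eqF// expR_gt0.
by move: (expR (- (alpha * H * c))) h => a h; field.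
Qed.

Lemma subfBm_covC s t : subfBm_cov s t = subfBm_cov t s.
Proof. by rewrite /subfBm_cov (addrC s t) (distrC t s) (addrC (s `^ _) (t `^ _)). Qed.

Lemma lamperti_covC s t : lamperti_cov s t = lamperti_cov t s.
Proof.
by rewrite /lamperti_cov subfBm_covC (mulrC (expR (- (alpha * H * s))) (expR (- (alpha * H * t)))).
Qed.

Lemma lamperti_cov_dist s t : lamperti_cov s t = lamperti_cov `|s - t| 0.
Proof.
wlog st : s t / t <= s.
  move=> h; have [ts|/ltW st] := leP t s; first exact: h.
  by rewrite lamperti_covC distrC; exact: h.
have := lamperti_cov_shift t (s - t) 0; rewrite subrK add0r => ->.
by rewrite ger0_norm ?subr_ge0.
Qed.

(** Factoring x^(2H) out of the powers of x + 1 and x - 1 exposes a second difference of y^(2H) at y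
    = 1 with step 1 / x: this is where the leading terms cancel. *)
Lemma subfBm_cov1E x : 1 <= x -> (x `^ H)^-1 * subfBm_cov x 1 =
  (x `^ H)^-1 + x `^ H * (1 - 2^-1 * ((1 + x^-1) `^ (2 * H) + (1 - x^-1) `^ (2 * H))).
Proof.
move=> x1; have x0 : 0 < x by exact: lt_le_trans x1.
have xv1 : x^-1 <= 1 by rewrite invf_le1.
rewrite /subfBm_cov powR1 (distrC 1 x) ger0_norm ?subr_ge0//.
have -> : x + 1 = x * (1 + x^-1) by rewrite mulrDr mulr1 mulfV// gt_eqF.
have -> : x - 1 = x * (1 - x^-1) by rewrite mulrBr mulr1 mulfV// gt_eqF.
rewrite !powRM ?(ltW x0)// ?subr_ge0// ?addr_ge0 ?invr_ge0 ?(ltW x0)//.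
have -> : x `^ (2 * H) = x `^ H * x `^ H.
  by rewrite -powRD ?(gt_eqF x0) ?implybT//; congr (_ `^ _); ring.
have : x `^ H != 0 by rewrite gt_eqF// powR_gt0.
by move: (x `^ H) => z z0; field.
Qed.

Lemma lamperti_cov0E h : lamperti_cov h 0 =
  (expR (alpha * h) `^ H)^-1 * subfBm_cov (expR (alpha * h)) 1.
Proof.
rewrite /lamperti_cov !mulr0 oppr0 expR0 mulr1 expR_powR -expRN.
by rewrite (mulrAC alpha h H).
Qed.

Let le_sqr (x : R) : 1 <= x -> 1 <= x `^ (2 * H) <= x ^+ 2.
Proof.
move=> x1; have x0 : 0 <= x by exact: le_trans x1.
have h := @ler_powR _ x x1; rewrite -(powR_mulrn 2 x0) -[X in X <= _ <= _](powRr0 x).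
by move: H_gt0 H_lt1 => *; apply/andP; split; apply: h => //; lra.
Qed.

Let ge_sqr (x : R) : 0 <= x <= 1 -> x ^+ 2 <= x `^ (2 * H) <= 1.
Proof.
move=> /andP[x0 x1]; have [->|xn0] := eqVneq x 0.
  by rewrite powR0 ?expr0n ?lexx ?ler01// mulf_neq0// gt_eqF.
have xp : 0 < x by rewrite lt_neqAle eq_sym xn0.
have h : 0 < x <= 1 by rewrite xp.
have {}h := ger_powR h.
rewrite -(powR_mulrn 2 x0) -[X in _ <= _ <= X](powRr0 x).
by move: H_gt0 H_lt1 => *; apply/andP; split; apply: h => //; lra.
Qed.

(** As 0 < 2H < 2, the powers of 1 + y and 1 - y with y = 1 / x lie between 1 and the corresponding
    squares. The second difference is thus at most 2 y in absolute value, and x^H / x decays because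
    H < 1. *)
Lemma subfBm_cov_decay x : 1 <= x ->
  `|(x `^ H)^-1 * subfBm_cov x 1| <= (x `^ H)^-1 + 2 * (x `^ H * x^-1).
Proof.
move=> x1; have x0 : 0 < x by exact: lt_le_trans x1.
rewrite subfBm_cov1E//; apply: (le_trans (ler_normD _ _)).
have z0 : 0 < x `^ H by rewrite powR_gt0.
rewrite ger0_norm ?invr_ge0 ?(ltW z0)// lerD2l normrM (ger0_norm (ltW z0)) mulrCA.
rewrite ler_pM2l//.
have y1 : x^-1 <= 1 by rewrite invf_le1.
have y0 : 0 <= x^-1 by rewrite invr_ge0 ltW.
move: (x^-1) y0 y1 => y y0 y1.
have /andP[a1 a2] : 1 <= (1 + y) `^ (2 * H) <= (1 + y) ^+ 2 by apply: le_sqr; lra.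
have /andP[b1 b2] : (1 - y) ^+ 2 <= (1 - y) `^ (2 * H) <= 1 by apply: ge_sqr; lra.
have y2 : y ^+ 2 <= y by rewrite expr2 ler_piMr.
have y3 : 0 <= y ^+ 2 by exact: sqr_ge0.
move: a2 b1; rewrite sqrrD sqrrB !expr1n !mul1r.
move: (_ `^ _) (_ `^ _) a1 b2 => a b.
by rewrite ler_norml; lra.
Qed.

(** With z = x^H >= 1 one has z + 1/z >= 2, and 1/z <= 1 only lowers the subtracted terms. What
    remains is to bound the powers of x + 1 and x - 1, each halved. *)
Lemma subfBm_cov_cont x : 1 <= x <= 2 ->
  subfBm_cov 1 1 - (x `^ H)^-1 * subfBm_cov x 1 <=
  5 / 2 * (x - 1) + 2^-1 * (x - 1) `^ (2 * H).
Proof.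
move=> /andP[x1 x2]; have x0 : 0 < x by exact: lt_le_trans x1.
have e11 : subfBm_cov 1 1 = 2 - 2^-1 * 2 `^ (2 * H).
  rewrite /subfBm_cov subrr normr0 !powR1 powR0 ?addr0; first by [].
  by rewrite mulf_neq0// gt_eqF.
have ex : (x `^ H)^-1 * subfBm_cov x 1 = x `^ H + (x `^ H)^-1
    - 2^-1 * (x `^ H)^-1 * ((x + 1) `^ (2 * H) + (x - 1) `^ (2 * H)).
  rewrite /subfBm_cov powR1 (distrC 1 x) ger0_norm ?subr_ge0//.
  have -> : x `^ (2 * H) = x `^ H * x `^ H.
    by rewrite -powRD ?(gt_eqF x0) ?implybT//; congr (_ `^ _); ring.
  have : x `^ H != 0 by rewrite gt_eqF// powR_gt0.
  by move: (x `^ H) => z z0; field.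
have zz : 1 <= x `^ H by rewrite -(powRr0 x) ler_powR// ltW.
(* With v = x - 1 <= 1 and b = 2^(2H) <= 4, the bound b (1 + v/2)^2 = b + b v + b v^2 / 4 is at most
   b + 5 v. *)
have q : (x + 1) `^ (2 * H) <= 2 `^ (2 * H) + 5 * (x - 1).
  have -> : x + 1 = 2 * (1 + (x - 1) / 2) by field.
  rewrite powRM//; last by lra.
  have /andP[_ a2] : 1 <= (1 + (x - 1) / 2) `^ (2 * H) <= (1 + (x - 1) / 2) ^+ 2.
    by apply: le_sqr; lra.
  have /andP[b1 b2] : 1 <= (2 : R) `^ (2 * H) <= 2 ^+ 2 by apply: le_sqr; lra.
  apply: (le_trans (ler_wpM2l _ a2)); first by lra.
  move: (2 `^ _) b1 b2 => b b1 b2; set v := x - 1.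
  have v0 : 0 <= v by rewrite subr_ge0.
  have : (4 - b) * v >= 0 by rewrite mulr_ge0// subr_ge0; lra.
  have : b * v * (1 - v) >= 0 by rewrite !mulr_ge0// /v; lra.
  by lra.
rewrite e11 ex.
have p0 : 0 <= (x + 1) `^ (2 * H) by exact: powR_ge0.
have p1 : 0 <= (x - 1) `^ (2 * H) by exact: powR_ge0.
have am : 2 <= x `^ H + (x `^ H)^-1.
  move: (x `^ H) zz => z z1.
  rewrite -subr_ge0 (_ : _ - _ = (z - 1) ^+ 2 / z); last by field; lra.
  by rewrite divr_ge0 ?sqr_ge0//; lra.
have zi : (x `^ H)^-1 <= 1 by rewrite invf_le1// (lt_le_trans _ zz).
have : (x `^ H)^-1 * ((x + 1) `^ (2 * H) + (x - 1) `^ (2 * H)) <=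
   (x + 1) `^ (2 * H) + (x - 1) `^ (2 * H) by rewrite ler_piMl// addr_ge0.
rewrite -(mulrA 2^-1).
move: (_ * (_ + _)) => w.
move: am q; move: (2 `^ _) ((x + 1) `^ _) ((x - 1) `^ _) (x `^ H) (x `^ H)^-1 => *; lra.
Qed.

(** For x = exp(alpha |s - t|) the two terms of [subfBm_cov_decay] are x^(-H) and 2 x^(H-1). *)
Lemma lamperti_cov_le s t : `|lamperti_cov s t| <=
  expR (- (alpha * H * `|s - t|)) + 2 * expR (- (alpha * (1 - H) * `|s - t|)).
Proof.
rewrite lamperti_cov_dist; move: `|s - t| (normr_ge0 (s - t)) => h h0.
rewrite lamperti_cov0E.
have x1 : 1 <= expR (alpha * h) by rewrite -expR0 ler_expR mulr_ge0// ltW.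
apply: (le_trans (subfBm_cov_decay x1)).
rewrite expR_powR -!expRN -expRD lerD//.
  by rewrite ler_expR (mulrAC alpha h H).
by rewrite ler_pM2l// ler_expR le_eqVlt; apply/orP; left; apply/eqP; ring.
Qed.

Lemma lamperti_cov_bounded s t : `|lamperti_cov s t| <= 3.
Proof.
apply: (le_trans (lamperti_cov_le s t)).
have := normr_ge0 (s - t); move: `|s - t| => h h0.
have a1 : expR (- (alpha * H * h)) <= 1.
  by rewrite -expR0 ler_expR oppr_le0 !mulr_ge0// ltW.
have a2 : expR (- (alpha * (1 - H) * h)) <= 1.
  by rewrite -[leRHS]expR0 ler_expR oppr_le0 !mulr_ge0// ?subr_ge0 ltW.
by lra.
Qed.

Lemma lamperti_cov_decay : exists2 C, 0 <= C &
  forall s t, `|lamperti_cov s t| * `|s - t| <= C.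
Proof.
have h_exp c h : 0 < c -> expR (- (c * h)) * h <= c^-1.
  move=> c0; rewrite expRN ler_pdivrMl ?expR_gt0// ler_pdivlMr// mulrC.
  by apply: le_trans (expR_ge1Dx _); rewrite lerDr.
have aH : 0 < alpha * H by exact: mulr_gt0.
have aH1 : 0 < alpha * (1 - H) by rewrite mulr_gt0// subr_gt0.
exists ((alpha * H)^-1 + 2 * (alpha * (1 - H))^-1).
  by rewrite addr_ge0 ?mulr_ge0 ?invr_ge0 ?ltW.
move=> s t; apply: (le_trans (ler_wpM2r _ (lamperti_cov_le s t))) => //.
by rewrite mulrDl lerD ?h_exp// -(mulrA 2) ler_pM2l// h_exp.
Qed.

Lemma lamperti_cov_cont e : 0 < e -> exists2 de, 0 < de &
  forall s t, `|s - t| <= de -> lamperti_cov 0 0 - lamperti_cov s t <= e.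
Proof.
(* The three bounds place x = exp(alpha h) in [1, 2] and make each of (5/2) (x - 1) and (x - 1)^(2H)
   / 2 at most e / 2. *)
move=> e0; pose v := Num.min 1 (Num.min (e / 5) (e `^ (2 * H)^-1)).
have v0 : 0 < v by rewrite !lt_min ltr01 divr_gt0// powR_gt0.
exists (ln (1 + v) / alpha); first by rewrite divr_gt0// ln_gt0// ltrDl.
move=> s t; rewrite [lamperti_cov s t]lamperti_cov_dist.
move: `|s - t| (normr_ge0 (s - t)) => h h0; rewrite ler_pdivlMr// => hv.
rewrite !lamperti_cov0E mulr0 expR0 powR1 invr1 mul1r.
have x1 : 1 <= expR (alpha * h) by rewrite -expR0 ler_expR mulr_ge0// ltW.
have xv : expR (alpha * h) <= 1 + v.
  by rewrite -[leRHS]lnK ?posrE ?addr_gt0// ler_expR mulrC.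
have v1 : v <= 1 by rewrite ge_min lexx.
have v2 : v <= e / 5 by rewrite !ge_min lexx ?orbT.
have v3 : v <= e `^ (2 * H)^-1 by rewrite !ge_min lexx ?orbT.
apply: (le_trans (subfBm_cov_cont _)); first by rewrite x1; lra.
have H20 : 2 * H != 0 by rewrite mulf_neq0// gt_eqF.
have : (expR (alpha * h) - 1) `^ (2 * H) <= e.
  rewrite (_ : e = (e `^ (2 * H)^-1) `^ (2 * H)); last by rewrite -powRrM mulVf// powRr1// ltW.
  by apply: ge0_ler_powR; rewrite ?nnegrE ?powR_ge0 ?mulr_ge0 ?(ltW H_gt0) ?subr_ge0//; lra.
clearbody v; move: (expR _) x1 xv => z z1 zv; move: (_ `^ _) => w we.
by lra.
Qed.

End lamperti_covariance.

Lemma lamperti_cov_def (R : realType) (H alpha s t : R) :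
  lamperti_cov H alpha s t = expR (- (alpha * H * s)) * expR (- (alpha * H * t)) *
    subfBm_cov H (expR (alpha * s)) (expR (alpha * t)).
Proof. by []. Qed.

(* Conversion would otherwise unfold real powers and exponentials. *)
#[local] Opaque lamperti_cov.

(** The right side is the squared chord between the points of angles a and b on the unit circle; the
    left side is its horizontal part. *)
Lemma cos_dist_sqr (R : realType) (a b : R) : (cos a - cos b) ^+ 2 <= 2 * (1 - cos (a - b)).
Proof.
rewrite cosB -subr_ge0 (_ : _ - _ = (sin a - sin b) ^+ 2) ?sqr_ge0//.
have := cos2Dsin2 a; have := cos2Dsin2 b.
move: (cos a) (sin a) (cos b) (sin b) => ca sa cb sb hb ha.
have -> : 2 * (1 - (ca * cb + sa * sb)) =
  (ca ^+ 2 + sa ^+ 2) + (cb ^+ 2 + sb ^+ 2) - 2 * (ca * cb + sa * sb) by rewrite ha hb; ring.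
by ring.
Qed.

Lemma expR_sub1_norm (R : realType) (z : R) : `|expR z - 1| <= `|z| * expR `|z|.
Proof.
have h1 : expR z - 1 <= z * expR z.
  have := expR_ge1Dx (- z); rewrite expRN => h.
  have : (1 - z) * expR z <= 1 by rewrite -ler_pdivlMr ?expR_gt0// mul1r.
  by rewrite mulrBl mul1r; lra.
have h2 : z <= expR z - 1 by have := expR_ge1Dx z; lra.
have h3 : z * expR z <= `|z| * expR `|z|.
  by apply: (le_trans (ler_norm _)); rewrite normrM ler_wpM2l// ger0_norm ?expR_ge0// ler_expR ler_norm.
have h4 : `|z| <= `|z| * expR `|z| by rewrite ler_peMr// -[leLHS]expR0 ler_expR.
have := ler_norm (- z); rewrite normrN => h5.
by rewrite ler_norml; apply/andP; split; lra.
Qed.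

Lemma cosM (R : realType) (a b : R) : cos a * cos b = 2^-1 * (cos (a + b) + cos (a - b)).
Proof. by rewrite cosD cosB; lra. Qed.

(** From z <= e / 2 + z^2 / (2 e): this passes from an L^1 norm to a mean square without taking
    roots. *)
Lemma norm_le_weighted_sqr (R : realType) (e z c : R) : 0 < e -> z ^+ 2 <= 2 * (1 - c) ->
  z <= e / 2 + e^-1 - e^-1 * c.
Proof.
move=> e0 zc; rewrite (_ : e / 2 + _ - _ = (e ^+ 2 / 2 + (1 - c)) / e); last first.
  by field; rewrite gt_eqF.
by rewrite ler_pdivlMr//; have := sqr_ge0 (e - z); rewrite sqrrB; lra.
Qed.

Lemma weighted_sqr_le (R : realType) (e z y : R) : 0 < e -> z <= e ^+ 2 / 2 ->
  1 - z <= y -> e / 2 + e^-1 - e^-1 * y <= e.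
Proof.
move=> e0 ze yz; rewrite (_ : e / 2 + _ - _ = (e ^+ 2 / 2 + (1 - y)) / e); last first.
  by field; rewrite gt_eqF.
by rewrite ler_pdivrMr// -expr2; lra.
Qed.

(** * The Lamperti transform satisfies the hypotheses of the ergodic theorem *)

Section lamperti_process.
Context d (Omega : measurableType d) (R : realType) (P : probability Omega R).
Variables (H alpha : R) (SH : R -> Omega -> R).
Hypotheses (H_gt0 : 0 < H) (H_lt1 : H < 1) (alpha_gt0 : 0 < alpha)
  (SH_subfBm : subfBm P H SH) (SH_meas : jointly_measurable SH).

Local Notation X := (lamperti H alpha SH).
Local Notation r := (lamperti_cov H alpha).

Lemma measurable_lamperti : @measurable_fun _ _ (measurableTypeR R * Omega)%type
  (measurableTypeR R) setT (fun p => X p.1 p.2).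
Proof.
have me (k : R) : measurable_fun setT (fun x : R => expR (k * x)).
  by apply: continuous_measurable_fun => x; apply: continuous_comp;
    [exact: mulrl_continuous|exact: continuous_expR].
have m1 : @measurable_fun _ _ (measurableTypeR R * Omega)%type (measurableTypeR R) setT
    (fun p => expR (- (alpha * H * p.1))).
  rewrite (_ : (fun _ => _) = (fun x : R => expR (- (alpha * H) * x)) \o fst); last first.
    by apply/funext => p /=; rewrite mulNr.
  exact: (measurableT_comp (me _) measurable_fst).
apply: measurable_funM => //.
have mp : measurable_fun setT (fun p : measurableTypeR R * Omega => (expR (alpha * p.1), p.2)).
  apply/measurable_fun_pairP; split => /=; last exact: measurable_snd.
  exact: (measurableT_comp (me _) measurable_fst).
have mD : measurable ([set t : measurableTypeR R | 0 <= t] `*` [set: Omega]).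
  by apply: measurableX => //; rewrite -set_itvcy; exact: measurable_itv.
apply: (measurable_comp mD _ SH_meas mp) => _ [p _ <-] /=.
by split => //=; exact: expR_ge0.
Qed.

Lemma lamperti_cos th (l : seq (R * R)) :
  \int[P]_w cos (th + \sum_(p <- l) p.1 * X p.2 w) =
  cos th * expR (- (\sum_(p <- l) \sum_(q <- l) p.1 * q.1 * r p.2 q.2) / 2).
Proof.
case: SH_subfBm => gX m0 cX.
pose l' := [seq (p.1 * expR (- (alpha * H * p.2)), expR (alpha * p.2)) | p <- l].
have l'0 p : p \in l' -> 0 <= p.2 by move=> /mapP[q _ ->]; exact: expR_ge0.
transitivity (\int[P]_w cos (th + \sum_(p <- l') p.1 * SH p.2 w)).
  apply: eq_Rintegral => w _; rewrite big_map; congr (cos (_ + _)).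
  by apply: eq_bigr => p _; rewrite /= mulrA.
rewrite (gaussian_process_cos gX m0 cX th l'0) big_map; congr (_ * expR (- _ / 2)).
apply: eq_bigr => p _; rewrite big_map; apply: eq_bigr => q _ /=.
rewrite lamperti_cov_def /subfBm_cov; set B := (_ - _ * _); rewrite !mulrA.
by rewrite (mulrAC _ _ q.1).
Qed.

Lemma lamperti_cov_diag s : r s s = r 0 0.
Proof. by have := lamperti_cov_shift H alpha s 0 0; rewrite !add0r. Qed.

Lemma lamperti_cos1 th a s : \int[P]_w cos (th + a * X s w) =
  cos th * expR (- (a ^+ 2 * r 0 0) / 2).
Proof.
transitivity (\int[P]_w cos (th + \sum_(p <- [:: (a, s)]) p.1 * X p.2 w)).
  by apply: eq_Rintegral => w _; rewrite big_seq1.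
by rewrite lamperti_cos !big_seq1 /= lamperti_cov_diag expr2.
Qed.

Lemma lamperti_cos2 th a s b t : \int[P]_w cos (th + (a * X s w + b * X t w)) =
  cos th * expR (- ((a ^+ 2 + b ^+ 2) * r 0 0 + 2 * (a * b * r s t)) / 2).
Proof.
transitivity (\int[P]_w cos (th + \sum_(p <- [:: (a, s); (b, t)]) p.1 * X p.2 w)).
  by apply: eq_Rintegral => w _; rewrite !big_cons big_nil addr0.
have sumE (K : R -> R -> R) : K t s = K s t -> K s s = K 0 0 -> K t t = K 0 0 ->
    \sum_(p <- [:: (a, s); (b, t)]) \sum_(q <- [:: (a, s); (b, t)]) p.1 * q.1 * K p.2 q.2 =
    (a ^+ 2 + b ^+ 2) * K 0 0 + 2 * (a * b * K s t).
  by move=> h1 h2 h3; rewrite !big_cons !big_nil /= h1 h2 h3; ring.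
have e := sumE r (lamperti_covC H alpha t s) (lamperti_cov_diag s) (lamperti_cov_diag t).
by rewrite lamperti_cos e.
Qed.

Let cos_L1 (f : Omega -> R) : measurable_fun setT f -> L1 P setT (fun w => cos (f w)).
Proof.
move=> mf; apply: (prob_bounded_L1 P (K := 1)); last first.
  by move=> w /=; rewrite ler_norml cos_geN1 cos_le1.
by apply: measurableT_comp => //; apply: continuous_measurable_fun; exact: continuous_cos.
Qed.

Let mX s : measurable_fun setT (X s).
Proof. exact: (measurable_X measurable_lamperti). Qed.

(** The distance is controlled by the mean of 1 - cos(u (X_s - X_t)), which is 1 - exp(- u^2 (r(0) -
    r(s - t))); only an upper bound on r(0) - r is called for. *)
Lemma lamperti_cos_cont th u e : 0 < e -> exists2 de, 0 < de &
  forall s t, `|s - t| <= de ->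
    \int[P]_w `|cos (th + u * X s w) - cos (th + u * X t w)| <= e.
Proof.
(* With u^2 + 1 in place of u^2 the divisor stays positive at u = 0; the resulting bound is u^2
   (r(0) - r) <= e^2 / 2. *)
move=> e0; have u0 : 0 < 2 * (u ^+ 2 + 1) by rewrite mulr_gt0// ltr_wpDl// sqr_ge0.
have e1 : 0 < e ^+ 2 / (2 * (u ^+ 2 + 1)) by rewrite divr_gt0// exprn_gt0.
have [de de0 h] := lamperti_cov_cont H_gt0 H_lt1 alpha_gt0 e1.
exists de => // s t /h; rewrite ler_pdivlMr// => {}h.
have iA k v : L1 P setT (fun w => cos (th + v * X k w)) by apply: cos_L1; apply: measurable_funD => //; exact: measurable_funM.
have iD : L1 P setT (fun w => cos (0 + (u * X s w + (- u) * X t w))).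
  apply: cos_L1; apply: measurable_funD => //; apply: measurable_funD;
  exact: measurable_funM.
have i1 : L1 P setT (fun=> e / 2 + e^-1).
  by apply: (prob_bounded_L1 P (K := `|e / 2 + e^-1|)).
have i2 : L1 P setT (fun w => e^-1 * cos (0 + (u * X s w + (- u) * X t w))) by exact: L1Z.
apply: (@le_trans _ _ (\int[P]_w (e / 2 + e^-1 - e^-1 * cos (0 + (u * X s w + (- u) * X t w))))).
  apply: le_Rintegral => //; [by apply: L1_norm => //; exact: L1B|exact: L1B|].
  move=> w _; have := cos_dist_sqr (th + u * X s w) (th + u * X t w).
  rewrite opprD addrACA subrr mulNr.
  set z := cos (th + _) - _; set c := cos (0 + _); move: z c => z c zc.
  rewrite -(real_normK (num_real z)) in zc; move: `|z| zc => {}z zc.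
  exact: norm_le_weighted_sqr.
rewrite RintegralB// prob_Rint_cst RintegralZl// lamperti_cos2 cos0 mul1r.
rewrite (_ : - _ / 2 = - (u ^+ 2 * (r 0 0 - r s t))); last by move: (r 0 0) (r s t) => *; field.
have := expR_ge1Dx (- (u ^+ 2 * (r 0 0 - r s t))).
have : u ^+ 2 * (r 0 0 - r s t) <= e ^+ 2 / 2.
  have [h0|h0] := leP 0 (r 0 0 - r s t); first by move: h h0; move: (r 0 0 - r s t) => z; lra.
  rewrite (@le_trans _ _ 0) ?divr_ge0 ?sqr_ge0//.
  by rewrite mulr_ge0_le0 ?sqr_ge0// ltW.
move: (u ^+ 2 * _) => z ze; move: (expR _) => y yz.
exact: weighted_sqr_le e0 ze yz.
Qed.

(** By the product-to-sum formula the covariance of the cosines equals exp(- u^2 r(0)) / 2 times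
    cos(2 th) (exp(- u^2 r) - 1) + (exp(u^2 r) - 1). Since |r| <= 3, this is at most a constant
    times |r|, and |r| |s - t| is bounded. *)
Lemma lamperti_cos_mix th u : exists2 C, 0 <= C & forall s t,
  `|\int[P]_w ((cos (th + u * X s w) - \int[P]_w' cos (th + u * X 0 w')) *
               (cos (th + u * X t w) - \int[P]_w' cos (th + u * X 0 w')))| * `|s - t| <= C.
Proof.
have [C C0 hC] := lamperti_cov_decay H_gt0 H_lt1 alpha_gt0.
pose B := expR (- (u ^+ 2 * r 0 0)) * (u ^+ 2 * expR (3 * u ^+ 2)).
have B0 : 0 <= B by apply: mulr_ge0; [|apply: mulr_ge0]; rewrite ?expR_ge0 ?sqr_ge0.
exists (B * C); first exact: mulr_ge0.
move=> s t; apply: (@le_trans _ _ (B * `|r s t| * `|s - t|)); last first.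
  by rewrite -mulrA ler_wpM2l.
apply: ler_wpM2r => //.
have iA k : L1 P setT (fun w => cos (th + u * X k w)) by apply: cos_L1; apply: measurable_funD => //; exact: measurable_funM.
have i2 v k : L1 P setT (fun w => cos (k + (u * X s w + v * X t w))).
  by apply: cos_L1; apply: measurable_funD => //; apply: measurable_funD; exact: measurable_funM.
rewrite lamperti_cos1; set M := cos th * _.
have -> : \int[P]_w ((cos (th + u * X s w) - M) * (cos (th + u * X t w) - M)) =
   2^-1 * (\int[P]_w cos (2 * th + (u * X s w + u * X t w)) +
           \int[P]_w cos (0 + (u * X s w + (- u) * X t w))) - M ^+ 2.
  transitivity (\int[P]_w (2^-1 * (cos (2 * th + (u * X s w + u * X t w)) + cos (0 + (u * X s w + (- u) * X t w))) +
      (M ^+ 2 - M * (cos (th + u * X s w) + cos (th + u * X t w))))).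
    apply: eq_Rintegral => w _.
    have := cosM (th + u * X s w) (th + u * X t w).
    rewrite (_ : th + u * X s w + (th + u * X t w) = 2 * th + (u * X s w + u * X t w)); last by ring.
    rewrite (_ : th + u * X s w - (th + u * X t w) = 0 + (u * X s w + (- u) * X t w)); last by ring.
    by move: (cos _) (cos _) (cos _) (cos _) => a b c e h; rewrite -h; ring.
  have iM : L1 P setT (fun=> M ^+ 2) by apply: (prob_bounded_L1 P (K := `|M ^+ 2|)).
  have i3 : L1 P setT (fun w => cos (2 * th + (u * X s w + u * X t w)) + cos (0 + (u * X s w + (- u) * X t w))).
    exact: L1D.
  have i4 : L1 P setT (fun w => cos (th + u * X s w) + cos (th + u * X t w)) by exact: L1D.
  have i5 : L1 P setT (fun w => M * (cos (th + u * X s w) + cos (th + u * X t w))) by exact: L1Z.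
  rewrite RintegralD//; [|exact: L1Z|exact: L1B].
  rewrite RintegralZl// RintegralD// RintegralB// prob_Rint_cst RintegralZl// RintegralD//.
  by rewrite !lamperti_cos1 -/M; ring.
rewrite !lamperti_cos2 cos0 mul1r.
have e1 : expR (- ((u ^+ 2 + u ^+ 2) * r 0 0 + 2 * (u * u * r s t)) / 2) =
   expR (- (u ^+ 2 * r 0 0)) * expR (- (u ^+ 2 * r s t)).
  by rewrite -expRD; congr expR; move: (r 0 0) (r s t) => *; field.
have e2 : expR (- ((u ^+ 2 + (- u) ^+ 2) * r 0 0 + 2 * (u * - u * r s t)) / 2) =
   expR (- (u ^+ 2 * r 0 0)) * expR (u ^+ 2 * r s t).
  by rewrite -expRD; congr expR; move: (r 0 0) (r s t) => *; field.
have e3 : M ^+ 2 = cos th ^+ 2 * expR (- (u ^+ 2 * r 0 0)).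
  by rewrite /M exprMn [X in _ * X]expr2 -expRD; congr (_ * expR _); move: (r 0 0) => *; field.
have e5 : cos th ^+ 2 = 2^-1 * (1 + cos (2 * th)).
  by rewrite expr2 cosM subrr cos0 addrC (_ : 2 * th = th + th)//; ring.
rewrite e1 e2 e3 e5.
have alg (c E x y : R) : 2^-1 * (c * (E * x) + E * y) - 2^-1 * (1 + c) * E =
    E * (2^-1 * (c * (x - 1) + (y - 1))) by ring.
rewrite alg.
rewrite normrM ger0_norm ?expR_ge0// /B -(mulrA (expR _)) ler_wpM2l ?expR_ge0//.
have b1 := expR_sub1_norm (u ^+ 2 * r s t).
have b2 := expR_sub1_norm (- (u ^+ 2 * r s t)); rewrite normrN in b2.
have r3 := lamperti_cov_bounded H_gt0 H_lt1 alpha_gt0 s t.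
have ez : `|u ^+ 2 * r s t| * expR `|u ^+ 2 * r s t| <= u ^+ 2 * expR (3 * u ^+ 2) * `|r s t|.
  rewrite normrM (ger0_norm (sqr_ge0 u)).
  move: (u ^+ 2) (sqr_ge0 u) `|r s t| (normr_ge0 (r s t)) r3 => v v0 z z0 z3.
  rewrite mulrAC ler_wpM2r// ler_wpM2l// ler_expR (mulrC 3) ler_wpM2l//.
have b3 := le_trans b1 ez; have b4 := le_trans b2 ez.
rewrite normrM ger0_norm ?invr_ge0// ler_pdivrMl//.
apply: (le_trans (ler_normD _ _)).
have b5 : `|cos (2 * th) * (expR (- (u ^+ 2 * r s t)) - 1)| <= u ^+ 2 * expR (3 * u ^+ 2) * `|r s t|.
  by rewrite normrM (le_trans _ b4)// ler_piMl// ler_norml cos_geN1 cos_le1.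
by apply: (le_trans (lerD b5 b3)); rewrite (mulr_natl _ 2) mulr2n.
Qed.

Lemma lamperti_shift_cos b th s : \int[P]_w cos (th + lin_comb X b s w) =
  cos th * expR (- (\sum_(p <- s) \sum_(q <- s) p.1 * q.1 * r p.2 q.2) / 2).
Proof.
have sumE (K : R -> R -> R) : (forall c x y, K (x + c) (y + c) = K x y) ->
    \sum_(p <- [seq (p.1, p.2 + b%:R) | p <- s]) \sum_(q <- [seq (p.1, p.2 + b%:R) | p <- s])
      p.1 * q.1 * K p.2 q.2 =
    \sum_(p <- s) \sum_(q <- s) p.1 * q.1 * K p.2 q.2.
  move=> Kc; rewrite big_map; apply: eq_bigr => p _; rewrite big_map; apply: eq_bigr => q _ /=.
  by rewrite Kc.
have e := sumE r (fun c x y => lamperti_cov_shift H alpha c x y).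
rewrite -e -lamperti_cos; apply: eq_Rintegral => w _.
by rewrite /lin_comb big_map.
Qed.

Theorem lamperti_ergodic (f : R -> R) : measurable_fun setT f ->
  L1 P setT (fun w => f (X 0 w)) ->
  {ae P, forall w, (forall T, L1 (@lebesgue_measure R) `[0, T] (fun s => f (X s w))) /\
    average X f w T @[T --> +oo] --> \int[P]_w' f (X 0 w')}.
Proof.
move=> mf iff.
have shift th s : \int[P]_w cos (th + lin_comb X false s w) =
    \int[P]_w cos (th + lin_comb X true s w).
  exact: etrans (lamperti_shift_cos false th s) (esym (lamperti_shift_cos true th s)).
have law0 th u s : \int[P]_w cos (th + u * X s w) = \int[P]_w cos (th + u * X 0 w).
  exact: etrans (lamperti_cos1 th u s) (esym (lamperti_cos1 th u 0)).
exact: (ergodic_theorem measurable_lamperti shift law0 lamperti_cos_cont lamperti_cos_mix mf iff).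
Qed.

End lamperti_process.

(** * Time averages and reconstruction *)

Lemma cvg_complex (R : realType) (T : Type) (F : set_system T) (f : T -> R[i]) (l : R[i]) :
  Filter F ->
  (f t @[t --> F] --> (l : R[i]^o)) <->
  (complex.Re (f t) @[t --> F] --> complex.Re l) /\
  (complex.Im (f t) @[t --> F] --> complex.Im l).
Proof.
move=> FF.
have ReB (a b : R[i]) : complex.Re (a - b) = complex.Re a - complex.Re b by case: a; case: b.
have ImB (a b : R[i]) : complex.Im (a - b) = complex.Im a - complex.Im b by case: a; case: b.
split.
- move=> /(@cvgrPdist_lt R[i] (R[i]^o) T F FF f l) fl.
  have aux (g : R[i] -> R) : (forall a b, g (a - b) = g a - g b) ->
      (forall z, (`|g z|%:C <= `|z|)%C) -> g (f t) @[t --> F] --> g l.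
    move=> gB gle; apply/cvgrPdist_lt => e e0.
    have e0' : (0 < e%:C)%C by rewrite ltcR.
    apply: filterS (fl _ e0') => t h; rewrite -gB -ltcR.
    exact: le_lt_trans (gle _) h.
  split; apply: aux => //; first exact: normc_ge_Re.
  move=> z; rewrite normc_def lecR -sqrtr_sqr ler_wsqrtr// lerDr sqr_ge0//.
(* A positive element of [R[i]] is real, so the imaginary part of the given radius vanishes. *)
- move=> [/cvgrPdist_lt fr /cvgrPdist_lt fi]; apply/(@cvgrPdist_lt R[i] (R[i]^o) T F FF f l) => -[e e'].
  rewrite ltcE /= => /andP[/eqP -> e0].
  have e2 : 0 < e / 2 by rewrite divr_gt0.
  apply: filterS2 (fr _ e2) (fi _ e2) => t hr hi.
  have le (z : R[i]) : (`|z| <= (`|complex.Re z| + `|complex.Im z|)%:C)%C.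
    rewrite normc_def lecR -(@ler_pXn2r _ 2) ?nnegrE ?sqrtr_ge0 ?addr_ge0//.
    rewrite sqr_sqrtr ?addr_ge0 ?sqr_ge0// sqrrD !real_normK ?num_real//.
    by rewrite -addrA lerD2l lerDr mulrn_wge0// mulr_ge0.
  apply: (le_lt_trans (le _)); rewrite ltcR ReB ImB [e]splitr.
  exact: ltrD.
Qed.

Lemma ctime_avgE (R : realType) (x : R -> R[i]) (T : R) : ctime_avg x T =
  Complex (T^-1 * \int[lebesgue_measure]_(s in `[0, T]) complex.Re (x s))
          (T^-1 * \int[lebesgue_measure]_(s in `[0, T]) complex.Im (x s)).
Proof.
by rewrite /ctime_avg /cintegral; apply/eqP; rewrite eq_complex /= !mul0r subr0 addr0 !eqxx.
Qed.

Lemma cvg_time_avg (R : realType) (x : R -> R) (l : R) :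
  (forall T, L1 (@lebesgue_measure R) `[0, T] x) ->
  T^-1 * \int[lebesgue_measure]_(s in `[0, T]) x s @[T --> +oo] --> l ->
  time_avg x T @[T --> +oo] --> l%:E.
Proof.
move=> ix xl; have : (T^-1 * \int[lebesgue_measure]_(s in `[0, T]) x s)%:E @[T --> +oo] --> l%:E.
  by apply: cvg_EFin; [exact: nearW|exact: xl].
apply: cvg_eq1 => T; rewrite /time_avg EFinM /Rintegral fineK//.
exact: (integrable_fin_num _ (ix T)).
Qed.

Lemma expectation_Rintegral d (Omega : measurableType d) (R : realType)
    (P : probability Omega R) (X : Omega -> R) : L1 P setT X ->
  'E_P[X]%E = (\int[P]_w X w)%:E.
Proof. by move=> iX; rewrite unlock /Rintegral fineK//; exact: (integrable_fin_num _ iX). Qed.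

Lemma cos_lipschitz (R : realType) (a b : R) : `|cos a - cos b| <= `|a - b|.
Proof.
wlog ab : a b / a < b.
  move=> h; case: (ltgtP a b) => [/h//|/h|->]; last by rewrite !subrr.
  by rewrite distrC (distrC a).
have [|c _ e] := @MVT R (fun x => cos x) (fun x => - sin x) a b ab.
  by apply: continuous_subspaceT => x; exact: continuous_cos.
rewrite distrC e normrM normrN distrC ler_piMl//.
exact: sin_max.
Qed.

Lemma cosBpihalf (R : realType) (x : R) : cos (- (pi / 2) + x) = sin x.
Proof. by rewrite cosD cosN sinN cos_pihalf sin_pihalf; ring. Qed.

Section lamperti_averages.
Context d (Omega : measurableType d) (R : realType) (P : probability Omega R).
Variables (H alpha : R) (SH : R -> Omega -> R).
Hypotheses (H_gt0 : 0 < H) (H_lt1 : H < 1) (alpha_gt0 : 0 < alpha)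
  (SH_subfBm : subfBm P H SH) (SH_meas : jointly_measurable SH).

Local Notation X := (lamperti H alpha SH).
Local Notation leb := (@lebesgue_measure R).

Let ergodic := lamperti_ergodic H_gt0 H_lt1 alpha_gt0 SH_subfBm SH_meas.

Let mX s : @measurable_fun _ _ Omega (measurableTypeR R) setT (X s).
Proof. exact: (measurable_X (measurable_lamperti H alpha SH_meas)). Qed.

Lemma lamperti_moment s k : L1 P setT (fun w => X s w ^+ k).
Proof.
case: SH_subfBm => gX _ _.
have := L1Z measurableT (expR (- (alpha * H * s)) ^+ k)
  (gaussian_process_moment gX k (expR_ge0 (alpha * s))).
by apply: L1_eq => // w _; rewrite /lamperti exprMn.
Qed.

Lemma lamperti_moment_stationary s k :
  \int[P]_w X s w ^+ k = \int[P]_w X 0 w ^+ k.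
Proof.
have mk : measurable_fun setT (fun x : R => x ^+ k) by exact: measurable_funX.
rewrite -(Rintegral_law (mX s) mk); last exact: lamperti_moment.
rewrite -(Rintegral_law (mX 0) mk); last exact: lamperti_moment.
rewrite /Rintegral; congr fine; apply: eq_measure_integral => B mB _.
apply: cos_law mB => th u.
exact: etrans (lamperti_cos1 alpha SH_subfBm th u s) (esym (lamperti_cos1 alpha SH_subfBm th u 0)).
Qed.

Lemma lampertiK t w : 0 < t -> SH t w = t `^ H * X (ln t / alpha) w.
Proof.
move=> t0; rewrite /lamperti (mulrC alpha (ln t / alpha)) divfK ?gt_eqF// lnK ?posrE//.
rewrite /powR gt_eqF// mulrA -expRD (_ : H * ln t + _ = 0) ?expR0 ?mul1r//.
by field; rewrite gt_eqF.
Qed.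

Lemma lamperti_time_avg (f : R -> R) : measurable_fun setT f ->
  L1 P setT (fun w => f (X 0 w)) ->
  {ae P, forall w, time_avg (fun s => f (X s w)) T @[T --> +oo] -->
    'E_P[fun w' => f (X 0 w')]%E}.
Proof.
move=> mf iff; apply: filterS (ergodic mf iff) => w [ifw fw].
by rewrite expectation_Rintegral//; exact: cvg_time_avg.
Qed.

Lemma lamperti_ctime_avg (f : R -> R[i]) : cmeasurable f ->
  cintegrable P setT (fun w => f (X 0 w)) ->
  {ae P, forall w,
    (forall t, 0 < t -> cintegrable leb `[0, t] (fun s => f (X s w))) /\
    ctime_avg (fun s => f (X s w)) T @[T --> +oo]
      --> (cintegral P setT (fun w' => f (X 0 w')) : R[i]^o)}.
Proof.
move=> [mr mi] [ir ii]; apply: filterS2 (ergodic mr ir) (ergodic mi ii) => w [r1 r2] [i1 i2].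
split; first by move=> t _; split; [exact: r1|exact: i1].
by apply/cvg_complex; split; [apply: cvg_eq1 r2|apply: cvg_eq1 i2] => T; rewrite ctime_avgE.
Qed.

(* The exceptional set is chosen for rational frequencies; the others are
   reached because the time averages of |X| stay bounded. *)
Lemma lamperti_cos_time_avg th : {ae P, forall w, forall u : R,
  average X (fun x => cos (th + u * x)) w T @[T --> +oo] -->
    \int[P]_w' cos (th + u * X 0 w')}.
Proof.
pose good u w := (forall T, L1 leb `[0, T] (fun s => cos (th + u * X s w))) /\
  average X (fun x => cos (th + u * x)) w T @[T --> +oo] --> \int[P]_w' cos (th + u * X 0 w').
have goodu u : {ae P, forall w, good u w}.
  by apply: ergodic; [exact: measurable_cosD|exact: cosD_L1].
have goodq : {ae P, forall w, forall q : rat, good (ratr q) w}.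
  have : {ae P, forall w, forall n, if unpickle n is Some q then good (ratr (q : rat)) w else True}.
    by apply/ae_foralln => n; case: unpickle => [q|]; [exact: goodu|exact: aeW].
  by apply: filterS => w h q; have := h (pickle q); rewrite pickleK.
have iX : L1 P setT (fun w => `|X 0 w|).
  by apply: L1_norm => //; apply: L1_eq (lamperti_moment 0 1) => // w _; rewrite expr1.
have goodn := ergodic (f := fun x => `|x|) (@normr_measurable _ _) iX.
apply: filterS2 goodq goodn => w gq [iw cw] u.
set m := \int[P]_w' `|X 0 w'| in cw.
have m0 : 0 <= m by exact: Rintegral_ge0.
apply/cvgrPdist_le => e e0.
(* Eventually the time average of |X| is at most m + 1, so replacing u by a rational within [de]
   costs at most e / 4, both in the average and in the expectation. *)
pose de := e / (4 * (m + 1)).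
have m1 : 0 < m + 1 by rewrite ltr_wpDl.
have de0 : 0 < de by rewrite divr_gt0// mulr_gt0.
have dem : de * (m + 1) = e / 4 by rewrite /de; field; rewrite gt_eqF.
have [q] := @rat_in_itvoo R (u - de) (u + de) ltac:(by rewrite ltrD2l; lra).
rewrite in_itv/= => /andP[q1 q2]; have uq : `|u - ratr q| <= de by rewrite ler_norml; lra.
have lip x : `|cos (th + u * x) - cos (th + ratr q * x)| <= de * `|x|.
  apply: (le_trans (cos_lipschitz _ _)).
  by rewrite opprD addrACA subrr add0r -mulrBl normrM ler_wpM2r.
have Euq : `|\int[P]_w' cos (th + u * X 0 w') - \int[P]_w' cos (th + ratr q * X 0 w')| <= e / 4.
  rewrite -RintegralB//; [|exact: cosD_L1|exact: cosD_L1].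
  apply: (@le_trans _ _ (\int[P]_w' (de * `|X 0 w'|))).
    by apply: le_Rint_norm => //; [apply: L1B => //; exact: cosD_L1|exact: L1Z].
  by rewrite RintegralZl// -/m -dem ler_pM2l// lerDl.
have [_ /cvgrPdist_le/(_ (e / 4) ltac:(by rewrite divr_gt0)) cq] := gq q.
move/cvgrPdist_le : cw => /(_ 1 ltr01) cw.
have bm v : bounded_measurable (fun x : R => cos (th + v * x)).
  by split; [exact: measurable_cosD|exists 1 => x; rewrite ler_norml cos_geN1 cos_le1].
have iv v T : L1 leb `[0, T] (fun s => cos (th + v * X s w)).
  exact: (bounded_path_L1 (measurable_lamperti H alpha SH_meas) 0 T w (bm v)).
near=> T.
have T0 : 0 < T by near: T; exact: nbhs_pinfty_gt.
have hq : `|\int[P]_w' cos (th + ratr q * X 0 w') - average X (fun x => cos (th + ratr q * x)) w T| <= e / 4.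
  by near: T.
have hm : `|m - average X (fun x => `|x|) w T| <= 1 by near: T.
have hT : `|average X (fun x => cos (th + u * x)) w T - average X (fun x => cos (th + ratr q * x)) w T| <= e / 4.
  rewrite /average -mulrBr -RintegralB// normrM gtr0_norm ?invr_gt0//.
  apply: (@le_trans _ _ (T^-1 * \int[leb]_(s in `[0, T]) (de * `|X s w|))).
    rewrite ler_pM2l ?invr_gt0//; apply: le_Rint_norm => //; [exact: L1B|].
    exact: (L1Z _ de (iw T)).
  rewrite RintegralZl//.
  rewrite mulrCA -dem ler_pM2l//.
  by move: hm; rewrite /average ler_norml; lra.
have -> : \int[P]_w' cos (th + u * X 0 w') - average X (fun x => cos (th + u * x)) w T =
  (\int[P]_w' cos (th + u * X 0 w') - \int[P]_w' cos (th + ratr q * X 0 w')) +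
  (\int[P]_w' cos (th + ratr q * X 0 w') - average X (fun x => cos (th + ratr q * x)) w T) -
  (average X (fun x => cos (th + u * x)) w T - average X (fun x => cos (th + ratr q * x)) w T) by ring.
apply: (le_trans (ler_normB _ _)).
apply: le_trans (lerD (ler_normD _ _) (lexx _)) _.
apply: le_trans (lerD (lerD Euq hq) hT) _.
by lra.
Unshelve. all: by end_near. Qed.

(** Every phase is recovered from 0 and - pi / 2, that is, from the real and imaginary parts of the
    characteristic function. *)
Lemma Rint_cosD d' (Omega' : measurableType d') (Q : probability Omega' R)
    (Z : Omega' -> measurableTypeR R) th u : measurable_fun setT Z ->
  \int[Q]_w cos (th + u * Z w) =
  cos th * \int[Q]_w cos (0 + u * Z w) - sin th * \int[Q]_w cos (- (pi / 2) + u * Z w).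
Proof.
move=> mZ; have iZ th' := cosD_L1 Q th' u mZ.
rewrite -!RintegralZl// -RintegralB//; [|exact: L1Z|exact: L1Z].
by apply: eq_Rintegral => w _; rewrite cosBpihalf add0r cosD.
Qed.

Lemma measurable_SH t : 0 < t -> @measurable_fun _ _ Omega (measurableTypeR R) setT (SH t).
Proof.
move=> t0; rewrite (_ : SH t = fun w => t `^ H * X (ln t / alpha) w); last first.
  by apply/funext => w; exact: lampertiK.
by apply: measurable_funM => //; exact: mX.
Qed.

Lemma Rint_cos_SH t th u : 0 < t ->
  \int[P]_w cos (th + u * SH t w) = \int[P]_w cos (th + u * t `^ H * X 0 w).
Proof.
move=> t0; transitivity (\int[P]_w cos (th + u * t `^ H * X (ln t / alpha) w)).
  by apply: eq_Rintegral => w _; rewrite lampertiK// mulrA.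
exact: etrans (lamperti_cos1 alpha SH_subfBm th _ _) (esym (lamperti_cos1 alpha SH_subfBm th _ 0)).
Qed.

Lemma SH_moment k t : 0 < t -> 'E_P[fun w => (SH t w ^+ k)%R]%E =
  ((t `^ (k%:R * H))%:E * 'E_P[fun w => (X 0 w ^+ k)%R])%E.
Proof.
move=> t0; have iX s := lamperti_moment s k.
have e w : SH t w ^+ k = t `^ (k%:R * H) * X (ln t / alpha) w ^+ k.
  by rewrite lampertiK// exprMn (mulrC k%:R) powRrM powR_mulrn ?powR_ge0.
have -> : (fun w => SH t w ^+ k) = (fun w => t `^ (k%:R * H) * X (ln t / alpha) w ^+ k).
  exact/funext.
rewrite !expectation_Rintegral//; last exact: L1Z.
by rewrite (RintegralZl _ measurableT (iX _)) (lamperti_moment_stationary (ln t / alpha) k) EFinM.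
Qed.

(** The scale t^H only changes the frequency into u t^H. Convergence at all frequencies along one
    trajectory therefore covers all t at once. *)
Lemma lamperti_cexpi_cvg w t u : 0 < t ->
  (forall v, average X (fun x => cos (0 + v * x)) w T @[T --> +oo] -->
    \int[P]_w' cos (0 + v * X 0 w')) ->
  (forall v, average X (fun x => cos (- (pi / 2) + v * x)) w T @[T --> +oo] -->
    \int[P]_w' cos (- (pi / 2) + v * X 0 w')) ->
  ctime_avg (fun s => cexpi (u * (t `^ H * X s w))) T @[T --> +oo] -->
    (Complex (\int[P]_w' cos (0 + u * SH t w')) (\int[P]_w' cos (- (pi / 2) + u * SH t w')) : R[i]^o).
Proof.
move=> t0 c1 c2; apply/cvg_complex; split; rewrite /= Rint_cos_SH//.
- apply: cvg_eq1 (c1 (u * t `^ H)) => T; rewrite mul0r subr0 /average; congr (_ * _).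
  by apply: eq_Rintegral => s _; rewrite add0r mulrA.
- apply: cvg_eq1 (c2 (u * t `^ H)) => T; rewrite mul0r addr0 /average; congr (_ * _).
  by apply: eq_Rintegral => s _; rewrite cosBpihalf mulrA.
Qed.

(** The averages converge to the characteristic function of [SH t] by [lamperti_cexpi_cvg]. If they
    also converge to that of [mu], uniqueness of limits identifies the two functions, and [cos_law]
    the two laws. The null set is chosen before [t] and [mu]. *)
Lemma lamperti_reconstruction : {ae P, forall w, forall t, 0 < t ->
  forall mu : probability R R,
  (forall u, ctime_avg (fun s => cexpi (u * (t `^ H * X s w))) T @[T --> +oo]
     --> (cintegral mu setT (fun x => cexpi (u * x)) : R[i]^o)) <->
  (forall A : set R, measurable A -> mu A = P (SH t @^-1` A))}.
Proof.
apply: filterS2 (lamperti_cos_time_avg 0) (lamperti_cos_time_avg (- (pi / 2))) => w c1 c2 t t0 mu.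
have cvgP u := lamperti_cexpi_cvg (u := u) t0 c1 c2.
have mid : @measurable_fun _ _ R (measurableTypeR R) setT (idfun : R -> R) by exact: measurable_id.
have Emu th u : \int[law mu mid]_x cos (th + u * x) = \int[mu]_x cos (th + u * x).
  by rewrite Rintegral_law//; [exact: measurable_cosD|exact: (cosD_L1 mu th u mid)].
have Emu' u : cintegral mu setT (fun x => cexpi (u * x)) =
    Complex (\int[mu]_x cos (0 + u * x)) (\int[mu]_x cos (- (pi / 2) + u * x)).
  rewrite /cintegral /=; congr Complex; apply: eq_Rintegral => x _.
    by rewrite add0r.
  by rewrite cosBpihalf.
have mS := measurable_SH t0.
split=> [cmu A mA|muA u].
- have h := @cos_law _ _ _ _ _ mu P idfun (SH t) mid mS.
  apply: (h _ A mA) => th u.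
  have /cvg_complex[r1 i1] := cmu u; have /cvg_complex[r2 i2] := cvgP u.
  rewrite (Rint_cosD mu th u mid) (Rint_cosD P th u mS).
  move: r1 i1; rewrite Emu' => r1 i1.
  have /= re := cvg_unique (@norm_hausdorff _ R) r1 r2.
  have /= ie := cvg_unique (@norm_hausdorff _ R) i1 i2.
  by rewrite re ie.
- rewrite Emu'; have E th : \int[mu]_x cos (th + u * x) = \int[P]_w' cos (th + u * SH t w').
    rewrite -Emu -(Rintegral_law mS (measurable_cosD th u)); last exact: cosD_L1.
    rewrite /Rintegral; congr fine; apply: eq_measure_integral => B mB _.
    exact: (muA B mB).
  by rewrite !E.
Qed.

Lemma cexpi_measurable u : cmeasurable (fun x : R => cexpi (u * x)).
Proof.
split => /=.
  by have := measurable_cosD 0 u; under eq_fun do rewrite add0r.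
by have := measurable_cosD (- (pi / 2)) u; under eq_fun do rewrite cosBpihalf.
Qed.

Lemma lamperti_cexpi_time_avg u : {ae P, forall w,
  ctime_avg (fun s => cexpi (u * X s w)) T @[T --> +oo]
    --> (cintegral P setT (fun w' => cexpi (u * X 0 w')) : R[i]^o)}.
Proof.
apply: filterS (lamperti_ctime_avg (cexpi_measurable u) _) => [w []//|].
split => /=.
  by apply: L1_eq (cosD_L1 P 0 u (mX 0)) => // w _; rewrite add0r.
by apply: L1_eq (cosD_L1 P (- (pi / 2)) u (mX 0)) => // w _; rewrite cosBpihalf.
Qed.

End lamperti_averages.

Unset Implicit Arguments.

Theorem corollary2p9 (R : realType) (d : measure_display)
    (Omega : measurableType d) (P : probability Omega R)
    (H alpha : R) (SH : R -> Omega -> R)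
    (H_gt0 : 0 < H) (H_lt1 : H < 1) (alpha_gt0 : 0 < alpha)
    (SH_subfBm : subfBm P H SH) (SH_meas : jointly_measurable SH) :
  let SLT := lamperti H alpha SH in
  (forall f : R -> R, measurable_fun setT f ->
     P.-integrable setT (fun w => (f (SLT 0 w))%:E) ->
     {ae P, forall w,
       time_avg (fun s => f (SLT s w)) t @[t --> +oo]
         --> 'E_P[fun w' => f (SLT 0%R w')]%E}) /\
  (forall f : R -> R[i], cmeasurable f ->
     cintegrable P setT (fun w => f (SLT 0 w)) ->
     {ae P, forall w,
       (forall t, 0 < t ->
          cintegrable lebesgue_measure `[0, t] (fun s => f (SLT s w))) /\
       ctime_avg (fun s => f (SLT s w)) t @[t --> +oo]
         --> (cintegral P setT (fun w' => f (SLT 0 w')) : R[i]^o)}) /\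
  (* the exponent of t is H: SLT (ln t / alpha) = t `^ (- H) * SH t *)
  (forall t w, 0 < t -> SH t w = t `^ H * SLT (ln t / alpha) w) /\
  (forall k : nat, (1 <= k)%N ->
     {ae P, forall w,
       time_avg (fun s => SLT s w ^+ k) t @[t --> +oo]
         --> 'E_P[fun w' => (SLT 0 w' ^+ k)%R]%E}) /\
  (forall (k : nat) (t : R), (1 <= k)%N -> 0 < t ->
     'E_P[fun w => (SH t w ^+ k)%R]%E
       = ((t `^ (k%:R * H))%:E * 'E_P[fun w => (SLT 0 w ^+ k)%R])%E) /\
  (forall u : R,
     {ae P, forall w,
       ctime_avg (fun s => cexpi (u * SLT s w)) t @[t --> +oo]
         --> (cintegral P setT (fun w' => cexpi (u * SLT 0 w')) : R[i]^o)}) /\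
  (* almost every single trajectory determines all one-time laws of SH: the
     law of SH t is the only one whose characteristic function is the limit of
     the time averages along t `^ H * SLT *)
  {ae P, forall w, forall t : R, 0 < t -> forall mu : probability R R,
     (forall u : R,
        ctime_avg (fun s => cexpi (u * (t `^ H * SLT s w))) T @[T --> +oo]
          --> (cintegral mu setT (fun x => cexpi (u * x)) : R[i]^o)) <->
     (forall A : set R, measurable A -> mu A = P (SH t @^-1` A))}.
Proof.
move=> SLT.
split; first exact: (lamperti_time_avg H_gt0 H_lt1 alpha_gt0 SH_subfBm SH_meas).
split; first exact: (lamperti_ctime_avg H_gt0 H_lt1 alpha_gt0 SH_subfBm SH_meas).
split; first by move=> t w; exact: lampertiK.
split.
  move=> k _.
  apply: (lamperti_time_avg H_gt0 H_lt1 alpha_gt0 SH_subfBm SH_meas (f := fun x => x ^+ k)).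
    exact: measurable_funX.
  exact: lamperti_moment.
split; first by move=> k t _; exact: SH_moment.
split; first exact: (lamperti_cexpi_time_avg H_gt0 H_lt1 alpha_gt0 SH_subfBm SH_meas).
exact: (lamperti_reconstruction H_gt0 H_lt1 alpha_gt0 SH_subfBm SH_meas).
Qed.
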